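(* Let $\delta\in\,]0,1[$, and let $B\subset\mathbb{R}^5$ be the unit ball centred at the origin. For every sufficiently large positive constant $c$ (that is, for every $c\ge c_0$ with some $c_0=c_0(\delta)>0$), the function $$u(x):=c+\frac{P_5(x)}{|x|^{1+\delta}},\qquad u(0):=c,$$ is a viscosity solution in $B$ of a uniformly elliptic conformal Hessian equation $f(\lambda(A^u))=0$; i.e. there exists a function $f:\mathbb{R}^5\to\mathbb{R}$, Lipschitz, invariant under permutations of the coordinates and uniformly elliptic, such that $u$ is a viscosity solution of $f(\lambda(A^u))=0$ in $B$. Moreover, for $\delta=\tfrac12$ the constant $c=240000$ is sufficient.
   Context: Write $x=(x_1,x_2,z_1,z_2,z_3)\in\mathbb{R}^5$. The Cartan isoparametric cubic form is $$P_5(x)=x_1^3+\frac{3x_1}{2}\left(z_1^2+z_2^2-2z_3^2-2x_2^2\right)+\frac{3\sqrt3}{2}\left(x_2z_1^2-x_2z_2^2+2z_1z_2z_3\right).$$ For a function $u>0$ on a domain of $\mathbb{R}^n$ ($n\ge 3$; here $n=5$), the conformal Hessian is $$A^u:=u\,D^2u-\tfrac12|Du|^2 I_n,$$ and $\lambda(A^u)=(\lambda_1,\dots,\lambda_n)$ denotes its eigenvalues. A conformal Hessian equation here is an equation $F(D^2u,Du,u)=0$ with $F(D^2u,Du,u)=f(\lambda(A^u))$, where $f$ is a Lipschitz function on $\mathbb{R}^n$ invariant under permutations of the coordinates. It is uniformly elliptic if there is a constant $C\ge1$ such that, writing $\tilde f(A):=f(\lambda(A))$ for a symmetric $n\times n$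 matrix $A$, $$C^{-1}\|N\|\le \tilde f(A+N)-\tilde f(A)\le C\|N\|$$ for all symmetric $A$ and all non-negative definite symmetric $N$. Viscosity solution has the usual meaning: a continuous $u>0$ is a viscosity solution in $B$ if, for every $x_0\in B$ and every $C^2$ function $\varphi$ near $x_0$ with $\varphi(x_0)=u(x_0)$, one has $f(\lambda(A^\varphi(x_0)))\ge 0$ whenever $u-\varphi$ has a local maximum at $x_0$, and $f(\lambda(A^\varphi(x_0)))\le 0$ whenever $u-\varphi$ has a local minimum at $x_0$. *)

(* Defs.v *)
From mathcomp Require Import all_boot all_order all_algebra all_fingroup.
From mathcomp Require Import all_classical all_reals all_analysis.

Set Implicit Arguments.
Unset Strict Implicit.
Unset Printing Implicit Defensive.

Import Order.TTheory GRing.Theory Num.Theory.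
Import numFieldNormedType.Exports.

Local Open Scope classical_set_scope.
Local Open Scope ring_scope.

Section Euclidean.
Context {R : realType} {n : nat}.
Implicit Types (x v : 'rV[R]_n) (A N : 'M[R]_n).

(* The library norm `|x| on matrices is the sup norm, hence this definition. *)
Definition enorm x : R := Num.sqrt (\sum_i x 0 i ^+ 2).

Definition unit_ball : set 'rV[R]_n := [set x | enorm x < 1].

Definition opnorm A : R := sup [set enorm (x *m A) | x in [set x | enorm x <= 1]].

Definition symmetric A : Prop := A^T = A.

Definition nonneg_definite A : Prop := forall v, 0 <= (v *m A *m v^T) 0 0.

(* The eigenvalues of A with multiplicity, in an unspecified order. The
   characteristic polynomial of a real symmetric matrix splits over R, so the
   default value of xget is never used for symmetric A. *)
Definition eigenvalues A : 'rV[R]_n :=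
  xget 0 [set l : 'rV[R]_n | char_poly A = \prod_i ('X - (l 0 i)%:P)].

End Euclidean.

Section Calculus.
Context {R : realType} {n : nat}.
Implicit Types (u phi : 'rV[R]_n -> R) (x : 'rV[R]_n).

Definition partial (i : 'I_n) u : 'rV[R]_n -> R :=
  fun x => 'D_(delta_mx 0 i) u x.

Definition gradient u x : 'rV[R]_n := \row_i partial i u x.

Definition hessian u x : 'M[R]_n := \matrix_(i, j) partial i (partial j u) x.

Definition C1_at u x : Prop :=
  forall i, derivable u x (delta_mx 0 i) /\ {for x, continuous (partial i u)}.

Definition C2_near u x0 : Prop :=
  \forall x \near x0, C1_at u x /\ forall j, C1_at (partial j u) x.

Definition conformal_hessian u x : 'M[R]_n :=
  u x *: hessian u x - (2^-1 * enorm (gradient u x) ^+ 2)%:M.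

End Calculus.

Section ConformalHessianEquation.
Context {R : realType} {n : nat}.
Implicit Types (f u : 'rV[R]_n -> R) (B : set 'rV[R]_n).

Definition permutation_invariant f : Prop :=
  forall (s : 'S_n) l, f (col_perm s l) = f l.

Definition uniformly_elliptic f : Prop :=
  exists2 C : R, 1 <= C & forall A N : 'M[R]_n,
    symmetric A -> symmetric N -> nonneg_definite N ->
    C^-1 * opnorm N <= f (eigenvalues (A + N)) - f (eigenvalues A)
                    <= C * opnorm N.

Definition viscosity_solution f B u : Prop :=
  [/\ {in B, continuous u}, (forall x, B x -> 0 < u x) &
      forall (x0 : 'rV[R]_n) (phi : 'rV[R]_n -> R),
        B x0 -> C2_near phi x0 -> phi x0 = u x0 ->
        ((\forall x \near x0, u x - phi x <= u x0 - phi x0) ->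
           0 <= f (eigenvalues (conformal_hessian phi x0))) /\
        ((\forall x \near x0, u x0 - phi x0 <= u x - phi x) ->
           f (eigenvalues (conformal_hessian phi x0)) <= 0)].

Definition solves_elliptic_conformal_hessian B u : Prop :=
  exists f, [/\ lipschitz f, permutation_invariant f, uniformly_elliptic f &
                viscosity_solution f B u].

End ConformalHessianEquation.

(* The column indices are elements of 'I_5 = Z/5Z, so that
   x = (x 0 0, ..., x 0 4) stands for (x1, x2, z1, z2, z3). *)
Definition cartan_cubic {R : realType} (x : 'rV[R]_5) : R :=
  let x1 := x 0 0 in let x2 := x 0 1 in
  let z1 := x 0 2 in let z2 := x 0 3 in let z3 := x 0 4 in
  x1 ^+ 3
  + 3 * x1 / 2 * (z1 ^+ 2 + z2 ^+ 2 - 2 * z3 ^+ 2 - 2 * x2 ^+ 2)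
  + 3 * Num.sqrt 3 / 2 * (x2 * z1 ^+ 2 - x2 * z2 ^+ 2 + 2 * z1 * z2 * z3).

Definition cartan_u {R : realType} (delta c : R) (x : 'rV[R]_5) : R :=
  if x == 0 then c else c + cartan_cubic x / enorm x `^ (1 + delta).

(* Main.v *)
Require Import Defs.
From mathcomp Require Import all_boot all_order all_algebra all_fingroup.
From mathcomp Require Import all_classical all_reals all_analysis.
From mathcomp Require Import complex spectral sesquilinear.
From mathcomp Require Import ring lra zify.

(* Put eps = 1 - delta, r = |x| and t = P(x) / r^3, so that |t| <= 1 since |DP| = 3 r^2.
   The plane spanned by x and DP(x) is invariant under D^2 P(x), and D^2 u differs from
   a multiple of D^2 P by a perturbation of that plane and a scalar matrix; hence the
   eigenvalues of D^2 u(x) are r^(-delta) E_i(t) for explicit algebraic functions E_i, and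
   those of A^u(x) are k E_i(t) - s with k = u r^(-delta) and s = |Du|^2 / 2.

   Let L be the set of all these vectors, in all orders. If some K satisfies
   sum_i (d_i + K max(d_i, 0)) >= 0 for every difference d of two elements of L, then the
   infimum over p in L of the left-hand side at d = l - p is a Lipschitz, symmetric,
   uniformly elliptic function of l which vanishes on L. Such a K exists if p_i >= q_i - tau
   for all i forces |sum_i (p_i - q_i)| <= C tau on L. For s = 0, comparing the traces, the
   extreme entries and the second and third largest entries (pigeonhole) bounds |k - k'| and
   min(k, k') |t - t'| by multiples of tau; for c large, s varies slowly compared with k
   and t, so that this term is absorbed.

   Away from 0 the function u is smooth, so at a point where a test function phi touches it
   from above (below) A^u <= A^phi (A^u >= A^phi). At 0 no C^2 function touches u, because
   u - c is odd and homogeneous of degree 2 - delta in ]1, 2[. *)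

Set Implicit Arguments.
Unset Strict Implicit.
Unset Printing Implicit Defensive.

Import Order.TTheory GRing.Theory Num.Theory.
Import numFieldNormedType.Exports.

Local Open Scope ring_scope.

(** * The spectrum of the Hessian as a function of t *)

(** The hard case of the domination estimate is an increase of t. For fixed k a larger t lowers the
    trace, the largest entry and the smallest entry all at once, so none of these three comparisons
    contradicts q being dominated by p. For 0 <= t < t' only the two intermediate entries can help:
    the middle root of the cubic, shifted by -(2 - eps) t, and the positive eigenvalue of the plane.
    Their order is not fixed: at t = 0 they are 0 < 3 eps, at t = 1 the first, 1 + eps, exceeds the
    second. Since the matching of entries is arbitrary, pigeonhole bounds only the larger and the
    smaller of the two. Either the middle roots are then compared with each other, and the smallest
    entry finishes the argument, or the two kinds of entry are exchanged, and a product that is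
    symmetric under the exchange and strictly monotone in t is needed. The powers of eps in the
    constants come from this case: near t = 0 the positive plane eigenvalue is only known to be at
    least eps^2, and an exchange forces t^2 >= eps^2 / 2. *)

Section Branches.
Variable R : realFieldType.
Implicit Types (eps t k tau : R).

(** [A] and the preimage of [B] under [s] have together more than n elements, so they share an index
    i, and v - tau <= q (s i) - tau <= p i <= u. With sizes n - j + 1 and j this compares the j-th
    largest entries without sorting. *)
Lemma pigeonhole_le n (p q : 'I_n -> R) (s : 'S_n) (A B : seq nat) u v tau :
    uniq A -> all (gtn n) A -> uniq B -> all (gtn n) B ->
    (n < size A + size B)%N ->
    (forall i, q (s i) - tau <= p i) ->
    (forall i : 'I_n, (i : nat) \in A -> p i <= u) ->
    (forall j : 'I_n, (j : nat) \in B -> v <= q j) ->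
  v - tau <= u.
Proof.
have cardA (C : seq nat) : uniq C -> all (gtn n) C ->
    #|[set i : 'I_n | (i : nat) \in C]| = size C.
  move=> uC aC; rewrite cardsE; transitivity (size (pmap (insub : nat -> option 'I_n) C)).
    rewrite -(card_uniqP (pmap_sub_uniq 'I_n uC)).
    by apply: eq_card => i; rewrite unfold_in mem_pmap_sub.
  by rewrite size_pmap_sub; apply/eqP; rewrite -all_count.
move=> uA aA uB aB nAB qp pu vq.
pose SA := [set i : 'I_n | (i : nat) \in A].
pose SB := s @^-1: [set i : 'I_n | (i : nat) \in B].
have : SA :&: SB != finset.set0.
  apply/eqP => I0; have := cardsUI SA SB.
  rewrite I0 cards0 addn0 (card_preimset _ (@perm_inj _ s)) !cardA// => eU.
  by move: nAB; rewrite -eU ltnNge (leq_trans (max_card _))// card_ord.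
case/finset.set0Pn => i; rewrite !inE => /andP[iA iB].
by apply: le_trans (pu _ iA); apply: le_trans (qp i); rewrite lerB// vq.
Qed.

(* At a point [x] with [t = P(x) / |x|^3] and [eps = 1 - delta], [branch_eig] lists the
   eigenvalues of [|x|^delta D^2 u (x)]: [by1 >= by2 >= by3] are the roots of
   [y^3 - 27 y + 54 t], coming from [D^2 P], and [bb > 0 > bbm] are the two eigenvalues in the
   plane spanned by [x] and [DP(x)]. *)
Record branch eps := Branch {
  bt : R; by1 : R; by2 : R; by3 : R; bb : R; bbm : R;
  br_t : -1 <= bt <= 1;
  br_c1 : by1 ^+ 3 - 27 * by1 + 54 * bt = 0;
  br_c2 : by2 ^+ 3 - 27 * by2 + 54 * bt = 0;
  br_c3 : by3 ^+ 3 - 27 * by3 + 54 * bt = 0;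
  br_y1 : 3 <= by1 <= 6;
  br_y2 : -3 <= by2 <= 3;
  br_y3 : -6 <= by3 <= -3;
  br_sum : by1 + by2 + by3 = 0;
  br_b : 0 < bb;
  br_bm : bbm < 0;
  br_qb : bb ^+ 2 + (8 - 2 * eps - eps ^+ 2) * bt * bb =
          eps * (9 * eps + (8 - 2 * eps - eps ^+ 2) * bt ^+ 2);
  br_qsum : bb + bbm = - ((8 - 2 * eps - eps ^+ 2) * bt) }.

Definition branch_eig eps (B : branch eps) : 'I_5 -> R :=
  nth 0 [:: by1 B - (2 - eps) * bt B; by2 B - (2 - eps) * bt B;
            by3 B - (2 - eps) * bt B; bb B; bbm B].

(** Since u - c is odd, the spectrum at -x is the negated one: t changes sign and the roots are
    negated in reverse order. This symmetry halves the later case analysis. *)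
Definition branch_opp eps (B : branch eps) : branch eps.
Proof.
refine (@Branch _ (- bt B) (- by3 B) (- by2 B) (- by1 B) (- bbm B) (- bb B)
  _ _ _ _ _ _ _ _ _ _ _ _);
  case: B => t y1 y2 y3 b bm /= /andP[? ?] ? ? ? /andP[? ?] /andP[? ?] /andP[? ?] *;
  try lra.
have -> : bm = - b - (8 - 2 * eps - eps ^+ 2) * t by lra.
transitivity (b ^+ 2 + (8 - 2 * eps - eps ^+ 2) * t * b); first by ring.
lra.
Defined.

Lemma branch_optE eps (B : branch eps) :
  (bt (branch_opp B) = - bt B) * (by1 (branch_opp B) = - by3 B) *
  (by2 (branch_opp B) = - by2 B) * (by3 (branch_opp B) = - by1 B) *
  (bb (branch_opp B) = - bbm B) * (bbm (branch_opp B) = - bb B).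
Proof. by case: B => *; do !split. Qed.

(** The quadratic with positive root [bb] is nonnegative at [L] and has a negative constant term. If
    [L] were below [bb], the identity weighting its values at the two points by each other would
    have sides of opposite sign. *)
Lemma branch_b_le eps (B : branch eps) : 0 < eps < 1 ->
  bb B <= by1 B - (2 - eps) * bt B.
Proof.
case: B => t y1 y2 y3 b bm /= /andP[t0 t1] c1 _ _ /andP[y1a y1b] _ _ _ b0 _ qb _ /andP[e0 e1].
set L := y1 - _.
have L1 : 1 <= L by rewrite /L; nra.
have e21 : eps ^+ 2 <= 1 by nra.
have e20 : 0 <= eps ^+ 2 by nra.
have key : 0 <= y1 ^+ 2 - 9 * eps ^+ 2 + (4 - eps ^+ 2) * t * (y1 - 3 * t).
  have [t0'|t0'] := leP 0 t.
    have : 0 <= t * (y1 - 3 * t) by apply: mulr_ge0; lra.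
    nra.
  have y27 : 27 - 9 * t <= y1 ^+ 2 by nra.
  have y6 : - 6 * t <= y1 by nra.
  have k0 : 0 <= y1 ^+ 2 + 4 * t * (y1 - 3 * t).
    have -> : y1 ^+ 2 + 4 * t * (y1 - 3 * t) = (y1 + 6 * t) * (y1 - 2 * t) by ring.
    apply: mulr_ge0; lra.
  have k1 : 0 <= y1 ^+ 2 - 9 + 3 * t * (y1 - 3 * t) by nra.
  (* The expression is affine in eps^2, hence a convex combination of its values at eps^2 = 0 and
     eps^2 = 1. *)
  have -> : y1 ^+ 2 - 9 * eps ^+ 2 + (4 - eps ^+ 2) * t * (y1 - 3 * t) =
   (1 - eps^+2) * (y1 ^+ 2 + 4 * t * (y1 - 3 * t)) + eps^+2 * (y1 ^+ 2 - 9 + 3 * t * (y1 - 3 * t)) by ring.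
  by apply: addr_ge0; apply: mulr_ge0 => //; lra.
have qL : 0 <= L ^+ 2 + (8 - 2 * eps - eps ^+ 2) * t * L - eps * (9 * eps + (8 - 2 * eps - eps ^+ 2) * t ^+ 2).
  by apply: le_trans key _; rewrite le_eqVlt; apply/orP; left; apply/eqP; rewrite /L; ring.
rewrite leNgt; apply/negP => Lb.
have c0 : 0 < eps * (9 * eps + (8 - 2 * eps - eps ^+ 2) * t ^+ 2).
  by apply: mulr_gt0 => //; nra.
set C := eps * _ in qb qL c0; set E := (8 - _ - _) * t in qb qL.
have : L * (b ^+ 2 + E * b - C) - b * (L ^+ 2 + E * L - C) = (b - L) * (L * b + C) by ring.
have -> : b ^+ 2 + E * b - C = 0 by rewrite qb; ring.
have : 0 < (b - L) * (L * b + C) by apply: mulr_gt0; nra.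
have : 0 <= b * (L ^+ 2 + E * L - C) by apply: mulr_ge0; nra.
lra.
Qed.

Lemma branch_y1_ge eps (B : branch eps) : by2 B <= by1 B.
Proof. by case: B => t y1 y2 y3 b bm /= _ _ _ _ /andP[? _] /andP[_ ?] *; lra. Qed.

Lemma branch_eig_le eps (B : branch eps) i : 0 < eps < 1 ->
  branch_eig B i <= by1 B - (2 - eps) * bt B.
Proof.
move=> e01; have := branch_b_le B e01; have := branch_y1_ge B.
have /andP[e0 e1] := e01.
have := br_bm B; have /andP[? ?] := br_t B; have /andP[? ?] := br_y1 B; have /andP[? ?] := br_y3 B.
by case: i => [[|[|[|[|[|//]]]]] ?]; rewrite /branch_eig/=; nra.
Qed.

Lemma branch_eig_ge eps (B : branch eps) i : 0 < eps < 1 ->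
  by3 B - (2 - eps) * bt B <= branch_eig B i.
Proof.
move=> e01; have := branch_b_le (branch_opp B) e01; have := branch_y1_ge (branch_opp B).
rewrite !branch_optE.
have /andP[e0 e1] := e01.
have := br_b B; have /andP[? ?] := br_t B; have /andP[? ?] := br_y1 B; have /andP[? ?] := br_y3 B.
by case: i => [[|[|[|[|[|//]]]]] ?]; rewrite /branch_eig/=; nra.
Qed.

Lemma branch_eig_sum eps (B : branch eps) :
  \sum_i branch_eig B i = - ((2 - eps) * (7 + eps) * bt B).
Proof.
rewrite /branch_eig !big_ord_recr big_ord0/= add0r.
have := br_qsum B; have := br_sum B; nra.
Qed.

End Branches.

(** * Dependence of the eigenvalue branches on t *)

Section BranchDependence.
Variable R : realFieldType.
Implicit Types (eps t k tau : R).

(** On y >= 3 the function y^3 - 27 y increases, and along the branch it equals -54 t. *)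
Lemma branch_y1_anti eps (B B' : branch eps) : bt B' <= bt B -> by1 B <= by1 B'.
Proof.
move: B B' => [t y1 ? ? ? ? _ c1 _ _ /andP[a _] ? ? ? ? ? ? ?] [t' y1' ? ? ? ? _ c1' _ _ /andP[a' _] ? ? ? ? ? ? ?] /= tt.
rewrite leNgt; apply/negP => ylt.
have : (y1 - y1') * (y1 ^+ 2 + y1 * y1' + y1' ^+ 2 - 27) = - 54 * (t - t') by lra.
have : 0 < (y1 - y1') * (y1 ^+ 2 + y1 * y1' + y1' ^+ 2 - 27) by apply: mulr_gt0; nra.
lra.
Qed.

Lemma branch_y3_anti eps (B B' : branch eps) : bt B' <= bt B -> by3 B <= by3 B'.
Proof.
move=> tt; have := @branch_y1_anti _ (branch_opp B') (branch_opp B).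
by rewrite !branch_optE !lerN2; apply.
Qed.

(** For t >= 0 one has by3^2 >= 27, so the divided difference of y^3 - 27 y is at least 3 * 27 - 27
    = 54. *)
Lemma branch_y3_lip eps (B B' : branch eps) : 0 <= bt B -> bt B <= bt B' ->
  by3 B - by3 B' <= bt B' - bt B.
Proof.
move=> t0 tt; have := branch_y3_anti tt; move: t0 tt.
move: B B' => [t ? ? y ? ? _ _ _ c _ _ /andP[a b] ? ? ? ? ?] [t' ? ? y' ? ? _ _ _ c' _ _ /andP[a' b'] ? ? ? ? ?] /= t0 tt yy.
have y27 : 27 <= y ^+ 2 by nra.
have y27' : 27 <= y' ^+ 2 by nra.
have yy27 : 27 <= y * y' by nra.
have : (y - y') * (y ^+ 2 + y * y' + y' ^+ 2 - 27) = 54 * (t' - t) by lra.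
have : (y - y') * 54 <= (y - y') * (y ^+ 2 + y * y' + y' ^+ 2 - 27) by apply: ler_wpM2l; lra.
lra.
Qed.

(** Here y >= 5, y^2 >= 27 and y' >= 3, so the divided difference is at least 27 + 15 + 9 - 27 = 24,
    and 54 / 24 = 9 / 4. *)
Lemma branch_y1_lip eps (B B' : branch eps) : bt B <= 0 -> 0 <= bt B' ->
  by1 B - by1 B' <= 9 / 4 * (bt B' - bt B).
Proof.
move=> t0 t0'; have := @branch_y1_anti _ B' B; move: t0 t0'.
move: B B' => [t y ? ? ? ? _ c _ _ /andP[a b] ? ? ? ? ? ? ?] [t' y' ? ? ? ? _ c' _ _ /andP[a' b'] ? ? ? ? ? ? ?] /= t0 t0'.
move=> /(_ (le_trans t0 t0')) yy.
have y27 : 27 <= y ^+ 2 by nra.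
have y5 : 5 <= y by nra.
have : (y - y') * (y ^+ 2 + y * y' + y' ^+ 2 - 27) = 54 * (t' - t) by lra.
have : (y - y') * 24 <= (y - y') * (y ^+ 2 + y * y' + y' ^+ 2 - 27).
  by apply: ler_wpM2l; nra.
lra.
Qed.

(** The middle root is tangent to 2 t at t = 0. The quotient z = 27 / (27 - y^2) is defined at t = 0
    as well and lies in [1, 3/2] because y^2 <= 9. *)
Lemma branch_z eps (B : branch eps) :
  exists z, [/\ 1 <= z, z <= 3 / 2, by2 B = 2 * bt B * z &
                4 * z ^+ 3 * bt B ^+ 2 = 27 * (z - 1)].
Proof.
case: B => [t ? y ? ? ? _ _ c _ _ /andP[a b] *] /=.
have y9 : y ^+ 2 <= 9 by nra.
have y0 : 0 <= y ^+ 2 by exact: sqr_ge0.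
have d0 : 27 - y ^+ 2 != 0 by rewrite gt_eqF//; lra.
have e1 : y = 2 * t * (27 / (27 - y ^+ 2)).
  have -> : 2 * t * (27 / (27 - y ^+ 2)) = (54 * t) / (27 - y ^+ 2) by field.
  by apply: (canRL (mulfK d0)); nra.
exists (27 / (27 - y ^+ 2)); split.
- by rewrite ler_pdivlMr; lra.
- by rewrite ler_pdivrMr; lra.
- exact: e1.
- have -> : 4 * (27 / (27 - y ^+ 2)) ^+ 3 * t ^+ 2 =
           (2 * t * (27 / (27 - y ^+ 2))) ^+ 2 * (27 / (27 - y ^+ 2)) by ring.
  by rewrite -e1; field.
Qed.

(** For t >= 0 the quadratic increases on b >= 0, and at eps^2 and at eps t it does not exceed its
    value at [bb]. The first bound is the useful one near t = 0. *)
Lemma branch_b_ge eps (B : branch eps) : 0 < eps < 1 -> 0 <= bt B ->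
  eps ^+ 2 <= bb B /\ eps * bt B <= bb B.
Proof.
case: B => [t ? ? ? b ? /andP[_ t1] _ _ _ _ _ _ _ b0 _ qb _] /= /andP[e0 e1] t0.
have E8 : 0 <= 8 - 2 * eps - eps ^+ 2 <= 8 by apply/andP; split; nra.
move: E8 qb; set E := 8 - _ - _ => /andP[E0 E8] qb; split; rewrite leNgt; apply/negP => blt.
- have e22 : eps ^+ 2 * eps ^+ 2 <= eps ^+ 2.
    by apply: ler_piMl; [exact: sqr_ge0|nra].
  have b2 : b ^+ 2 <= eps ^+ 2 * eps ^+ 2 by rewrite expr2; apply: ler_pM => //; lra.
  have : E * t * b < 8 * eps ^+ 2.
    apply: le_lt_trans (_ : 8 * b < _); last by lra.
    by apply: ler_wpM2r; [lra|nra].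
  have : 0 <= eps * (E * t ^+ 2) by apply: mulr_ge0; [lra|apply: mulr_ge0 => //; exact: sqr_ge0].
  nra.
- have : b ^+ 2 <= (eps * t) ^+ 2 by nra.
  have : E * t * b <= E * t * (eps * t) by apply: ler_wpM2l; [exact: mulr_ge0|lra].
  have : (eps * t) ^+ 2 <= eps ^+ 2.
    by rewrite exprMn; apply: ler_piMr; [exact: sqr_ge0|nra].
  have : 0 < eps ^+ 2 by rewrite exprn_gt0.
  nra.
Qed.

(** Subtracting the two quadratics gives (b - b') (b + b' + E t) = E (t' - t) (b' - eps (t + t')).
    Keeping b' from the second factor gives the first bound; keeping E t gives the second, which is
    sharper once t is bounded below. *)
Lemma branch_b_lip eps (B B' : branch eps) : 0 < eps < 1 -> 0 <= bt B -> bt B <= bt B' ->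
  bb B - bb B' <= 8 * (bt B' - bt B) /\
  bt B * (bb B - bb B') <= (bt B' - bt B) * (bb B' - eps * bt B').
Proof.
move=> e01 t0 tt; have [_ bt'] := branch_b_ge e01 (le_trans t0 tt); move: bt' e01 t0 tt.
move: B B' => [t ? ? ? b ? /andP[_ t1] _ _ _ _ _ _ _ b0 _ qb _]
 [t' ? ? ? b' ? /andP[_ t1'] _ _ _ _ _ _ _ b0' _ qb' _] /= bt' /andP[e0 e1] t0 tt.
have E0 : 0 < 8 - 2 * eps - eps ^+ 2 by nra.
have E8 : 8 - 2 * eps - eps ^+ 2 <= 8 by nra.
move: E0 E8 qb qb'; set E := 8 - _ - _ => E0 E8 qb qb'.
have [bb|bb] := leP b b'.
  split; first by nra.
  have : t * (b - b') <= 0 by nra.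
  have : 0 <= (t' - t) * (b' - eps * t') by apply: mulr_ge0; lra.
  lra.
have id : (b - b') * (b + b' + E * t) = E * ((t' - t) * (b' - eps * (t + t'))) by lra.
have up : (t' - t) * (b' - eps * (t + t')) <= (t' - t) * (b' - eps * t').
  by apply: ler_wpM2l; [lra|nra].
split.
- have : (b - b') * b' <= (b - b') * (b + b' + E * t) by apply: ler_wpM2l; [lra|nra].
  rewrite id => h.
  have h2 : E * ((t' - t) * (b' - eps * (t + t'))) <= E * ((t' - t) * b').
    apply: ler_wpM2l; first lra.
    by apply: ler_wpM2l; [lra|nra].
  have : (b - b') * b' <= (E * (t' - t)) * b' by lra.
  rewrite ler_pM2r// => h3; apply: le_trans h3 _; nra.
- have : (b - b') * (E * t) <= (b - b') * (b + b' + E * t) by apply: ler_wpM2l; lra.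
  rewrite id => h.
  have : E * (t * (b - b')) <= E * ((t' - t) * (b' - eps * t')).
    apply: le_trans (ler_wpM2l (ltW E0) up); lra.
  by rewrite ler_pM2l.
Qed.

End BranchDependence.

(** * Exclusion of an exchange of the two intermediate entries *)

Section Crossing.
Variable R : realFieldType.
Implicit Types (eps t k tau : R).

(** [A] is the numerator of the divided difference of (z - 1) / z^3. It is positive when 1 < z and
    z' < z, which forces monotonicity, and at most 1, which gives the slope. *)
Lemma z_of_t_lip (t t' z z' : R) : 0 <= t -> t <= t' ->
  1 <= z -> z <= 3 / 2 -> 1 <= z' -> z' <= 3 / 2 ->
  4 * z ^+ 3 * t ^+ 2 = 27 * (z - 1) -> 4 * z' ^+ 3 * t' ^+ 2 = 27 * (z' - 1) ->
  z <= z' /\ 4 * (t' ^+ 2 - t ^+ 2) <= 27 * (z' - z).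
Proof.
move=> t0 tt z1 z2 z1' z2' ez ez'.
pose A := z ^+ 2 + z * z' + z' ^+ 2 - z * z' * (z + z').
have A1 : A <= 1.
  have -> : A = 1 - (z - 1) * (z' - 1) * (1 + z + z') by rewrite /A; ring.
  rewrite lerBlDr lerDl; apply: mulr_ge0; last lra.
  by apply: mulr_ge0; lra.
have key : 4 * (t' ^+ 2 - t ^+ 2) * (z ^+ 3 * z' ^+ 3) = 27 * (z' - z) * A.
  transitivity (4 * z' ^+ 3 * t' ^+ 2 * z ^+ 3 - 4 * z ^+ 3 * t ^+ 2 * z' ^+ 3); first by ring.
  by rewrite ez ez' /A; ring.
have tt2 : 0 <= t' ^+ 2 - t ^+ 2 by nra.
have zz3 : 1 <= z ^+ 3 * z' ^+ 3 by rewrite -exprMn expr_ge1//; nra.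
have zz : z <= z'.
  rewrite leNgt; apply/negP => lt; have z1lt : 1 < z by lra.
  have A0 : 0 < A.
    have -> : A = (z - z') ^+ 2 + z * z' * (3 - z - z') by rewrite /A; ring.
    by apply: ltr_pwDl; [rewrite exprn_gt0//; lra | apply: mulr_ge0; [nra|lra]].
  have : 0 <= 4 * (t' ^+ 2 - t ^+ 2) * (z ^+ 3 * z' ^+ 3) by apply: mulr_ge0; lra.
  have : 27 * (z - z') * A > 0 by apply: mulr_gt0; lra.
  lra.
split=> //.
apply: le_trans (_ : 4 * (t' ^+ 2 - t ^+ 2) * (z ^+ 3 * z' ^+ 3) <= _).
  by rewrite -[leLHS]mulr1; apply: ler_wpM2l; lra.
by rewrite key -[leRHS]mulr1; apply: ler_wpM2l; lra.
Qed.

(** A product of two increasing positive factors: the first is at least 7 and the second has slope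
    at least 4 z^2 - 1 >= 3, whence 21. *)
Lemma psi_incr (e z z' : R) : e <= 1 -> 1 <= z -> z <= z' ->
  21 * (z' - z) <= (2 * z' + 6 - e) * (4 / 3 * z' ^+ 3 - z' + 1) -
                   (2 * z + 6 - e) * (4 / 3 * z ^+ 3 - z + 1).
Proof.
move=> e21 z1 zz.
have g0 : 0 <= 4 / 3 * z ^+ 3 - z + 1.
  have z2 : 1 <= z ^+ 2 by nra.
  have -> : z ^+ 3 = z * z ^+ 2 by ring.
  nra.
have g1 : 3 * (z' - z) <= (4 / 3 * z' ^+ 3 - z' + 1) - (4 / 3 * z ^+ 3 - z + 1).
  have -> : (4 / 3 * z' ^+ 3 - z' + 1) - (4 / 3 * z ^+ 3 - z + 1) =
   (4 / 3 * (z' ^+ 2 + z * z' + z ^+ 2) - 1) * (z' - z) by ring.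
  apply: ler_wpM2r; first lra.
  have : 1 <= z ^+ 2 by nra.
  have : 1 <= z * z' by nra.
  have : 1 <= z' ^+ 2 by nra.
  lra.
have h1 : 7 * (3 * (z' - z)) <= (2 * z' + 6 - e) * ((4 / 3 * z' ^+ 3 - z' + 1) - (4 / 3 * z ^+ 3 - z + 1)).
  by apply: ler_pM => //; lra.
have h2 : 0 <= (z' - z) * (4 / 3 * z ^+ 3 - z + 1) by apply: mulr_ge0; lra.
have -> : (2 * z' + 6 - e) * (4 / 3 * z' ^+ 3 - z' + 1) - (2 * z + 6 - e) * (4 / 3 * z ^+ 3 - z + 1)
 = (2 * z' + 6 - e) * ((4 / 3 * z' ^+ 3 - z' + 1) - (4 / 3 * z ^+ 3 - z + 1))
   + 2 * ((z' - z) * (4 / 3 * z ^+ 3 - z + 1)) by ring.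
lra.
Qed.

(* Here [2 t z] is the middle root of the cubic and [t (be + eps)] the positive root of the
   quadratic. The product of [x (x + 8 - eps^2)] over [x = be] and [x = 2 (z - 1)] is
   [2 eps^2] times an increasing function of [z], whereas the last two hypotheses say that the
   two factors have nearly been exchanged between the two points. *)
Lemma crossing_bound eps (t t' z z' be be' th : R) : 0 < eps < 1 ->
  0 < t -> t <= t' -> t' <= 1 ->
  1 <= z -> z <= 3 / 2 -> 1 <= z' -> z' <= 3 / 2 ->
  4 * z ^+ 3 * t ^+ 2 = 27 * (z - 1) -> 4 * z' ^+ 3 * t' ^+ 2 = 27 * (z' - 1) ->
  0 <= be -> 0 <= be' ->
  be * (be + 8 - eps ^+ 2) * t ^+ 2 = eps ^+ 2 * (9 - t ^+ 2) ->
  be' * (be' + 8 - eps ^+ 2) * t' ^+ 2 = eps ^+ 2 * (9 - t' ^+ 2) ->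
  0 <= th -> 8 * th <= eps ^+ 2 ->
  be' <= 2 * (z - 1) + 4 * th -> 2 * (z' - 1) <= be + 3 * th ->
  eps ^+ 2 <= 2 * t ^+ 2 /\ eps ^+ 2 * (t' ^+ 2 - t ^+ 2) <= 198 * th.
Proof.
move=> /andP[e0 e1] t0 tt t1 z1 z2 z1' z2' ez ez' b0 b0' eb eb' th0 the hx hx'.
have [zz tz] := z_of_t_lip (ltW t0) tt z1 z2 z1' z2' ez ez'.
have e2 : 0 < eps ^+ 2 by rewrite exprn_gt0.
have e21 : eps ^+ 2 <= 1 by nra.
move: e2 e21 eb eb' the; set e := eps ^+ 2 => e2 e21 eb eb' the.
have t2 : 0 < t ^+ 2 by rewrite exprn_gt0.
have t2' : 0 < t' ^+ 2 by rewrite exprn_gt0//; lra.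
have t21 : t ^+ 2 <= 1 by nra.
have t21' : t' ^+ 2 <= 1 by nra.
pose F x := x * (x + 8 - e).
have be'e : e <= be'.
  rewrite leNgt; apply/negP => lt.
  have : F be' < 8 * e by rewrite /F; nra.
  have : F be' * t' ^+ 2 >= 8 * e by rewrite /F eb'; nra.
  have : 0 <= F be' by rewrite /F; apply: mulr_ge0; clear -b0' e21; lra.
  nra.
have z3 : z ^+ 3 <= 27 / 8.
  have -> : 27 / 8 = (3 / 2) ^+ 3 :> R by field.
  by rewrite ler_pXn2r// nnegrE; clear -z1 z2; lra.
(* From e <= be' <= 2 (z - 1) + 4 th with 4 th <= e / 2, and z - 1 = 4 z^3 t^2 / 27 <= t^2 / 2. *)
have te : e <= 2 * t ^+ 2 by nra.
split=> //.
have f1 : F (2 * (z' - 1)) <= F be + 30 * th.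
  have x0 : 0 <= 2 * (z' - 1) by clear -z1'; lra.
  have x1 : 2 * (z' - 1) <= 1 by clear -z2'; lra.
  move: hx' x0 x1; move: (2 * (z' - 1)) => x hx' x0 x1.
  have -> : F x = F be + (x - be) * (x + be + 8 - e) by rewrite /F; ring.
  rewrite lerD2l; have [xb|xb] := leP x be.
    apply: le_trans (_ : 0 <= _); last by clear -th0; lra.
    by apply: mulr_le0_ge0; clear -xb x0 b0 e21; lra.
  have -> : 30 * th = (3 * th) * 10 by ring.
  by apply: ler_pM; clear -xb x0 b0 e21 e2 x1 hx'; lra.
have f2 : F be' <= F (2 * (z - 1)) + 44 * th.
  apply: le_trans (_ : F (2 * (z - 1) + 4 * th) <= _).
    by rewrite /F; apply: ler_pM => //; clear -b0' z1 th0 e21 hx; lra.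
  have -> : F (2 * (z - 1) + 4 * th) = F (2 * (z - 1)) + (4 * (z - 1) + 4 * th + 8 - e) * 4 * th.
    by rewrite /F; ring.
  by rewrite lerD2l; apply: ler_wpM2r => //; clear -z2 the e21 e2; lra.
have Fpos x : 0 <= x -> 0 <= F x by move=> x0; apply: mulr_ge0; clear -x0 e21; lra.
have Fb0 : 0 <= F be by exact: Fpos.
have Fb0' : 0 <= F be' by exact: Fpos.
have Fb : F be <= 18.
  have : F be * t ^+ 2 <= 18 * t ^+ 2 by rewrite /F eb; nra.
  by rewrite ler_pM2r.
have Fx : 0 <= F (2 * (z - 1)) <= 9.
  by apply/andP; split; [apply: Fpos|rewrite /F; clear -z1 z2 e2]; nra.
have Fx' : 0 <= F (2 * (z' - 1)) by apply: Fpos; clear -z1'; lra.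
(* 1227 = 44 * 18 + 30 * 9 + 1320 / 8, the last term because 8 th <= e <= 1. *)
have prod : F (2 * (z' - 1)) * F be' <= F be * F (2 * (z - 1)) + 1227 * th.
  move/andP: Fx => [Fx0 Fx9].
  apply: le_trans (_ : (F be + 30 * th) * (F (2 * (z - 1)) + 44 * th) <= _).
    exact: ler_pM.
  have -> : (F be + 30 * th) * (F (2 * (z - 1)) + 44 * th) = F be * F (2 * (z - 1)) +
    (44 * F be + 30 * F (2 * (z - 1)) + 1320 * th) * th by ring.
  by rewrite lerD2l; apply: ler_wpM2r => //; clear -Fb Fx9 the e21; lra.
(* Eliminating s = t^2 between the equations of the two roots leaves a function of z alone; this is
   why the product of both factors is considered. *)
have psi x b s : 0 < s -> 4 * x ^+ 3 * s = 27 * (x - 1) -> F b * s = e * (9 - s) ->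
    F b * F (2 * (x - 1)) = 2 * e * ((2 * x + 6 - e) * (4 / 3 * x ^+ 3 - x + 1)).
  move=> s0 ex ey; apply: (mulIf (_ : s != 0)); first by rewrite gt_eqF.
  transitivity (F b * s * F (2 * (x - 1))); first by ring.
  rewrite ey /F.
  transitivity (e * (2 / 27) * (2 * x + 6 - e) * (9 * (27 * (x - 1)) - s * (27 * (x - 1)))); first by field.
  rewrite -ex.
  transitivity (e * (2 / 27) * (2 * x + 6 - e) * (36 * x ^+ 3 - 4 * x ^+ 3 * s) * s); first by ring.
  by rewrite ex; field.
move: prod; rewrite [F (2 * (z' - 1)) * _]mulrC (psi _ _ _ t2 ez eb) (psi _ _ _ t2' ez' eb').
have low := psi_incr e21 z1 zz.
move=> prod.
have h1 : 2 * e * (21 * (z' - z)) <= 1227 * th.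
  apply: le_trans (_ : 2 * e * ((2 * z' + 6 - e) * (4 / 3 * z' ^+ 3 - z' + 1) -
                     (2 * z + 6 - e) * (4 / 3 * z ^+ 3 - z + 1)) <= _).
    by rewrite ler_pM2l//; clear -e2; lra.
  by clear -prod; lra.
have h2 : e * (4 * (t' ^+ 2 - t ^+ 2)) <= e * (27 * (z' - z)) by rewrite ler_pM2l.
by clear -h1 h2 th0; lra.
Qed.

End Crossing.

(** * Consequences of domination up to tau *)

Section Domination.
Variable R : realFieldType.
Implicit Types (eps t k tau : R).

Definition dominates eps tau k (B : branch eps) k' (B' : branch eps) : Prop :=
  exists s : 'S_5, forall i, k' * branch_eig B' (s i) - tau <= k * branch_eig B i.

Section Dominates.
Context eps (tau k k' : R) (B B' : branch eps).
Hypotheses (e01 : 0 < eps < 1) (k0 : 0 < k) (k'0 : 0 < k').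
Hypothesis dom : dominates tau k B k' B'.

Lemma dominates_trace : (2 - eps) * (7 + eps) * (k * bt B - k' * bt B') <= 5 * tau.
Proof.
have [s dom_s] := dom.
have : \sum_i (k' * branch_eig B' (s i) - tau) <= \sum_i k * branch_eig B i.
  by apply: ler_sum => i _; exact: dom_s.
rewrite big_split/= -!mulr_sumr (_ : \sum_i branch_eig B' (s i) = \sum_i branch_eig B' i).
  rewrite !branch_eig_sum sumrN sumr_const card_ord -mulr_natl; lra.
by rewrite [RHS](reindex_inj (@perm_inj _ s)).
Qed.

Lemma dominates_max :
  k' * (by1 B' - (2 - eps) * bt B') <= k * (by1 B - (2 - eps) * bt B) + tau.
Proof.
have [s dom_s] := dom; rewrite -lerBlDr.
apply: (@pigeonhole_le _ 5 (fun i => k * branch_eig B i)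
  (fun i => k' * branch_eig B' i) s [:: 0; 1; 2; 3; 4]%N [:: 0]%N _ _ tau) => //.
- by move=> i _; rewrite ler_pM2l// branch_eig_le.
- by case=> [[|//] ?].
Qed.

Lemma dominates_min :
  k * ((2 - eps) * bt B - by3 B) <= k' * ((2 - eps) * bt B' - by3 B') + tau.
Proof.
have [s dom_s] := dom.
suff : k' * (by3 B' - (2 - eps) * bt B') - tau <= k * (by3 B - (2 - eps) * bt B) by lra.
apply: (@pigeonhole_le _ 5 (fun i => k * branch_eig B i)
  (fun i => k' * branch_eig B' i) s [:: 2]%N [:: 0; 1; 2; 3; 4]%N _ _ tau) => //.
- by case=> [[|[|[|//]]] ?].
- by move=> i _; rewrite ler_pM2l// branch_eig_ge.
Qed.

(** Comparison of the third largest entries: three entries of [B] are at most u and three of [B'] at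
    least v, and 3 + 3 > 5. In [dominates_3rd_b] the entry [bb] replaces the middle root among the
    small entries of [B]. *)
Lemma dominates_3rd v u :
    (k * (by2 B - (2 - eps) * bt B) <= u) -> (k * (by3 B - (2 - eps) * bt B) <= u) ->
    (k * bbm B <= u) -> (v <= k' * (by1 B' - (2 - eps) * bt B')) ->
    (v <= k' * (by2 B' - (2 - eps) * bt B')) -> (v <= k' * bb B') ->
  v <= u + tau.
Proof.
move=> u2 u3 u5 v1 v2 v4; have [s dom_s] := dom; rewrite -lerBlDr.
apply: (@pigeonhole_le _ 5 (fun i => k * branch_eig B i)
  (fun i => k' * branch_eig B' i) s [:: 1; 2; 4]%N [:: 0; 1; 3]%N _ _ tau) => //.
- by case=> [[|[|[|[|[|//]]]]] ?].
- by case=> [[|[|[|[|//]]]] ?].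
Qed.

Lemma dominates_3rd_b v u :
    (k * bb B <= u) -> (k * (by3 B - (2 - eps) * bt B) <= u) ->
    (k * bbm B <= u) -> (v <= k' * (by1 B' - (2 - eps) * bt B')) ->
    (v <= k' * (by2 B' - (2 - eps) * bt B')) -> (v <= k' * bb B') ->
  v <= u + tau.
Proof.
move=> u2 u3 u5 v1 v2 v4; have [s dom_s] := dom; rewrite -lerBlDr.
apply: (@pigeonhole_le _ 5 (fun i => k * branch_eig B i)
  (fun i => k' * branch_eig B' i) s [:: 3; 2; 4]%N [:: 0; 1; 3]%N _ _ tau) => //.
- by case=> [[|[|[|[|[|//]]]]] ?].
- by case=> [[|[|[|[|//]]]] ?].
Qed.

Lemma dominates_2nd v u :
    (k * (by2 B - (2 - eps) * bt B) <= u) -> (k * bb B <= u) ->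
    (k * (by3 B - (2 - eps) * bt B) <= u) ->
    (k * bbm B <= u) -> (v <= k' * (by1 B' - (2 - eps) * bt B')) ->
    (v <= k' * (by2 B' - (2 - eps) * bt B') \/ v <= k' * bb B') ->
  v <= u + tau.
Proof.
move=> u2 u3 u4 u5 v1; have [s dom_s] := dom; rewrite -lerBlDr => -[v2|v2].
- apply: (@pigeonhole_le _ 5 (fun i => k * branch_eig B i)
  (fun i => k' * branch_eig B' i) s [:: 1; 2; 3; 4]%N [:: 0; 1]%N _ _ tau) => //.
  + by case=> [[|[|[|[|[|//]]]]] ?].
  + by case=> [[|[|//]] ?].
- apply: (@pigeonhole_le _ 5 (fun i => k * branch_eig B i)
  (fun i => k' * branch_eig B' i) s [:: 1; 2; 3; 4]%N [:: 0; 3]%N _ _ tau) => //.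
  + by case=> [[|[|[|[|[|//]]]]] ?].
  + by case=> [[|[|[|[|//]]]] ?].
Qed.

End Dominates.

Lemma branch_eig_opp eps (B : branch eps) :
  exists r : 'S_5, forall i, branch_eig (branch_opp B) i = - branch_eig B (r i).
Proof.
pose r : 'I_5 -> 'I_5 := nth ord0 [:: @Ordinal 5 2 isT; @Ordinal 5 1 isT; @Ordinal 5 0 isT; @Ordinal 5 4 isT; @Ordinal 5 3 isT].
have rI : injective r.
  by apply: can_inj (r) _ => -[[|[|[|[|[|//]]]]] ?]; apply: val_inj.
exists (perm rI) => i; rewrite permE /branch_eig !branch_optE.
case: i => [[|[|[|[|[|//]]]]] ?] /=; ring.
Qed.

(** Negation reverses inequalities, so the two points exchange their roles. *)
Lemma dominates_opp eps tau k k' (B B' : branch eps) :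
  dominates tau k B k' B' -> dominates tau k' (branch_opp B') k (branch_opp B).
Proof.
move=> [s dom]; have [r rE] := branch_eig_opp B; have [r' rE'] := branch_eig_opp B'.
exists (r' * s^-1 * r^-1)%g => i; rewrite rE rE' !permM permKV.
have := dom (s^-1%g (r' i)); rewrite permKV; lra.
Qed.

End Domination.

(** * The cases t' <= t and t <= 0 <= t' *)

Section DecreasingCases.
Variable R : realFieldType.
Implicit Types (eps t k tau : R).

Section Cases.
Context eps (tau k k' : R) (B B' : branch eps).
Hypotheses (e01 : 0 < eps < 1) (k0 : 0 < k) (k'0 : 0 < k') (tau0 : 0 <= tau).
Hypothesis dom : dominates tau k B k' B'.

Lemma dominates_trace_le : k * bt B - k' * bt B' <= tau.
Proof.
have t00 := tau0; have := dominates_trace dom; have /andP[e0 e1] := e01.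
suff h (x : R) : (2 - eps) * (7 + eps) * x <= 5 * tau -> x <= tau by exact: h.
move=> h; have [x0|x0] := leP x 0; first lra.
have : 8 * x <= (2 - eps) * (7 + eps) * x by rewrite ler_pM2r//; nra.
lra.
Qed.

(* When [t] decreases, the largest and the smallest eigenvalue move in the same direction, so
   the trace and these two already determine [k] and [t]. *)
Lemma dominates_anti : bt B' <= bt B ->
  [/\ k - k' <= tau, k' - k <= tau & k * (bt B - bt B') <= 2 * tau].
Proof.
move=> tt; have t00 := tau0.
have h1 := dominates_trace_le; have h2 := dominates_max e01 k0 dom.
have h3 := dominates_min e01 k'0 dom.
have y1 := branch_y1_anti tt; have y3 := branch_y3_anti tt.
have /andP[t1 t2] := br_t B; have /andP[t1' t2'] := br_t B'.
have /andP[a1 a2] := br_y1 B'; have /andP[c1 c2] := br_y3 B'.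
have /andP[e0 e1] := e01.
have L1 : 1 <= by1 B' - (2 - eps) * bt B' by nra.
have L2 : 1 <= (2 - eps) * bt B' - by3 B' by nra.
have et : 0 <= (2 - eps) * (bt B - bt B') by apply: mulr_ge0; lra.
have kk : k' - k <= tau.
  have : k * (by1 B - (2 - eps) * bt B) <= k * (by1 B' - (2 - eps) * bt B').
    by rewrite ler_pM2l//; lra.
  have [|kk] := leP (k' - k) 0; first lra.
  have : (k' - k) * 1 <= (k' - k) * (by1 B' - (2 - eps) * bt B') by rewrite ler_pM2l.
  lra.
have kk' : k - k' <= tau.
  have : k * ((2 - eps) * bt B' - by3 B') <= k * ((2 - eps) * bt B - by3 B).
    by rewrite ler_pM2l//; lra.
  have [|kk'] := leP (k - k') 0; first lra.
  have : (k - k') * 1 <= (k - k') * ((2 - eps) * bt B' - by3 B') by rewrite ler_pM2l.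
  lra.
split=> //.
(* k (t - t') = (k t - k' t') + (k' - k) t', and the trace bounds the first term by tau. *)
suff : (k' - k) * bt B' <= tau by lra.
clear -kk kk' t1' t2' t00; nra.
Qed.

Lemma branch_mid eps' (C : branch eps') : 0 < eps' < 1 ->
  (0 <= bt C -> eps' * bt C <= by2 C - (2 - eps') * bt C) /\
  (bt C <= 0 -> by2 C - (2 - eps') * bt C <= eps' * bt C).
Proof.
move=> /andP[? ?]; have [z [z1 z2 -> _]] := branch_z C; split=> ?; nra.
Qed.

(** The middle root and both negative branches at [B] are at most eps t, while the middle root and
    both positive branches at [B'] are at least eps t', so the third largest entries separate the
    two. *)
Lemma dominates_opposite : bt B <= 0 -> 0 <= bt B' ->
  eps * (k' * bt B' - k * bt B) <= tau.
Proof.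
move=> t0 t0'; have t00 := tau0; have /andP[e0 e1] := e01.
have [_ /(_ t0) m] := branch_mid B e01; have [/(_ t0') m' _] := branch_mid B' e01.
have := @branch_b_ge _ _ (branch_opp B) e01; rewrite !branch_optE oppr_ge0.
case/(_ t0) => _ bb.
have [_ b'] := branch_b_ge e01 t0'.
have lb' := branch_b_le B' e01.
have /andP[t1 t2] := br_t B; have /andP[c1 c2] := br_y3 B.
suff : k' * (eps * bt B') <= k * (eps * bt B) + tau by lra.
apply: (dominates_3rd dom); rewrite ler_pM2l//; lra.
Qed.

Lemma dominates_opposite_max : bt B <= 0 -> 0 <= bt B' ->
  eps * (k' - k) <= 6 * tau.
Proof.
move=> t0 t0'; have t00 := tau0; have /andP[e0 e1] := e01.
have [kk|kk] := leP (k' - k) 0.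
  by apply: le_trans (_ : 0 <= _); [rewrite pmulr_rle0|lra].
have h2 := dominates_max e01 k0 dom.
have ho := dominates_opposite t0 t0'.
have l1 := branch_y1_lip t0 t0'.
have /andP[t1' t2'] := br_t B'; have /andP[a1 a2] := br_y1 B'.
have L1 : 1 <= by1 B' - (2 - eps) * bt B' by nra.
(* 17 / 4 = 9 / 4 + 2: the slope of [by1] plus a bound for 2 - eps. *)
have h : by1 B - (2 - eps) * bt B <= by1 B' - (2 - eps) * bt B' + 17 / 4 * (bt B' - bt B).
  have : 0 <= eps * (bt B' - bt B) by apply: mulr_ge0; lra.
  lra.
have : k * (by1 B - (2 - eps) * bt B) <= k * (by1 B' - (2 - eps) * bt B' + 17 / 4 * (bt B' - bt B)).
  by rewrite ler_pM2l.
have : (k' - k) * 1 <= (k' - k) * (by1 B' - (2 - eps) * bt B') by rewrite ler_pM2l.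
have : k * bt B' <= k' * bt B' by apply: ler_wpM2r => //; lra.
move=> i1 i2 i3.
have : k' - k <= 17 / 4 * (k' * bt B' - k * bt B) + tau by lra.
rewrite -(ler_pM2l e0) => i4.
have : eps * tau <= tau by rewrite ler_piMl//; lra.
lra.
Qed.

End Cases.

End DecreasingCases.

(** * The case 0 <= t <= t' *)

Section IncreasingCase.
Variable R : realFieldType.
Implicit Types (eps t k tau : R).

Definition bmid eps (B : branch eps) := by2 B - (2 - eps) * bt B.

Section Cases.
Context eps (tau k k' : R) (B B' : branch eps).
Hypotheses (e01 : 0 < eps < 1) (k0 : 0 < k) (k'0 : 0 < k') (tau0 : 0 <= tau).
Hypotheses (t0 : 0 <= bt B) (tt : bt B <= bt B').
Hypothesis dom : dominates tau k B k' B'.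

Let t0' : 0 <= bt B' := le_trans t0 tt.

(** The second and third largest entries at each point are the larger and the smaller of [bmid] and
    [bb]. Adding the two comparisons is insensitive to their order; separately they give either
    middle root against middle root or the exchange. *)
Lemma dominates_middle :
  k' * (bmid B' + bb B') <= k * (bmid B + bb B) + 2 * tau /\
  (k' * bmid B' <= k * bmid B + tau \/
   k' * bb B' <= k * bmid B + tau /\ k' * bmid B' <= k * bb B + tau).
Proof.
have /andP[e0 e1] := e01; have t00 := t0; have t00' := t0'.
have [/(_ t0) m _] := branch_mid B e01.
have lb' := branch_b_le B' e01; have y21 := branch_y1_ge B'.
have b0 := br_b B; have bm0 := br_bm B; have /andP[c1 c2] := br_y3 B.
have et : 0 <= eps * bt B by exact: mulr_ge0 (ltW e0) t0.
have et2 : 0 <= (2 - eps) * bt B by apply: mulr_ge0; lra.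
have u3 w : 0 <= w -> k * (by3 B - (2 - eps) * bt B) <= w.
  by move=> w0; apply: le_trans w0; rewrite pmulr_rle0//; lra.
have u5 w : 0 <= w -> k * bbm B <= w.
  by move=> w0; apply: le_trans w0; rewrite pmulr_rle0//; lra.
have km0 : 0 <= k * bmid B by rewrite pmulr_rge0 /bmid//; lra.
have kb0 : 0 <= k * bb B by rewrite pmulr_rge0//; lra.
have vm : k' * bmid B' <= k' * (by1 B' - (2 - eps) * bt B').
  by rewrite ler_pM2l// /bmid; lra.
have vb : k' * bb B' <= k' * (by1 B' - (2 - eps) * bt B') by rewrite ler_pM2l.
have thm : Num.min (k' * bmid B') (k' * bb B') <= k * bmid B + tau.
  by apply: (dominates_3rd dom); rewrite ?u3 ?u5// ge_min ?lexx ?orbT// ?vm.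
have thb : Num.min (k' * bmid B') (k' * bb B') <= k * bb B + tau.
  by apply: (dominates_3rd_b dom); rewrite ?u3 ?u5// ge_min ?lexx ?orbT// ?vm.
have sec w : w = k' * bmid B' \/ w = k' * bb B' -> w <= Num.max (k * bmid B) (k * bb B) + tau.
  move=> ww; apply: (dominates_2nd dom).
  - by rewrite le_max lexx.
  - by rewrite le_max lexx orbT.
  - by apply: u3; rewrite le_max km0.
  - by apply: u5; rewrite le_max km0.
  - by case: ww => ->.
  - by case: ww => ->; [left|right].
have sm := sec _ (or_introl erefl); have sb := sec _ (or_intror erefl).

case: (leP (k' * bmid B') (k' * bb B')) thm thb => h1 thm thb;
case: (leP (k * bmid B) (k * bb B)) sm sb => h2 sm sb; (split; first lra);
  try (by left; lra); by right; split; lra.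
Qed.

Lemma branch_low_ge : 5 <= - by3 B.
Proof.
have := t0; case: (B) => t ? ? y ? ? _ _ _ c _ _ /andP[? ?] ? ? ? ? ? /= t00.
have : 27 <= y ^+ 2 by nra.
nra.
Qed.

(** The modulus of the smallest entry is at least 5 and grows with slope at most 3 in t, so an
    excess of k over k' must be paid for by t' - t. *)
Lemma dominates_rising_le : 5 * (k - k') <= 3 * (k' * (bt B' - bt B)) + tau /\
  5 * (k - k') <= 3 * (k * (bt B' - bt B)) + tau.
Proof.
have /andP[e0 e1] := e01; have t00 := t0; have t00' := t0'; have tt0 := tt.
have h3 := dominates_min e01 k'0 dom.
have low := branch_low_ge; have y3 := branch_y3_anti tt.
have lip := branch_y3_lip t0 tt; have k00 := k0; have k00' := k'0; have tau00 := tau0.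
have et : 0 <= eps * (bt B' - bt B) by apply: mulr_ge0; lra.
have et2 : 0 <= (2 - eps) * bt B by apply: mulr_ge0; lra.
have et3 : 0 <= (2 - eps) * (bt B' - bt B) by apply: mulr_ge0; lra.
set L := (2 - eps) * bt B - by3 B in h3; set L' := (2 - eps) * bt B' - by3 B' in h3.
have L5 : 5 <= L by rewrite /L; lra.
have LL : L <= L' by rewrite /L /L'; lra.
have LL3 : L' - L <= 3 * (bt B' - bt B) by rewrite /L /L'; lra.
have p1 : k' * (L' - L) <= k' * (3 * (bt B' - bt B)) by rewrite ler_pM2l.
have p2 : k * (L' - L) <= k * (3 * (bt B' - bt B)) by rewrite ler_pM2l.
have [kk|kk] := leP (k - k') 0.
  have q1 : 0 <= k' * (bt B' - bt B) by apply: mulr_ge0; lra.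
  have q2 : 0 <= k * (bt B' - bt B) by apply: mulr_ge0; lra.
  by split; lra.
have p3 : (k - k') * 5 <= (k - k') * L by rewrite ler_pM2l.
have p4 : (k - k') * 5 <= (k - k') * L' by rewrite ler_pM2l//; lra.
by split; lra.
Qed.

(** Relative to t the middle entry does not decrease, whereas the modulus of the smallest one does.
    Cross-multiplying the two comparisons eliminates k and leaves k' M (t' L - t L') <= 10 tau with
    t' L - t L' >= 4 (t' - t). *)
Lemma dominates_direct : k' * bmid B' <= k * bmid B + tau ->
  eps * (k' * (bt B' - bt B)) <= 5 / 2 * tau.
Proof.
have /andP[e0 e1] := e01; have t00 := t0; have tt0 := tt; have tau00 := tau0.
have h3 := dominates_min e01 k'0 dom.
have low := branch_low_ge.
have lip := branch_y3_lip t0 tt; have /andP[_ t1] := br_t B; have /andP[y31 _] := br_y3 B.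
have [z [z1 z2 ez ez2]] := branch_z B; have [z' [z1' z2' ez' ez2']] := branch_z B'.
have [zz _] := z_of_t_lip t0 tt z1 z2 z1' z2' ez2 ez2'.
rewrite /bmid ez ez'.
move: h3 low lip t1 y31 t00 tt0; set t := bt B; set t' := bt B'; set y := by3 B; set y' := by3 B'.
move=> h3 low lip t1 y31 t00 tt0.
have -> : 2 * t' * z' - (2 - eps) * t' = t' * (eps + 2 * (z' - 1)) by ring.
have -> : 2 * t * z - (2 - eps) * t = t * (eps + 2 * (z - 1)) by ring.
move=> hm.
set M := eps + 2 * (z - 1) in hm.
have Me : eps <= M by rewrite /M; lra.
have M2 : M <= 2 by rewrite /M; lra.
have hm1 : k' * (t' * M) <= k * (t * M) + tau.
  apply: le_trans hm; rewrite ler_pM2l//; apply: ler_wpM2l; rewrite /M; lra.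
set L := (2 - eps) * t - y in h3; set L' := (2 - eps) * t' - y' in h3.
have L0 : 0 <= L by rewrite /L; nra.
have L8 : L <= 8 by rewrite /L; nra.
have step1 : k' * (t' * M) * L <= (k * (t * M) + tau) * L by apply: ler_wpM2r.
have step2 : (t * M) * (k * L) <= (t * M) * (k' * L' + tau).
  by apply: ler_wpM2l => //; apply: mulr_ge0; lra.
have step3 : k' * (M * (t' * L - t * L')) <= 10 * tau.
  have tM : t * M <= 2 by nra.
  have : (t * M + L) * tau <= 10 * tau by apply: ler_wpM2r => //; lra.
  lra.
have step4 : 4 * (t' - t) <= t' * L - t * L'.
  have -> : t' * L - t * L' = (t' - t) * (- y) - t * (y - y') by rewrite /L /L'; ring.
  have : (t' - t) * 5 <= (t' - t) * (- y) by apply: ler_wpM2l; rewrite ?subr_ge0.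
  have : t * (y - y') <= 1 * (t' - t) by apply: le_trans (_ : t * (t' - t) <= _); [exact: ler_wpM2l|apply: ler_wpM2r => //; rewrite subr_ge0].
  lra.
have step5 : eps * (4 * (t' - t)) <= M * (t' * L - t * L').
  by apply: ler_pM => //; [exact: ltW|rewrite mulr_ge0// subr_ge0].
have : k' * (eps * (4 * (t' - t))) <= k' * (M * (t' * L - t * L')) by rewrite ler_pM2l.
by lra.
Qed.

End Cases.
End IncreasingCase.

(** * The exchanged alternative *)

Section CrossedCase.
Variable R : realFieldType.
Implicit Types (eps t k tau : R).

Lemma branch_mid_z eps (B : branch eps) z : by2 B = 2 * bt B * z ->
  bmid B = bt B * (eps + 2 * (z - 1)).
Proof. by rewrite /bmid => ->; ring. Qed.

(** Dividing [bb] by t and subtracting eps brings its quadratic to the form x (x + 8 - eps^2) of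
    [crossing_bound]. *)
Lemma branch_bE eps (B : branch eps) : 0 < bt B ->
  (bb B / bt B - eps) * (bb B / bt B - eps + 8 - eps ^+ 2) * bt B ^+ 2 =
  eps ^+ 2 * (9 - bt B ^+ 2).
Proof.
move=> t0; have := br_qb B; move: t0 (bb B); set t := bt B => t0 b qb.
have -> : (b / t - eps) * (b / t - eps + 8 - eps ^+ 2) * t ^+ 2 =
  b ^+ 2 + (8 - 2 * eps - eps ^+ 2) * t * b - eps * ((8 - 2 * eps - eps ^+ 2) * t ^+ 2) - eps ^+ 2 * t ^+ 2.
  by field; rewrite gt_eqF.
by rewrite qb; ring.
Qed.

(** Everything is normalised by k t: with th = tau / (k t) the trace gives k' t' >= (1 - th) k t, so
    both exchanged comparisons lose their factors k and k' up to multiples of th. *)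
Lemma dominates_crossed eps (tau k k' : R) (B B' : branch eps) :
  0 < eps < 1 -> 0 < k -> 0 < k' -> 0 <= bt B -> bt B <= bt B' ->
  k * bt B - k' * bt B' <= tau ->
  k' * bb B' <= k * bmid B + tau -> k' * bmid B' <= k * bb B + tau ->
  8 * tau < eps ^+ 2 * (k * bt B) -> 0 <= tau ->
  eps ^+ 2 <= 2 * bt B ^+ 2 /\
  eps ^+ 4 * (k * (bt B' - bt B)) <= 198 * tau.
Proof.
move=> e01 k0 k'0 t0 tt tr hb hm small tau0.
have /andP[e0 e1] := e01.
have e2 : 0 < eps ^+ 2 by rewrite exprn_gt0.
have e21 : eps ^+ 2 <= 1 by nra.
have kt : 0 < k * bt B.
  by rewrite -(pmulr_rgt0 _ e2); apply: le_lt_trans small; apply: mulr_ge0.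
have t1 : 0 < bt B by move: kt; rewrite pmulr_rgt0.
have t1' : 0 < bt B' by apply: lt_le_trans tt.
have /andP[_ t11'] := br_t B'.
have [z [z1 z2 ez ez2]] := branch_z B; have [z' [z1' z2' ez' ez2']] := branch_z B'.
rewrite (branch_mid_z ez) in hb; rewrite (branch_mid_z ez') in hm.
have [_ be] := branch_b_ge e01 t0; have [_ be'] := branch_b_ge e01 (ltW t1').
have E := branch_bE t1; have E' := branch_bE t1'.
have hbB : bb B = bt B * (bb B / bt B) by field; rewrite gt_eqF.
have hbB' : bb B' = bt B' * (bb B' / bt B') by field; rewrite gt_eqF.
rewrite hbB in hm; rewrite hbB' in hb.
have B0 : eps <= bb B / bt B by rewrite ler_pdivlMr.
have B0' : eps <= bb B' / bt B' by rewrite ler_pdivlMr.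
pose th := tau / (k * bt B).
have thE : tau = k * bt B * th by rewrite /th; field; rewrite gt_eqF//= gt_eqF.
have th0 : 0 <= th by rewrite /th divr_ge0// ltW.
have th8 : 8 * th <= eps ^+ 2.
  by rewrite -(ler_pM2l kt); move: small; rewrite {1}thE; clear; lra.
move: B0 B0' hb hm E E'; move: (bb B / bt B) (bb B' / bt B') => b b' B0 B0' hb hm E E'.
have kt1 : k * bt B * (1 - th) <= k' * bt B' by move: tr; rewrite thE; clear; lra.
have c1 : (1 - th) * b' <= eps + 2 * (z - 1) + th.
  rewrite -(ler_pM2l kt).
  apply: le_trans (_ : k' * bt B' * b' <= _); first by rewrite mulrA; apply: ler_wpM2r => //; clear -B0' e0; lra.
  by move: hb; rewrite thE; clear; lra.
have c2 : (1 - th) * (eps + 2 * (z' - 1)) <= b + th.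
  rewrite -(ler_pM2l kt).
  apply: le_trans (_ : k' * bt B' * (eps + 2 * (z' - 1)) <= _).
    by rewrite mulrA; apply: ler_wpM2r => //; clear -e0 z1'; lra.
  by move: hm; rewrite thE; clear; lra.
have b3 : b' <= 3.
  have h : 7 / 8 * b' <= (1 - th) * b' by apply: ler_wpM2r; [clear -B0' e0; lra|clear -th8 e21; lra].
  by clear -h c1 z2 e1 th8 e21; lra.
have d1 : b' - eps <= 2 * (z - 1) + 4 * th.
  have : th * b' <= th * 3 by exact: ler_wpM2l.
  by clear -c1; lra.
have d2 : 2 * (z' - 1) <= b - eps + 3 * th.
  have : th * (eps + 2 * (z' - 1)) <= th * 2 by apply: ler_wpM2l => //; clear -e1 z2'; lra.
  by clear -c2; lra.
have [] := @crossing_bound _ eps (bt B) (bt B') z z' (b - eps) (b' - eps) th e01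
  t1 tt t11' z1 z2 z1' z2' ez2 ez2' _ _ E E' th0 th8 d1 d2; rewrite ?subr_ge0 ?subrK//.
move=> et etl; split => //.
have q : 0 <= k * (bt B' - bt B) by rewrite mulr_ge0 ?subr_ge0// ltW.
(* A second factor eps^2 is spent on eps^2 <= 2 t^2, which turns the bound on t'^2 - t^2 into one on
   t' - t. *)
have r1 : eps ^+ 2 * (k * (bt B' - bt B)) * eps ^+ 2 <= eps ^+ 2 * (k * (bt B' - bt B)) * (2 * bt B ^+ 2).
  by apply: ler_wpM2l => //; exact: mulr_ge0 (ltW e2) q.
have r2 : (k * bt B) * (eps ^+ 2 * (bt B' ^+ 2 - bt B ^+ 2)) <= (k * bt B) * (198 * th) by rewrite ler_pM2l.
have r3 : eps ^+ 2 * k * bt B * ((bt B' - bt B) * (2 * bt B)) <= eps ^+ 2 * k * bt B * ((bt B' - bt B) * (bt B' + bt B)).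
  apply: ler_wpM2l.
    by rewrite !mulr_ge0 ?ltW.
  by apply: ler_wpM2l; [rewrite subr_ge0|rewrite mulr_natl mulr2n lerD2r].
have -> : eps ^+ 4 = eps ^+ 2 * eps ^+ 2 by rewrite -exprD.
by rewrite {1}thE; clear -r1 r2 r3; lra.
Qed.

End CrossedCase.

(** * All cases together *)

Section DominationBound.
Variable R : realFieldType.
Implicit Types (eps t k tau : R).

Lemma exprn_ger_pow eps n (x y : R) : 0 < eps < 1 -> 0 <= y ->
  x <= y -> eps ^+ n * x <= y.
Proof.
move=> /andP[e0 e1] y0 xy; have en : eps ^+ n <= 1 by rewrite exprn_ile1 ?ltW.
have en0 : 0 <= eps ^+ n by rewrite exprn_ge0 ?ltW.
have [x0|x0] := leP x 0; first by apply: le_trans y0; rewrite mulr_ge0_le0.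
by apply: le_trans xy; rewrite ler_piMl// ltW.
Qed.

Lemma dominates_rising eps (tau k k' : R) (B B' : branch eps) :
  0 < eps < 1 -> 0 < k -> 0 < k' -> 0 <= tau -> 0 <= bt B -> bt B <= bt B' ->
  dominates tau k B k' B' ->
  [/\ eps ^+ 5 * (k - k') <= 285 * tau, eps ^+ 5 * (k' - k) <= 285 * tau &
      eps ^+ 4 * (Num.min k k' * (bt B' - bt B)) <= 200 * tau].
Proof.
move=> e01 k0 k'0 tau0 t0 tt dom; have /andP[e0 e1] := e01.
have e4 : 0 < eps ^+ 4 by rewrite exprn_gt0.
have e2 : 0 < eps ^+ 2 by rewrite exprn_gt0.
have t0' := le_trans t0 tt.
have tr := dominates_trace_le e01 tau0 dom.
have [sum cases] := dominates_middle e01 k0 k'0 t0 tt dom.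
have [rl rl'] := dominates_rising_le e01 k0 k'0 tau0 t0 tt dom.
have [z [z1 z2 ez ez2]] := branch_z B; have [z' [z1' z2' ez' ez2']] := branch_z B'.
have [zz _] := z_of_t_lip t0 tt z1 z2 z1' z2' ez2 ez2'.
have mE := branch_mid_z ez; have mE' := branch_mid_z ez'.
have m0 : eps * bt B <= bmid B by rewrite mE [eps * _]mulrC ler_wpM2l//; clear -z1; lra.
have m0' : eps * bt B' <= bmid B' by rewrite mE' [eps * _]mulrC ler_wpM2l//; clear -z1'; lra.
have mm : bmid B <= bmid B' by rewrite mE mE'; apply: ler_pM => //; clear -e0 z1 zz; lra.
have [b2 bet] := branch_b_ge e01 t0; have [b2' bet'] := branch_b_ge e01 t0'.
have [bl bl'] := branch_b_lip e01 t0 tt.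
have et0 : 0 <= eps * bt B by rewrite mulr_ge0// ltW.
have et0' : 0 <= eps * bt B' by rewrite mulr_ge0// ltW.
have min1 : Num.min k k' * (bt B' - bt B) <= k * (bt B' - bt B).
  by apply: ler_wpM2r; [rewrite subr_ge0|rewrite ge_min lexx].
have min2 : Num.min k k' * (bt B' - bt B) <= k' * (bt B' - bt B).
  by apply: ler_wpM2r; [rewrite subr_ge0|rewrite ge_min lexx orbT].
case: cases => [hm|[hb hm]].
  have d := dominates_direct e01 k'0 tau0 t0 tt dom hm.
  split.
  - have -> : eps ^+ 5 * (k - k') = eps ^+ 4 * (eps * (k - k')) by ring.
    apply: (exprn_ger_pow _ e01); first by clear -tau0; lra.
    have : eps * (5 * (k - k')) <= eps * (3 * (k' * (bt B' - bt B)) + tau) by rewrite ler_pM2l.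
    have : eps * tau <= tau by rewrite ler_piMl// ltW.
    by clear -d tau0; lra.
  - have -> : eps ^+ 5 * (k' - k) = eps ^+ 2 * (eps * (eps ^+ 2 * (k' - k))) by ring.
    apply: (exprn_ger_pow _ e01); first by clear -tau0; lra.
    have [kk|kk] := leP (k' - k) 0.
      apply: le_trans (_ : 0 <= _); last by clear -tau0; lra.
      by apply: mulr_ge0_le0; [exact: ltW|apply: mulr_ge0_le0 => //; exact: ltW].
    have : (k' - k) * eps ^+ 2 <= (k' - k) * (bmid B + bb B).
      by rewrite ler_pM2l//; clear -b2 m0 et0; lra.
    have : k' * (bmid B + bb B - (bmid B' + bb B')) <= k' * (8 * (bt B' - bt B)).
      by rewrite ler_pM2l//; clear -bl mm; lra.
    move=> h1 h2.
    have : eps ^+ 2 * (k' - k) <= 8 * (k' * (bt B' - bt B)) + 2 * tau.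
      by clear -h1 h2 sum; lra.
    rewrite -(ler_pM2l e0).
    have : eps * tau <= tau by rewrite ler_piMl// ltW.
    by clear -d tau0; lra.
  - have -> : eps ^+ 4 * (Num.min k k' * (bt B' - bt B)) = eps ^+ 3 * (eps * (Num.min k k' * (bt B' - bt B))) by ring.
    apply: (exprn_ger_pow _ e01); first by clear -tau0; lra.
    have : eps * (Num.min k k' * (bt B' - bt B)) <= eps * (k' * (bt B' - bt B)) by rewrite ler_pM2l.
    by clear -d tau0; lra.
(* If k t is itself of order tau, then so is k', because bb >= eps^2 at [B']; no comparison of t
   with t' is then required. *)
have [big|small] := leP (eps ^+ 2 * (k * bt B)) (8 * tau).
  have M2 : bmid B <= 2 * bt B.
    rewrite mE mulrC; apply: ler_wpM2r => //; clear -e1 z2; lra.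
  have h1 : eps ^+ 2 * (k' * bb B') <= 17 * tau.
    have : eps ^+ 2 * (k' * bb B') <= eps ^+ 2 * (k * bmid B + tau) by rewrite ler_pM2l.
    have : eps ^+ 2 * (k * bmid B) <= eps ^+ 2 * (k * (2 * bt B)) by rewrite !ler_pM2l.
    have : eps ^+ 2 * tau <= tau by exact: exprn_ger_pow e01 tau0 (lexx _).
    by clear -big; lra.
  have h2 : eps ^+ 4 * k' <= 17 * tau.
    have : eps ^+ 2 * (k' * eps ^+ 2) <= eps ^+ 2 * (k' * bb B') by rewrite !ler_pM2l.
    by clear -h1; lra.
  have /andP[_ t1'] := br_t B'.
  have h3 : k' * (bt B' - bt B) <= k' by apply: ler_piMr; [exact: ltW|clear -t1' t0; lra].
  have h4 : eps ^+ 4 * (k' * (bt B' - bt B)) <= 17 * tau.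
    by apply: le_trans h2; rewrite ler_pM2l.
  have e44 : eps ^+ 4 * tau <= tau by exact: exprn_ger_pow e01 tau0 (lexx _).
  split.
  - have -> : eps ^+ 5 * (k - k') = eps ^+ 1 * (eps ^+ 4 * (k - k')) by ring.
    apply: (exprn_ger_pow _ e01); first by clear -tau0; lra.
    have : eps ^+ 4 * (5 * (k - k')) <= eps ^+ 4 * (3 * (k' * (bt B' - bt B)) + tau) by rewrite ler_pM2l.
    by clear -h4 e44 tau0; lra.
  - have -> : eps ^+ 5 * (k' - k) = eps ^+ 1 * (eps ^+ 4 * (k' - k)) by ring.
    apply: (exprn_ger_pow _ e01); first by clear -tau0; lra.
    have : 0 <= eps ^+ 4 * k by apply: mulr_ge0; apply: ltW.
    by clear -h2 tau0; lra.
  - have : eps ^+ 4 * (Num.min k k' * (bt B' - bt B)) <= eps ^+ 4 * (k' * (bt B' - bt B)) by rewrite ler_pM2l.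
    by clear -h4 tau0; lra.
have [te d] := dominates_crossed e01 k0 k'0 t0 tt tr hb hm small tau0.
have e44 : eps ^+ 4 * tau <= tau by exact: exprn_ger_pow e01 tau0 (lexx _).
split.
- have -> : eps ^+ 5 * (k - k') = eps ^+ 1 * (eps ^+ 4 * (k - k')) by ring.
  apply: (exprn_ger_pow _ e01); first by clear -tau0; lra.
  have : eps ^+ 4 * (5 * (k - k')) <= eps ^+ 4 * (3 * (k * (bt B' - bt B)) + tau) by rewrite ler_pM2l.
  by clear -d e44 tau0; lra.
- have [kk|kk] := leP (k' - k) 0.
    apply: le_trans (_ : 0 <= _); last by clear -tau0; lra.
    by apply: mulr_ge0_le0 => //; rewrite exprn_ge0 ?ltW.
  (* 7 / 10 is below 1 / sqrt 2; with t bounded below, the sharper estimate of [branch_b_lip] can be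
     divided by t. The constant 285 is 10 * 199 / 7 rounded up. *)
  have t10 : 7 * eps <= 10 * bt B.
    rewrite leNgt; apply/negP => lt.
    have : (10 * bt B) ^+ 2 < (7 * eps) ^+ 2 by rewrite ltr_pXn2r ?nnegrE//; clear -t0 e0; lra.
    by rewrite !exprMn; clear -te e2; lra.
  have S0 : 0 < bmid B' + bb B' by apply: lt_le_trans (_ : eps ^+ 2 <= _) => //; clear -m0' et0' b2'; lra.
  have h1 : bt B * ((k' - k) * (bmid B' + bb B')) <= k * ((bt B' - bt B) * (bb B' - eps * bt B')) + 2 * tau * bt B.
    apply: le_trans (_ : bt B * (k * (bb B - bb B') + 2 * tau) <= _).
      apply: ler_wpM2l => //.
      have : k * bmid B <= k * bmid B' by rewrite ler_pM2l.
      by clear -sum; lra.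
    have : k * (bt B * (bb B - bb B')) <= k * ((bt B' - bt B) * (bb B' - eps * bt B')) by rewrite ler_pM2l.
    by clear; lra.
  have h2 : eps * (bt B * (k' - k)) <= eps * (k * (bt B' - bt B)) + tau.
    rewrite -(ler_pM2r S0).
    have i1 : eps * (k * ((bt B' - bt B) * (bb B' - eps * bt B'))) <= eps * (k * ((bt B' - bt B) * (bmid B' + bb B'))).
      rewrite ler_pM2l// ler_pM2l//; apply: ler_wpM2l; first by clear -tt; lra.
      by clear -et0' m0'; lra.
    have i2 : tau * (2 * (eps * bt B)) <= tau * (bmid B' + bb B').
      apply: ler_wpM2l => //.
      have : eps * bt B <= eps * bt B' by rewrite ler_pM2l.
      by clear -m0' bet'; lra.
    have i3 : eps * (bt B * ((k' - k) * (bmid B' + bb B'))) <=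
      eps * (k * ((bt B' - bt B) * (bb B' - eps * bt B')) + 2 * tau * bt B) by rewrite ler_pM2l.
    by clear -i1 i2 i3; lra.
  have h3 : eps ^+ 4 * (bt B * (k' - k)) <= 199 * tau.
    rewrite -(ler_pM2l e0).
    have : eps ^+ 4 * (eps * (bt B * (k' - k))) <= eps ^+ 4 * (eps * (k * (bt B' - bt B)) + tau) by rewrite ler_pM2l.
    have : eps * (eps ^+ 4 * (k * (bt B' - bt B))) <= eps * (198 * tau) by rewrite ler_pM2l.
    have : eps * (eps ^+ 3 * tau) <= eps * tau by rewrite ler_pM2l//; apply: exprn_ger_pow.
    by clear; lra.
  have : eps ^+ 4 * (7 * eps * (k' - k)) <= eps ^+ 4 * (10 * bt B * (k' - k)) by rewrite ler_pM2l// ler_pM2r.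
  by clear -h3 tau0; lra.
- have : eps ^+ 4 * (Num.min k k' * (bt B' - bt B)) <= eps ^+ 4 * (k * (bt B' - bt B)) by rewrite ler_pM2l.
  by clear -d tau0; lra.
Qed.

Lemma dominates_bound eps (tau k k' : R) (B B' : branch eps) :
  0 < eps < 1 -> 0 < k -> 0 < k' -> 0 <= tau -> dominates tau k B k' B' ->
  eps ^+ 5 * `|k - k'| <= 285 * tau /\
  eps ^+ 4 * (Num.min k k' * `|bt B - bt B'|) <= 200 * tau.
Proof.
move=> e01 k0 k'0 tau0 dom; have /andP[e0 e1] := e01.
have e5 : 0 <= eps ^+ 5 by rewrite exprn_ge0 ?ltW.
suff [h1 h2 h3] : [/\ eps ^+ 5 * (k - k') <= 285 * tau, eps ^+ 5 * (k' - k) <= 285 * tau &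
      eps ^+ 4 * (Num.min k k' * `|bt B - bt B'|) <= 200 * tau].
  split=> //; have [kk|kk] := ger0P (k - k'); first exact: h1.
  by rewrite opprB.
have [tt|tt] := leP (bt B') (bt B).
  have [h1 h2 h3] := dominates_anti e01 k0 k'0 tau0 dom tt.
  rewrite ger0_norm ?subr_ge0//.
  split; apply: (exprn_ger_pow _ e01); try by clear -tau0 h1 h2; lra.
  have : Num.min k k' * (bt B - bt B') <= k * (bt B - bt B').
    by apply: ler_wpM2r; [clear -tt; lra|rewrite ge_min lexx].
  by clear -h3 tau0; lra.
rewrite ltr0_norm ?subr_lt0// opprB.
have [t0|t0] := leP 0 (bt B).
  exact: (dominates_rising e01 k0 k'0 tau0 t0 (ltW tt)).
have [t0'|t0'] := leP (bt B') 0.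
  have := @dominates_rising _ _ _ _ (branch_opp B') (branch_opp B) e01 k'0 k0 tau0.
  rewrite !branch_optE oppr_ge0 lerN2 => /(_ t0' (ltW tt) (dominates_opp dom)) [h1 h2 h3].
  split=> //; rewrite minC.
  by move: h3; rewrite opprK addrC.
have h1 := dominates_opposite e01 k0 k'0 tau0 dom (ltW t0) (ltW t0').
have h2 := dominates_opposite_max e01 k0 k'0 tau0 dom (ltW t0) (ltW t0').
have h3 : eps * (k - k') <= 6 * tau.
  have := @dominates_opposite_max _ _ _ _ _ (branch_opp B') (branch_opp B) e01 k'0 k0 tau0.
  by rewrite !branch_optE oppr_ge0 oppr_le0; apply => //; [exact: dominates_opp| exact: ltW| exact: ltW].
split.
- have -> : eps ^+ 5 * (k - k') = eps ^+ 4 * (eps * (k - k')) by ring.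
  by apply: (exprn_ger_pow _ e01); clear -h3 tau0; lra.
- have -> : eps ^+ 5 * (k' - k) = eps ^+ 4 * (eps * (k' - k)) by ring.
  by apply: (exprn_ger_pow _ e01); clear -h2 tau0; lra.
- set m := Num.min k k'; have -> : eps ^+ 4 * (m * (bt B' - bt B)) = eps ^+ 3 * (eps * (m * (bt B' - bt B))) by ring.
  apply: (exprn_ger_pow _ e01); first by clear -tau0; lra.
  have i1 : eps * (m * bt B') <= eps * (k' * bt B').
    by rewrite ler_pM2l// ler_pM2r// /m ge_min lexx orbT.
  have i2 : eps * (m * - bt B) <= eps * (k * - bt B).
    by rewrite ler_pM2l// ler_pM2r ?oppr_gt0// /m ge_min lexx.
  by clear -i1 i2 h1 tau0; lra.
Qed.

End DominationBound.

Local Open Scope classical_set_scope.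

(** * The operator as a lower envelope *)

Section Envelope.
Context {R : realType} {n : nat}.
Implicit Types (l p d : 'rV[R]_n) (K : R) (L : set 'rV[R]_n).

Definition gauge K d : R := \sum_i (d 0 i + K * Num.max (d 0 i) 0).

Lemma gauge0 K : gauge K 0 = 0.
Proof. by rewrite /gauge big1// => i _; rewrite mxE maxxx; ring. Qed.

Lemma gauge_perm K (s : 'S_n) d : gauge K (col_perm s d) = gauge K d.
Proof.
rewrite /gauge [RHS](reindex_inj (@perm_inj _ s)); apply: eq_bigr => i _.
by rewrite !mxE.
Qed.

Lemma gaugeD K d d' : 0 <= K -> gauge K (d + d') <= gauge K d + gauge K d'.
Proof.
move=> K0; rewrite /gauge -big_split/=; apply: ler_sum => i _; rewrite !mxE.
set x := d 0 i; set y := d' 0 i.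
have : K * Num.max (x + y) 0 <= K * (Num.max x 0 + Num.max y 0).
  by apply: ler_wpM2l => //; case: (leP (x + y) 0); case: (leP x 0); case: (leP y 0); lra.
lra.
Qed.

Lemma gauge_le K d : 0 <= K -> gauge K d <= (1 + K) * \sum_i `|d 0 i|.
Proof.
move=> K0; rewrite mulr_sumr; apply: ler_sum => i _; set x := d 0 i.
have h1 : x <= `|x| by exact: ler_norm.
have : K * Num.max x 0 <= K * `|x| by apply: ler_wpM2l; rewrite // ge_max h1 normr_ge0.
lra.
Qed.

Lemma gauge_nneg K d : (forall i, 0 <= d 0 i) -> gauge K d = (1 + K) * \sum_i d 0 i.
Proof.
move=> d0; rewrite mulr_sumr; apply: eq_bigr => i _.
by rewrite max_l//; ring.
Qed.

Lemma gauge_npos K d : (forall i, 0 <= d 0 i) -> gauge K (- d) = - \sum_i d 0 i.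
Proof.
move=> d0; rewrite -sumrN; apply: eq_bigr => i _.
by rewrite mxE max_r ?oppr_le0//; ring.
Qed.

(* An infimum of functions of slopes between [1] and [1 + K], hence elliptic; it vanishes
   on [L] as soon as [gauge K] is nonnegative on the differences of points of [L]. *)
Definition lower_envelope K L l : R := inf [set gauge K (l - p) | p in L].

Context (K : R) (L : set 'rV[R]_n).
Hypotheses (K0 : 0 <= K) (L0 : L !=set0)
  (Lgauge : forall p q, L p -> L q -> 0 <= gauge K (p - q)).

Let f := lower_envelope K L.

(** By subadditivity gauge (l - p) >= gauge (q - p) - gauge (q - l) for a fixed q in [L], and the
    first term is nonnegative. Hence [inf] is a true infimum. *)
Let lbound_gauge l : has_lbound [set gauge K (l - p) | p in L].
Proof.
have [q Lq] := L0; exists (- gauge K (q - l)) => _ [p Lp <-].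
have := gaugeD (q - l) (l - p) K0; rewrite addrA subrK.
have := Lgauge Lq Lp; lra.
Qed.

Lemma lower_envelope_le l p : L p -> f l <= gauge K (l - p).
Proof. by move=> Lp; apply: ge_inf => //; exists p. Qed.

Lemma lower_envelope_ge l x : (forall p, L p -> x <= gauge K (l - p)) -> x <= f l.
Proof.
move=> h; apply: lb_le_inf; last by move=> _ [p Lp <-]; exact: h.
by have [q Lq] := L0; exists (gauge K (l - q)), q.
Qed.

Lemma lower_envelopeD l d : f (l + d) <= f l + gauge K d.
Proof.
rewrite -lerBlDr; apply: lower_envelope_ge => p Lp.
have := lower_envelope_le (l + d) Lp; have := gaugeD (l - p) d K0.
rewrite (_ : l - p + d = l + d - p); last by rewrite addrAC.
lra.
Qed.

Lemma lower_envelope_eq0 p : L p -> f p = 0.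
Proof.
move=> Lp; apply/eqP; rewrite eq_le; apply/andP; split.
  by have := lower_envelope_le p Lp; rewrite subrr gauge0.
by apply: lower_envelope_ge => q Lq; exact: Lgauge.
Qed.

Lemma lower_envelope_perm : (forall (s : 'S_n) p, L p -> L (col_perm s p)) ->
  permutation_invariant f.
Proof.
move=> Ls; have le (s : 'S_n) l : f (col_perm s l) <= f l.
  apply: lower_envelope_ge => p Lp; rewrite -(gauge_perm _ s) linearB/=.
  by apply: lower_envelope_le; exact: Ls.
move=> s l; apply/eqP; rewrite eq_le le/=.
by have := le (s^-1)%g (col_perm s l); rewrite -col_permM mulVg col_perm1.
Qed.

Lemma lower_envelope_mono l d : (forall i, 0 <= d 0 i) ->
  \sum_i d 0 i <= f (l + d) - f l <= (1 + K) * \sum_i d 0 i.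
Proof.
move=> d0; have := lower_envelopeD l d; have := lower_envelopeD (l + d) (- d).
by rewrite addrK (gauge_nneg K d0) (gauge_npos K d0) => h1 h2; apply/andP; split; lra.
Qed.

Lemma lower_envelope_lipschitz : lipschitz f.
Proof.
exists ((1 + K) * n%:R); split; first exact: num_real.
move=> M /ltW KM [l l'] _ /=; apply: le_trans (ler_wpM2r (normr_ge0 _) KM).
have sum_le d : \sum_i `|d 0 i| <= n%:R * `|d|.
  rewrite -[n in n%:R]card_ord -sumr_const mulr_suml; apply: ler_sum => i _; rewrite mul1r.
  rewrite [leRHS]/Num.norm/= mx_normrE.
  exact: (le_bigmax_cond _ (fun ij => `|d ij.1 ij.2|) (j := (0, i))).
rewrite -mulrA ler_norml; apply/andP; split.
- have := lower_envelopeD l (l' - l); have := gauge_le (l' - l) K0.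
  rewrite (addrC l) subrK; have := sum_le (l' - l); rewrite [`|l - l'|]distrC => h1 h2 h3.
  have : (1 + K) * \sum_i `|(l' - l) 0 i| <= (1 + K) * (n%:R * `|l' - l|).
    by apply: ler_wpM2l => //; exact: addr_ge0.
  lra.
- have := lower_envelopeD l' (l - l'); have := gauge_le (l - l') K0.
  rewrite (addrC l') subrK; have := sum_le (l - l') => h1 h2 h3.
  have : (1 + K) * \sum_i `|(l - l') 0 i| <= (1 + K) * (n%:R * `|l - l'|).
    by apply: ler_wpM2l => //; exact: addr_ge0.
  lra.
Qed.

End Envelope.

(** * The spectrum of the conformal Hessian *)

Section Perturbation.
Context {R : realType}.

(** On y >= 0 the derivative of exp (-al y) has modulus at most al, and that of exp y is at least 1;
    both are expressed through 1 + x <= exp x. *)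
Lemma expR_comparison (al y y' : R) : 0 <= al -> 0 <= y -> y <= y' ->
  0 <= expR (- (al * y)) - expR (- (al * y')) <= al * (expR y' - expR y).
Proof.
move=> a0 y0 yy; apply/andP; split.
  by rewrite subr_ge0 ler_expR lerN2 ler_wpM2l.
have e1 : expR (- (al * y')) = expR (- (al * y)) * expR (- (al * (y' - y))).
  by rewrite -expRD; congr expR; ring.
have e2 : expR y' = expR y * expR (y' - y) by rewrite -expRD; congr expR; ring.
have h1 := expR_ge1Dx (- (al * (y' - y))); have h2 := expR_ge1Dx (y' - y).
have h3 : expR (- (al * y)) <= 1 by rewrite -expR0 ler_expR oppr_le0 mulr_ge0.
have h4 : 1 <= expR y by rewrite -expR0 ler_expR.
have h5 := expR_gt0 (- (al * y)).
have h6 : 0 <= al * (y' - y) by rewrite mulr_ge0// subr_ge0.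
have h7 : expR (- (al * y)) * (1 - expR (- (al * (y' - y)))) <= al * (y' - y).
  apply: le_trans (_ : expR (- (al * y)) * (al * (y' - y)) <= _).
    by apply: ler_wpM2l; [exact: ltW|lra].
  by rewrite -[leRHS]mul1r; apply: ler_wpM2r.
have h8 : y' - y <= expR y * (expR (y' - y) - 1).
  apply: le_trans (_ : 1 * (y' - y) <= _); first by rewrite mul1r.
  by apply: ler_pM => //; lra.
have h9 : al * (y' - y) <= al * (expR y * (expR (y' - y) - 1)) by apply: ler_wpM2l.
by rewrite e1 e2; move: h7 h9; rewrite !mulrBr !mulr1; lra.
Qed.

(** With y = -delta ln r the two powers are exp (-al y) and exp y, where al = 2 (1 - delta) / delta.
    The power on the right carries the factor c in [scale_factor], so its variation costs only 1 / c
    of that of k. *)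
Lemma powR_comparison (delta r r' : R) : 0 < delta < 1 -> 0 < r <= 1 -> 0 < r' <= 1 ->
  `|r `^ (2 * (1 - delta)) - r' `^ (2 * (1 - delta))| <=
  2 * (1 - delta) / delta * `|r `^ (- delta) - r' `^ (- delta)|.
Proof.
move=> /andP[d0 d1]; have d00 : delta != 0 by rewrite gt_eqF.
wlog rr : r r' / r' <= r => [H hr hr'|].
  have /orP[/H|/H] := le_total r' r; first exact.
  by rewrite distrC [`|_ `^ (- _) - _|]distrC; apply.
move=> /andP[r0 r1] /andP[r'0 r'1].
have a0 : 0 <= 2 * (1 - delta) / delta.
  by apply: divr_ge0; [apply: mulr_ge0; lra|exact: ltW].
pose y (r : R) := - delta * ln r.
have y1 : 0 <= y r by rewrite /y mulNr oppr_ge0 pmulr_rle0// ln_le0.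
have y2 : y r <= y r'.
  by rewrite /y !mulNr lerN2 ler_pM2l// ler_ln.
have vE (z : R) : 0 < z -> z `^ (2 * (1 - delta)) = expR (- (2 * (1 - delta) / delta * y z)).
  by move=> z0; rewrite /powR gt_eqF// /y; congr expR; field.
have RE (z : R) : 0 < z -> z `^ (- delta) = expR (y z) by move=> z0; rewrite /powR gt_eqF.
rewrite !vE// !RE//.
have /andP[h1 h2] := expR_comparison a0 y1 y2.
by rewrite ger0_norm// distrC ger0_norm// subr_ge0 ler_expR.
Qed.

(* With [r = |x|] and [t = P(x) / r^3], these are [u(x) r^(-delta)] and [|Du(x)|^2 / 2]. *)
Definition scale_factor delta c (r t : R) : R := c * r `^ (- delta) + r `^ (2 * (1 - delta)) * t.

Definition shift_term delta (r t : R) : R :=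
  r `^ (2 * (1 - delta)) * (9 - (8 - 2 * (1 - delta) - (1 - delta) ^+ 2) * t ^+ 2) / 2.

(** Here r stands for |x|^(-delta) and v for |x|^(2 (1 - delta)). From k = c r + v t one gets c |r -
    r'| <= |k - k'| + |v - v'| + |t - t'|; the middle term is at most al |r - r'| and is absorbed,
    which leaves the factor c - al. *)
Lemma shift_bound (al c e r v t r' v' t' k k' : R) :
  0 <= al -> 0 <= e <= 8 -> al + 1 <= c -> 9 <= c ->
  1 <= r -> 1 <= r' -> 0 <= v <= 1 -> 0 <= v' <= 1 -> -1 <= t <= 1 -> -1 <= t' <= 1 ->
  `|v - v'| <= al * `|r - r'| -> k = c * r + v * t -> k' = c * r' + v' * t' ->
  (c - al) * `|v * (9 - e * t ^+ 2) / 2 - v' * (9 - e * t' ^+ 2) / 2| <=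
    9 / 2 * al * `|k - k'| + 9 * (Num.min k k' * `|t - t'|).
Proof.
move=> a0 /andP[e0 e8] ac c9 r1 r'1 /andP[v0 v1] /andP[v'0 v'1] ht ht' vr kE k'E.
have [/andP[t0 t1] /andP[t'0 t'1]] := (ht, ht').
have nt : `|t| <= 1 by rewrite ler_norml ht.
have vt : `|v * t| <= 1 by rewrite normrM (ger0_norm v0) mulr_ile1.
have nt' : `|t'| <= 1 by rewrite ler_norml ht'.
have vt' : `|v' * t'| <= 1 by rewrite normrM (ger0_norm v'0) mulr_ile1.
have c0 : 0 <= c by clear -c9; lra.
have kc : c - 1 <= k.
  by move: vt; rewrite ler_norml kE => /andP[? _]; have := (ler_wpM2l c0 r1); lra.
have k'c : c - 1 <= k'.
  by move: vt'; rewrite ler_norml k'E => /andP[? _]; have := (ler_wpM2l c0 r'1); lra.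
set d := `|t - t'|; have d0 : 0 <= d by exact: normr_ge0.
have md : (c - 1) * d <= Num.min k k' * d by apply: ler_wpM2r => //; rewrite le_min kc k'c.
apply: le_trans (_ : _ <= 9 / 2 * al * `|k - k'| + 9 * ((c - 1) * d)) _; last by clear -md; lra.
have hR : c * `|r - r'| <= `|k - k'| + `|v - v'| + d.
  have -> : c * `|r - r'| = `|(k - k') - (v - v') * t - v' * (t - t')|.
    rewrite (_ : _ - _ - _ = c * (r - r')); last by rewrite kE k'E; ring.
    by rewrite normrM [in RHS]ger0_norm//; lra.
  apply: le_trans (ler_normB _ _) _; apply: lerD.
    apply: le_trans (ler_normB _ _) _; rewrite lerD2l normrM.
    by rewrite -[leRHS]mulr1; apply: ler_wpM2l.
  rewrite normrM (ger0_norm v'0) -[leRHS]mul1r; exact: ler_wpM2r.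
have hv : (c - al) * `|v - v'| <= al * (`|k - k'| + d).
  have : al * (c * `|r - r'|) <= al * (`|k - k'| + `|v - v'| + d) by apply: ler_wpM2l.
  have : c * `|v - v'| <= c * (al * `|r - r'|) by apply: ler_wpM2l.
  by clear; lra.
have hs : `|v * (9 - e * t ^+ 2) / 2 - v' * (9 - e * t' ^+ 2) / 2| <=
    9 / 2 * `|v - v'| + 8 * d.
  have -> : v * (9 - e * t ^+ 2) / 2 - v' * (9 - e * t' ^+ 2) / 2 =
    (v - v') * ((9 - e * t ^+ 2) / 2) - (v' * e) * ((t + t') / 2) * (t - t') by field.
  apply: le_trans (ler_normB _ _) _; apply: lerD.
    rewrite normrM [leRHS]mulrC; apply: ler_wpM2l => //.
    have q0 : 0 <= t ^+ 2 by exact: sqr_ge0.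
    have q1 : t ^+ 2 <= 1 by rewrite -(ger0_norm q0) normrX exprn_ile1.
    have eq0 : 0 <= e * t ^+ 2 by rewrite mulr_ge0.
    have eq1 : e * t ^+ 2 <= 8 * 1 by apply: ler_pM.
    by rewrite ger0_norm; clear -eq0 eq1; lra.
  rewrite normrM; apply: ler_wpM2r => //; rewrite normrM -[leRHS]mulr1.
  apply: ler_pM => //; last first.
    by rewrite ler_norml; apply/andP; clear -t0 t1 t'0 t'1; split; lra.
  by rewrite normrM (ger0_norm v'0) (ger0_norm e0) -[leRHS]mul1r; apply: ler_pM.
have ca : 0 <= c - al by clear -ac; lra.
apply: le_trans (ler_wpM2l ca hs) _.
have : (al * 7 / 2) * d >= 0 by rewrite mulr_ge0//; clear -a0; lra.
have : (c - 9) * d >= 0 by rewrite mulr_ge0//; clear -c9; lra.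
by clear -hv; lra.
Qed.

End Perturbation.

Lemma powR_le1 (R : realType) (r a : R) : 0 < r <= 1 -> 0 <= a -> r `^ a <= 1.
Proof.
move=> /andP[r0 r1] a0; rewrite -[leRHS](congr1 (@^~ a) (powR1 R)).
by apply: ge0_ler_powR => //; rewrite nnegrE ?ltW.
Qed.

Lemma scale_factor_pos (R : realFieldType) (c t v w : R) : 9 <= c ->
  -1 <= t <= 1 -> 0 <= v <= 1 -> 1 <= w -> 0 < c * w + v * t.
Proof.
move=> c9 /andP[t0 t1] /andP[v0 v1] w1.
have : c * 1 <= c * w by apply: ler_wpM2l => //; lra.
have : v * (-1) <= v * t by apply: ler_wpM2l.
by lra.
Qed.

Lemma eccentricity_bound (R : realFieldType) (delta : R) : 0 < delta < 1 ->
  0 <= 8 - 2 * (1 - delta) - (1 - delta) ^+ 2 <= 8.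
Proof. by move=> /andP[d0 d1]; apply/andP; split; nra. Qed.

Lemma shift_sub_le (R : realFieldType) (a b S S' tau : R) :
  b - S' - tau <= a - S -> b - (tau + `|S - S'|) <= a.
Proof.
by have := ler_norm (S' - S); rewrite distrC; lra.
Qed.

(** The lower bound on c makes the right-hand side at most (c - al) (tau + D) / 2, so D <= (tau + D)
    / 2. This is the source of the factor 2 in the condition on c. *)
Lemma absorb_shift (R : realFieldType) (al c a b D tau k m : R) :
  0 <= al -> al < c -> al + 2 * (9 / 2 * al * a + 9 * b) <= c -> 0 <= tau + D ->
  (c - al) * D <= 9 / 2 * al * k + 9 * m -> k <= a * (tau + D) -> m <= b * (tau + D) ->
  D <= tau.
Proof.
move=> al0 ac cl T0 h hk hm; have ca : 0 < c - al by rewrite subr_gt0.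
have x1 : al * k <= al * (a * (tau + D)) by exact: ler_wpM2l.
have QT : 0 <= (c - al - 2 * (9 / 2 * al * a + 9 * b)) * (tau + D).
  by rewrite mulr_ge0// -addrA -opprD subr_ge0.
have : (c - al) * D <= (c - al) * ((tau + D) / 2) by lra.
by rewrite ler_pM2l//; lra.
Qed.

(** 32 = 16 * 2: the trace coefficient is at most 16, and T <= 2 tau. *)
Lemma trace_difference_bound (R : realFieldType) (eps a b k m x D tau T : R) : 0 < eps < 1 ->
  0 <= a -> 0 <= b -> `|x| <= k + m -> k <= a * T -> m <= b * T -> T <= 2 * tau ->
  `|D| <= tau -> `|- ((2 - eps) * (7 + eps) * x) - 5 * D| <= (32 * (a + b) + 5) * tau.
Proof.
move=> /andP[e0 e1] a0 b0 hx hk hm hT hD.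
have L0 : 0 <= (2 - eps) * (7 + eps) by apply: mulr_ge0; lra.
have L1 : (2 - eps) * (7 + eps) <= 16 by nra.
have hab : (a + b) * T <= (a + b) * (2 * tau) by apply: ler_wpM2l => //; exact: addr_ge0.
have hx' : `|x| <= (a + b) * T by lra.
apply: le_trans (ler_normB _ _) _; rewrite normrN.
have -> : `|(2 - eps) * (7 + eps) * x| = (2 - eps) * (7 + eps) * `|x|.
  by rewrite normrM (ger0_norm L0).
have -> : `|5 * D| = 5 * `|D| by rewrite normrM ger0_norm.
have := ler_pM L0 (normr_ge0 _) L1 hx'.
by lra.
Qed.

(** * The gauge inequality on the set of spectra *)

Section EigenvalueSet.
Context {R : realType} (delta c : R).
Let eps := 1 - delta.
Implicit Types (r : R) (B : branch (1 - delta)).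

Definition conformal_eig r B : 'I_5 -> R :=
  fun i => scale_factor delta c r (bt B) * branch_eig B i - shift_term delta r (bt B).

(* Every [lambda (A^u (x))] with [0 < |x| <= 1], in all orders; only this inclusion is proved
   and needed. *)
Definition eigenvalue_set : set 'rV[R]_5 := [set l | exists r B (s : 'S_5),
  0 < r <= 1 /\ l = \row_i conformal_eig r B (s i)].

Definition trace_const : R := 32 * (285 / eps ^+ 5 + 200 / eps ^+ 4) + 5.

Hypotheses (d01 : 0 < delta < 1) (c9 : 9 <= c)
  (c_large : 2 * eps / delta + 2 * (9 / 2 * (2 * eps / delta) * (285 / eps ^+ 5) +
    9 * (200 / eps ^+ 4)) <= c).

Lemma conformal_eig_dominates r B r' B' (tau : R) (s : 'S_5) : 0 < r <= 1 -> 0 < r' <= 1 -> 0 <= tau ->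
  (forall i, conformal_eig r' B' (s i) - tau <= conformal_eig r B i) ->
  `|\sum_i conformal_eig r B i - \sum_i conformal_eig r' B' i| <= trace_const * tau.
Proof.
move=> hr hr' tau0 dom; have d01' := d01; have [/andP[d0 d1] /andP[r0 r1] /andP[r'0 r'1]] := And3 d01' hr hr'.
have e0 : 0 < eps by rewrite subr_gt0.
have e1 : 0 < eps < 1 by rewrite e0 /eps; lra.
have al0 : 0 <= 2 * eps / delta by apply: divr_ge0; [apply: mulr_ge0; lra|exact: ltW].
set al := 2 * eps / delta in al0 *.
have i5 : 0 < (eps ^+ 5)^-1 by rewrite invr_gt0 exprn_gt0.
have i4 : 0 < (eps ^+ 4)^-1 by rewrite invr_gt0 exprn_gt0.
have cl := c_large; rewrite -/al in cl; have c9' := c9.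
have i5' : 1 <= (eps ^+ 5)^-1 by rewrite invf_ge1 ?exprn_gt0// exprn_ile1// ltW//; case/andP: e1.
have i4' : 1 <= (eps ^+ 4)^-1 by rewrite invf_ge1 ?exprn_gt0// exprn_ile1// ltW//; case/andP: e1.
have ai5 : 0 <= al * (eps ^+ 5)^-1 by rewrite mulr_ge0// ltW.
have ac : al + 1 <= c by lra.
have R1 (z : R) : 0 < z <= 1 -> 1 <= z `^ (- delta).
  move=> /andP[z0 z1]; rewrite powRN invf_ge1 ?powR_gt0//.
  by apply: powR_le1; [rewrite z0|exact: ltW].
have v01 (z : R) : 0 < z <= 1 -> 0 <= z `^ (2 * (1 - delta)) <= 1.
  move=> /andP[z0 z1]; rewrite powR_ge0/=.
  by apply: powR_le1; [rewrite z0|rewrite mulr_ge0// ltW].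
have [k kE] : exists k, k = scale_factor delta c r (bt B) by eexists.
have [k' k'E] : exists k, k = scale_factor delta c r' (bt B') by eexists.
have [S SE] : exists S, S = shift_term delta r (bt B) by eexists.
have [S' S'E] : exists S, S = shift_term delta r' (bt B') by eexists.
have e8 := eccentricity_bound d01'.
have sb : (c - al) * `|S - S'| <= 9 / 2 * al * `|k - k'| + 9 * (Num.min k k' * `|bt B - bt B'|).
  rewrite SE S'E; apply: (shift_bound al0 e8 ac c9' (R1 _ hr) (R1 _ hr') (v01 _ hr) (v01 _ hr')
    (br_t B) (br_t B') (powR_comparison d01' hr hr') kE k'E).
have kpos (z : R) (B0 : branch (1 - delta)) : 0 < z <= 1 -> 0 < scale_factor delta c z (bt B0).
  move=> hz; have := R1 _ hz; have := v01 _ hz; have := br_t B0; rewrite /scale_factor.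
  exact: scale_factor_pos.
have k0 : 0 < k by rewrite kE kpos.
have k'0 : 0 < k' by rewrite k'E kpos.
(* Dropping the scalar terms S and S' turns domination within tau into domination of pure multiples
   within T; [absorb_shift] then returns |S - S'| <= tau. *)
pose T := tau + `|S - S'|.
have T0 : 0 <= T by rewrite addr_ge0.
have dom' : dominates T k B k' B'.
  exists s => i; have := dom i; rewrite /conformal_eig -kE -k'E -SE -S'E /T.
  exact: shift_sub_le.
have [b1 b2] := dominates_bound e1 k0 k'0 T0 dom'.
have b1' : `|k - k'| <= 285 / eps ^+ 5 * T.
  by rewrite mulrAC ler_pdivlMr ?exprn_gt0// mulrC.
have b2' : Num.min k k' * `|bt B - bt B'| <= 200 / eps ^+ 4 * T.
  by rewrite mulrAC ler_pdivlMr ?exprn_gt0// mulrC.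
have ST : `|S - S'| <= tau by apply: absorb_shift al0 _ cl T0 sb b1' b2'; lra.
have TT : T <= 2 * tau by rewrite mulr_natl mulr2n lerD2l.
have sumE (z : R) (B0 : branch (1 - delta)) : \sum_i conformal_eig z B0 i =
    - ((2 - eps) * (7 + eps) * (scale_factor delta c z (bt B0) * bt B0)) - 5 * shift_term delta z (bt B0).
  rewrite /conformal_eig big_split/= -mulr_sumr branch_eig_sum sumrN sumr_const card_ord -mulr_natl.
  by rewrite /eps; ring.
rewrite !sumE -kE -k'E -SE -S'E.
have kt : `|k * bt B - k' * bt B'| <= `|k - k'| + Num.min k k' * `|bt B - bt B'|.
  have nt (B0 : branch (1 - delta)) : `|bt B0| <= 1 by rewrite ler_norml br_t.
  have [kk|kk] := leP k k'.
    rewrite (_ : _ - _ = (k - k') * bt B' + k * (bt B - bt B')); last by ring.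
    apply: le_trans (ler_normD _ _) _; rewrite !normrM (gtr0_norm k0) lerD2r.
    by rewrite -[leRHS]mulr1; apply: ler_wpM2l.
  rewrite (_ : _ - _ = (k - k') * bt B + k' * (bt B - bt B')); last by ring.
  apply: le_trans (ler_normD _ _) _; rewrite !normrM (gtr0_norm k'0) lerD2r.
  by rewrite -[leRHS]mulr1; apply: ler_wpM2l.
rewrite (_ : _ - _ = - ((2 - eps) * (7 + eps) * (k * bt B - k' * bt B')) - 5 * (S - S')); last by ring.
have a0 : 0 <= 285 / eps ^+ 5 by exact: mulr_ge0 (ler0n _ _) (ltW i5).
have b0 : 0 <= 200 / eps ^+ 4 by exact: mulr_ge0 (ler0n _ _) (ltW i4).
exact: trace_difference_bound e1 a0 b0 kt b1' b2' TT ST.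
Qed.

Lemma trace_const_ge0 : 0 <= trace_const.
Proof.
have := d01 => /andP[d0 d1]; have e0 : 0 < eps by rewrite subr_gt0.
have i5 : 0 < (eps ^+ 5)^-1 by rewrite invr_gt0 exprn_gt0.
have i4 : 0 < (eps ^+ 4)^-1 by rewrite invr_gt0 exprn_gt0.
by rewrite /trace_const; lra.
Qed.

(** With tau the sum of the positive parts of p - q, the vector q dominates p within tau, and the
    gauge of p - q is the difference of traces plus [trace_const] times tau. *)
Lemma eigenvalue_set_gauge p q : eigenvalue_set p -> eigenvalue_set q ->
  0 <= gauge trace_const (p - q).
Proof.
move=> [r [B [s [hr ->]]]] [r' [B' [s' [hr' ->]]]].
set p0 := \row_i _; set q0 := \row_i _.
pose tau := \sum_i Num.max ((p0 - q0) 0 i) 0.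
have m0 i : 0 <= Num.max ((p0 - q0) 0 i) 0 by rewrite le_max lexx orbT.
have tau0 : 0 <= tau by exact: sumr_ge0.
have dom i : conformal_eig r B ((s'^-1 * s)%g i) - tau <= conformal_eig r' B' i.
  rewrite lerBlDr -lerBlDl; apply: le_trans (_ : Num.max ((p0 - q0) 0 (s'^-1 i)%g) 0 <= _).
    by rewrite !mxE permKV permM le_max lexx.
  by rewrite /tau (bigD1 (s'^-1 i)%g)//= lerDl sumr_ge0.
have sumE (z : R) (B0 : branch (1 - delta)) (s0 : 'S_5) :
    \sum_i conformal_eig z B0 (s0 i) = \sum_i conformal_eig z B0 i.
  by rewrite [RHS](reindex_inj (@perm_inj _ s0)).
have gE : gauge trace_const (p0 - q0) =
    \sum_i conformal_eig r B i - \sum_i conformal_eig r' B' i + trace_const * tau.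
  rewrite /gauge big_split/= -mulr_sumr; congr (_ + _).
  by rewrite -(sumE r B s) -(sumE r' B' s') -sumrB; apply: eq_bigr => i _; rewrite !mxE.
have := conformal_eig_dominates hr' hr tau0 dom.
by rewrite gE distrC ler_norml => /andP[h _]; lra.
Qed.

Lemma eigenvalue_set_perm (s : 'S_5) p : eigenvalue_set p -> eigenvalue_set (col_perm s p).
Proof.
move=> [r [B [s' [hr ->]]]]; exists r, B, (s * s')%g; split => //.
by apply/rowP => i; rewrite !mxE permM.
Qed.

End EigenvalueSet.

(** * Monotonicity of eigenvalues *)

Lemma char_poly_conj (F : fieldType) m (U D : 'M[F]_m) : U \in unitmx ->
  char_poly (invmx U *m D *m U) = char_poly D.
Proof.
move=> uU; rewrite /char_poly.
have -> : char_poly_mx (invmx U *m D *m U) =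
    map_mx polyC (invmx U) *m char_poly_mx D *m map_mx polyC U.
  rewrite /char_poly_mx mulmxBr mulmxBl !map_mxM; congr (_ - _).
  by rewrite mul_mx_scalar -scalemxAl -map_mxM mulVmx// map_mx1 scalemx1.
rewrite !det_mulmx mulrAC -det_mulmx -map_mxM mulVmx// map_mx1 det1 mul1r.
by [].
Qed.

(** The multiplicity of a root counts its occurrences, so both rows have the same multiset of
    entries. *)
Lemma prod_XsubC_inj (F : fieldType) m (l l' : 'rV[F]_m) :
  \prod_i ('X - (l 0 i)%:P) = \prod_i ('X - (l' 0 i)%:P) ->
  exists s : 'S_m, l = col_perm s l'.
Proof.
have mupE (q : seq F) x : mup x (\prod_(a <- q) ('X - a%:P)) = count_mem x q.
  elim: q => [|a q IH]; first by rewrite big_nil mupNroot// root1.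
  have n0 : \prod_(a <- q) ('X - a%:P) != 0 :> {poly F}.
    by apply: monic_neq0; apply: monic_prod_XsubC.
  rewrite big_cons mupM// ?polyXsubC_eq0// IH -['X - _]expr1 mup_XsubCX /=.
  by case: eqP.
have big_codom (v : 'rV[F]_m) : \prod_i ('X - (v 0 i)%:P) =
    \prod_(a <- [tuple v 0 i | i < m]) ('X - a%:P).
  by rewrite big_map big_enum.
rewrite !big_codom => e.
have /tuple_permP[s es] : perm_eq [tuple l 0 i | i < m] [tuple l' 0 i | i < m].
  by apply/allP => x _ /=; rewrite -!mupE e.
exists s; apply/rowP => i; rewrite mxE.
have -> : l 0 i = nth 0 [tuple l 0 i | i < m] i by rewrite -tnth_nth tnth_mktuple.
by rewrite es -tnth_nth !tnth_mktuple.
Qed.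

Section Spectral.
Local Open Scope sesquilinear_scope.
Context {R : realType} {n : nat}.
Implicit Types (A N : 'M[R]_n) (l : 'rV[R]_n).
Local Notation C := R[i].
Local Notation toC := (map_mx (real_complex R)).

(** A unitary diagonalisation over [R[i]] whose diagonal is real. *)
Definition spectral_form A l : Prop :=
  exists2 U : 'M[C]_n, U \is unitarymx &
    toC A = U^t* *m diag_mx (toC l) *m U.

Lemma spectral_form_exists A : Defs.symmetric A -> exists l, spectral_form A l.
Proof.
move=> symA.
have rA : toC A \is a realmx.
  by apply/mxOverP => i j; rewrite mxE; apply/complex_realP; eexists.
have hA : toC A \is hermsymmx.
  apply: realsym_hermsym => //; apply/is_hermitianmxP.
  by rewrite expr0 scale1r map_mx_id// map_trmx symA.
have /mxOverP rd := hermitian_spectral_diag_real hA.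
exists (map_mx (@complex.Re R) (spectral_diag (toC A))), (spectralmx (toC A)).
  exact: spectral_unitarymx.
have /orthomx_spectralP {1}-> := hermitian_normalmx hA.
have -> : toC (map_mx (@complex.Re R) (spectral_diag (toC A))) = spectral_diag (toC A).
  by apply/rowP => i; rewrite !mxE RRe_real.
by rewrite (invmx_unitary (spectral_unitarymx _)).
Qed.

Lemma spectral_form_char_poly A l : spectral_form A l ->
  char_poly A = \prod_i ('X - (l 0 i)%:P).
Proof.
move=> [U uU AE]; apply: (map_poly_inj (real_complex R)).
rewrite map_char_poly map_prod_XsubC AE -invmx_unitary//.
rewrite (char_poly_conj _ (unitarymx_unit uU)) char_poly_trig ?diag_mx_is_trig//.
by apply: eq_bigr => i _; rewrite !mxE eqxx mulr1n.
Qed.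

Lemma spectral_form_perm A l (s : 'S_n) : spectral_form A l ->
  spectral_form A (col_perm s l).
Proof.
move=> [U uU AE]; exists (row_perm s U).
  apply/unitarymxP; apply/matrixP => i j.
  have /unitarymxP/matrixP/(_ (s i) (s j)) := uU.
  rewrite !mxE (inj_eq (@perm_inj _ s)) => <-.
  by apply: eq_bigr => k _; rewrite !mxE.
rewrite AE; apply/matrixP => i j; rewrite !mul_mx_diag !mxE.
rewrite (reindex_inj (@perm_inj _ s)); apply: eq_bigr => k _.
by rewrite !mxE.
Qed.

Lemma spectral_form_eigenvalues A : Defs.symmetric A -> spectral_form A (eigenvalues A).
Proof.
move=> /spectral_form_exists[l Al].
have cl := spectral_form_char_poly Al.
have ce : char_poly A = \prod_i ('X - (eigenvalues A 0 i)%:P) 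
  (* The diagonal [l] is a witness of the factorisation, which excludes the default value of
     [xget]. *)
  by rewrite /eigenvalues; case: xgetP => [y _ //|/(_ l)/(_ cl)].
have [s ->] := prod_XsubC_inj (etrans (esym ce) cl).
exact: spectral_form_perm.
Qed.

Lemma spectral_form_trace A l : spectral_form A l -> \tr A = \sum_i l 0 i.
Proof.
move=> [U uU AE]; apply: complexI.
transitivity (\tr (toC A)); first by rewrite trace_map_mx.
rewrite AE mxtrace_mulC mulmxA (unitarymxP uU) mul1mx mxtrace_diag rmorph_sum/=.
by apply: eq_bigr => i _; rewrite mxE.
Qed.

Definition herm_form (M : 'M[C]_n) (v : 'rV[C]_n) : R := complex.Re ((v *m M *m v^t*) 0 0).

Definition sqmod (z : C) : R := complex.Re z ^+ 2 + complex.Im z ^+ 2.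

Lemma herm_formE A l U x : U \is unitarymx -> toC A = U^t* *m diag_mx (toC l) *m U ->
  herm_form (toC A) (x *m U) = \sum_i l 0 i * sqmod (x 0 i).
Proof.
move=> uU AE; rewrite /herm_form AE trmx_mul map_mxM/=.
have -> : x *m U *m (U ^t* *m diag_mx (toC l) *m U) *m (U ^t* *m x ^t*) =
          x *m diag_mx (toC l) *m x ^t*.
  by rewrite !mulmxA !mulmxtVK.
rewrite mxE raddf_sum; apply: eq_bigr => i _.
rewrite mul_mx_diag !mxE mulrAC -mulrC -normCK -add_Re2_Im2 -rmorphM/=.
by [].
Qed.

Lemma herm_formD M M' v : herm_form (M + M') v = herm_form M v + herm_form M' v.
Proof. by rewrite /herm_form mulmxDr mulmxDl [in LHS]mxE raddfD. Qed.

(** For v = a + i b the real part of the complex form is the sum of the real forms at a and at b. *)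
Lemma herm_form_ge0 N v : nonneg_definite N -> 0 <= herm_form (toC N) v.
Proof.
move=> N0.
pose a : 'rV[R]_n := map_mx (@complex.Re R) v; pose b : 'rV[R]_n := map_mx (@complex.Im R) v.
have -> : herm_form (toC N) v = (a *m N *m a^T) 0 0 + (b *m N *m b^T) 0 0.
  rewrite /herm_form !mxE raddf_sum -big_split/=; apply: eq_bigr => j _.
  rewrite !mxE !mulr_suml raddf_sum -big_split/=; apply: eq_bigr => i _.
  rewrite !mxE; case: (v 0 i) => a1 b1; case: (v 0 j) => a2 b2 /=.
  ring.
by rewrite addr_ge0.
Qed.

Lemma herm_form_sqnorm (U : 'M[C]_n) (x : 'rV[C]_n) : U \is unitarymx ->
  herm_form 1%:M (x *m U) = \sum_i sqmod (x 0 i).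
Proof.
move=> uU; rewrite /herm_form mulmx1 trmx_mul map_mxM/= mulmxA mulmxtVK//.
rewrite mxE raddf_sum; apply: eq_bigr => i _.
by rewrite !mxE -normCK -add_Re2_Im2.
Qed.

Lemma sqmod_ge0 z : 0 <= sqmod z.
Proof. by rewrite addr_ge0 ?sqr_ge0. Qed.

Lemma herm_form_gt0 (v : 'rV[C]_n) : v != 0 -> 0 < herm_form 1%:M v.
Proof.
move=> v0; rewrite -[v]mulmx1 herm_form_sqnorm; last first.
  by apply/unitarymxP; rewrite trmx1 map_mx1 mulmx1.
rewrite lt_neqAle sumr_ge0 ?andbT; last by move=> *; exact: sqmod_ge0.
apply: contraNneq v0 => /esym/eqP; rewrite psumr_eq0; last by move=> *; exact: sqmod_ge0.
move=> /allP h; apply/eqP/rowP => i; rewrite mxE.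
have := h i (mem_index_enum i); rewrite /= /sqmod paddr_eq0 ?sqr_ge0// !sqrf_eq0.
by case: (v 0 i) => a b /= /andP[/eqP -> /eqP ->].
Qed.

(* Courant-Fischer by dimension count: the span of the eigenvectors of [A] for the
   eigenvalues of index [>= k] meets that of [A + N] for the indices [<= k]. *)
Lemma sorted_eigenvalues_le A N l l' : nonneg_definite N ->
  spectral_form A l -> spectral_form (A + N) l' ->
  (forall i j : 'I_n, (i <= j)%N -> l 0 i <= l 0 j) ->
  (forall i j : 'I_n, (i <= j)%N -> l' 0 i <= l' 0 j) ->
  forall k, l 0 k <= l' 0 k.
Proof.
move=> N0 [U uU AE] [U' uU' AE'] ls ls' k.
pose V : 'M[C]_n := copid_mx k *m U; pose W : 'M[C]_n := pid_mx k.+1 *m U'.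
have rV : \rank V = (n - k)%N.
  have fU : row_free U by rewrite row_free_unit (unitarymx_unit uU).
  by rewrite /V (mxrankMfree _ fU) rank_copid_mx// ltnW.
have rW : \rank W = k.+1.
  have fU' : row_free U' by rewrite row_free_unit (unitarymx_unit uU').
  by rewrite /W (mxrankMfree _ fU') rank_pid_mx.
have : (V :&: W)%MS != 0.
  rewrite -mxrank_eq0 -lt0n; have := mxrank_sum_cap V W.
  have := rank_leq_col (V + W)%MS; rewrite rV rW; have := ltn_ord k; lia.
case/rowV0Pn => v; rewrite sub_capmx => /andP[/submxP[x vx] /submxP[y vy]] v0.
have vxU : v = (x *m copid_mx k) *m U by rewrite -mulmxA.
have vyU : v = (y *m pid_mx k.+1) *m U' by rewrite -mulmxA.
have sq := herm_form_gt0 v0.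
have hA : l 0 k * herm_form 1%:M v <= herm_form (toC A) v.
  rewrite {1}vxU herm_form_sqnorm// vxU (herm_formE _ uU AE) mulr_sumr.
  apply: ler_sum => i _; have [ki|ik] := leqP k i.
    by apply: ler_wpM2r; [exact: sqmod_ge0|exact: ls].
  suff -> : (x *m copid_mx k) 0 i = 0 by rewrite /sqmod/= expr0n/= addr0 !mulr0.
  rewrite mxE big1// => j _; rewrite !mxE.
  have -> : (nat_of_ord j == nat_of_ord i) = (j == i) by [].
  by have [->|ji] := eqVneq j i; rewrite ?ik subrr mulr0.
have hB : herm_form (toC (A + N)) v <= l' 0 k * herm_form 1%:M v.
  rewrite vyU herm_form_sqnorm// (herm_formE _ uU' AE') mulr_sumr.
  apply: ler_sum => i _; have [ik|ki] := leqP i k.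
    by apply: ler_wpM2r; [exact: sqmod_ge0|exact: ls'].
  suff -> : (y *m pid_mx k.+1) 0 i = 0 by rewrite /sqmod/= expr0n/= addr0 !mulr0.
  rewrite mxE big1// => j _; rewrite !mxE ltnS.
  have -> : (nat_of_ord j == nat_of_ord i) = (j == i) by [].
  have [->|ji] := eqVneq j i; last by rewrite /= mulr0.
  by rewrite leqNgt ki /= mulr0.
have hAB : herm_form (toC A) v <= herm_form (toC (A + N)) v.
  rewrite map_mxD/= herm_formD lerDl.
  exact: herm_form_ge0.
by rewrite -(ler_pM2r sq); apply: le_trans hA (le_trans hAB hB).
Qed.

Lemma sorting_perm l : exists s : 'S_n, forall i j : 'I_n, (i <= j)%N ->
  (col_perm s l) 0 i <= (col_perm s l) 0 j.
Proof.
pose t := [tuple l 0 i | i < n]; pose st := sort <=%R t.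
have /tuple_permP[s es] : perm_eq st t by rewrite perm_sort.
exists s => i j ij; rewrite !mxE.
have nE k : l 0 (s k) = nth 0 st k by rewrite es -tnth_nth !tnth_mktuple.
rewrite !nE; apply: (sorted_leq_nth le_trans le_refl) => //; rewrite ?inE ?size_sort ?size_tuple//.
exact: (sort_sorted le_total).
Qed.

Lemma eigenvalues_mono A N : Defs.symmetric A -> Defs.symmetric N -> nonneg_definite N ->
  exists s : 'S_n, forall i, eigenvalues A 0 (s i) <= eigenvalues (A + N) 0 i.
Proof.
move=> sA sN N0.
have sAN : Defs.symmetric (A + N) by rewrite /Defs.symmetric linearD/= sA sN.
have [s hs] := sorting_perm (eigenvalues A).
have [s' hs'] := sorting_perm (eigenvalues (A + N)).
have := sorted_eigenvalues_le N0 (spectral_form_perm s (spectral_form_eigenvalues sA))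
  (spectral_form_perm s' (spectral_form_eigenvalues sAN)) hs hs' => h.
exists (s'^-1 * s)%g => i.
by have := h ((s'^-1)%g i); rewrite !mxE permKV permM.
Qed.

Lemma sum_eigenvalues A : Defs.symmetric A -> \sum_i eigenvalues A 0 i = \tr A.
Proof. by move=> sA; rewrite (spectral_form_trace (spectral_form_eigenvalues sA)). Qed.

End Spectral.

(** * From monotonicity in the eigenvalues to uniform ellipticity *)

Section Elliptic.
Context {R : realType} {n : nat}.
Implicit Types (A N : 'M[R]_n) (x : 'rV[R]_n).

Lemma delta_form N (i j : 'I_n) :
  ((delta_mx 0 i : 'rV[R]_n) *m N *m (delta_mx 0 j : 'rV[R]_n)^T) 0 0 = N i j.
Proof. by rewrite -rowE trmx_delta -colE !mxE. Qed.

Lemma nonneg_definite_diag N i : nonneg_definite N -> 0 <= N i i.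
Proof. by move=> /(_ (delta_mx 0 i)); rewrite delta_form. Qed.

Lemma diag_le_trace N i : nonneg_definite N -> N i i <= \tr N.
Proof.
move=> N0; rewrite /mxtrace (bigD1 i)//= lerDl sumr_ge0// => j _.
exact: nonneg_definite_diag.
Qed.

(** The form at e_i + e_j and at e_i - e_j gives 2 |N_ij| <= N_ii + N_jj. *)
Lemma entry_le_trace N i j : Defs.symmetric N -> nonneg_definite N -> `|N i j| <= \tr N.
Proof.
move=> sN N0; have ij : N j i = N i j by rewrite -[in LHS]sN mxE.
have addE (X Y : 'M[R]_1) : (X + Y) 0 0 = X 0 0 + Y 0 0 by rewrite mxE.
have scaleE a (X : 'M[R]_1) : (a *: X) 0 0 = a * X 0 0 by rewrite mxE.
have N2 a : 0 <= N i i + 2 * a * N i j + a ^+ 2 * N j j.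
  have := N0 (delta_mx 0 i + a *: delta_mx 0 j).
  rewrite linearD linearZ/= !mulmxDl !mulmxDr -!scalemxAl -!scalemxAr.
  by rewrite !(addE, scaleE) !delta_form ij; lra.
have := N2 1; have := N2 (-1); have := diag_le_trace i N0; have := diag_le_trace j N0.
by move=> *; rewrite ler_norml; apply/andP; split; lra.
Qed.

Lemma enorm_le_sum x : enorm x <= \sum_i `|x 0 i|.
Proof.
have s0 : 0 <= \sum_i `|x 0 i| by exact: sumr_ge0.
rewrite -(ler_sqr (sqrtr_ge0 _) s0)// sqr_sqrtr; last by apply: sumr_ge0 => i _; exact: sqr_ge0.
rewrite expr2 mulr_suml; apply: ler_sum => i _.
rewrite -real_normK ?num_real// expr2; apply: ler_wpM2l => //.
by rewrite (bigD1 i)//= lerDl sumr_ge0.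
Qed.

Lemma abs_le_enorm x i : `|x 0 i| <= enorm x.
Proof.
rewrite -(ler_sqr (normr_ge0 _) (sqrtr_ge0 _)) sqr_sqrtr; last by apply: sumr_ge0 => j _; exact: sqr_ge0.
rewrite real_normK ?num_real// (bigD1 i)//= lerDl; apply: sumr_ge0 => j _; exact: sqr_ge0.
Qed.

Lemma enorm_mul_le N x : Defs.symmetric N -> nonneg_definite N -> enorm x <= 1 ->
  enorm (x *m N) <= n%:R ^+ 2 * \tr N.
Proof.
move=> sN N0 x1; apply: le_trans (enorm_le_sum _) _.
apply: le_trans (_ : \sum_(i < n) n%:R * \tr N <= _); last first.
  by rewrite sumr_const card_ord -[leLHS]mulr_natl mulrA -expr2.
apply: ler_sum => j _; rewrite mxE; apply: le_trans (ler_norm_sum _ _ _) _.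
apply: le_trans (_ : \sum_(i < n) \tr N <= _); last first.
  by rewrite sumr_const card_ord -[leLHS]mulr_natl.
apply: ler_sum => i _; rewrite normrM -[leRHS]mul1r; apply: ler_pM => //.
  exact: le_trans (abs_le_enorm x i) x1.
exact: entry_le_trace.
Qed.

Lemma opnorm_le_trace N : Defs.symmetric N -> nonneg_definite N ->
  opnorm N <= n%:R ^+ 2 * \tr N.
Proof.
move=> sN N0; apply: ge_sup.
  exists (enorm ((0 : 'rV[R]_n) *m N)), 0 => //=.
  by rewrite /enorm big1 ?sqrtr0// => i _; rewrite mxE expr0n.
by move=> _ [x x1 <-]; exact: enorm_mul_le.
Qed.

Lemma trace_le_opnorm N : Defs.symmetric N -> nonneg_definite N ->
  \tr N <= n%:R * opnorm N.
Proof.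
move=> sN N0; rewrite mulr_natl -[n in _ *+ n]card_ord -sumr_const.
apply: ler_sum => i _; apply: le_trans (ler_norm _) _.
have -> : N i i = ((delta_mx 0 i : 'rV[R]_n) *m N) 0 i by rewrite -rowE mxE.
apply: le_trans (abs_le_enorm _ i) _; apply: ub_le_sup.
  by exists (n%:R ^+ 2 * \tr N) => _ [x x1 <-]; exact: enorm_mul_le.
exists (delta_mx 0 i) => //=.
rewrite /enorm (bigD1 i)//= mxE !eqxx expr1n big1 ?addr0 ?sqrtr1// => j ji.
by rewrite mxE eqxx (negbTE ji) expr0n.
Qed.

Lemma opnorm_ge0 N : 0 <= opnorm N.
Proof.
rewrite /opnorm; have [h|h] := pselect (has_sup [set enorm (x *m N) | x in [set x | enorm x <= 1]]).
  have [[y [x x1 xy]] hu] := h; apply: le_trans (sqrtr_ge0 _) (ub_le_sup hu _).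
  by exists x.
by rewrite sup_out.
Qed.

(** After matching, the eigenvalues increase by nonnegative amounts whose sum is the trace of N, and
    on nonnegative N the trace and the operator norm are equivalent. *)
Lemma uniformly_elliptic_of_mono (K : R) (f : 'rV[R]_n -> R) : 0 <= K ->
  permutation_invariant f ->
  (forall l d : 'rV[R]_n, (forall i, 0 <= d 0 i) ->
     \sum_i d 0 i <= f (l + d) - f l <= (1 + K) * \sum_i d 0 i) ->
  uniformly_elliptic f.
Proof.
move=> K0 fs fmono; have K10 : 0 <= 1 + K by rewrite addr_ge0.
(* The summand 1 ensures 1 <= C even for n = 0. *)
pose C : R := (1 + K) * n%:R ^+ 2 + 1.
have nn0 : 0 <= n%:R ^+ 2 :> R by exact: sqr_ge0.
have C1 : 1 <= C by rewrite /C lerDr; exact: mulr_ge0.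
exists C => // A N sA sN N0.
have sAN : Defs.symmetric (A + N) by rewrite /Defs.symmetric linearD/= sA sN.
have [s hs] := eigenvalues_mono sA sN N0.
pose d := eigenvalues (A + N) - col_perm s (eigenvalues A).
have d0 i : 0 <= d 0 i by rewrite !mxE subr_ge0.
have := fmono (col_perm s (eigenvalues A)) d d0.
rewrite [col_perm _ _ + d]addrC subrK fs.
have -> : \sum_i d 0 i = \tr N.
  transitivity (\sum_i eigenvalues (A + N) 0 i - \sum_i eigenvalues A 0 (s i)).
    by rewrite -sumrB; apply: eq_bigr => i _; rewrite !mxE.
  have <- : \sum_i eigenvalues A 0 i = \sum_i eigenvalues A 0 (s i).
    by rewrite (reindex_inj (@perm_inj _ s)).
  by rewrite !sum_eigenvalues// linearD/= addrC addKr.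
have tr0 : 0 <= \tr N by apply: sumr_ge0 => i _; exact: nonneg_definite_diag.
have h1 := opnorm_le_trace sN N0; have h2 := trace_le_opnorm sN N0.
have o0 := opnorm_ge0 N.
move=> /andP[m1 m2]; apply/andP; split.
  apply: le_trans m1; rewrite mulrC ler_pdivrMr; last exact: lt_le_trans C1.
  apply: le_trans h1 _; rewrite mulrC; apply: ler_wpM2l => //.
  have h3 : 0 <= K * n%:R ^+ 2 by exact: mulr_ge0.
  by rewrite /C; clear -h3; lra.
apply: le_trans m2 _.
have nn : n%:R <= n%:R ^+ 2 :> R by rewrite -natrX ler_nat; case: (n) => // m; rewrite expnS expn1 leq_pmull.
apply: le_trans (_ : (1 + K) * (n%:R * opnorm N) <= _); first exact: ler_wpM2l.
rewrite mulrA; apply: ler_wpM2r => //.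
apply: le_trans (_ : (1 + K) * n%:R ^+ 2 <= _); first exact: ler_wpM2l.
by rewrite /C lerDl.
Qed.

End Elliptic.

(** * Second-order comparison at a local maximum *)

Section Line.
Context {R : realType} {n : nat}.
Implicit Types (F G : 'rV[R]_n -> R) (x v : 'rV[R]_n).

Lemma is_derive_lineP F x v (h d : R) :
  is_derive (x + h *: v) v F d <-> is_derive h (1 : R) (fun s : R => F (x + s *: v)) d.
Proof.
pose q1 := fun s : R => s^-1 *: ((F \o shift (x + h *: v)) (s *: v) - F (x + h *: v)).
pose q2 := fun s : R => s^-1 *: (((fun s : R => F (x + s *: v)) \o shift h) (s *: (1 : R)) - F (x + h *: v)).
have e : q1 = q2.
  apply/funext => s; rewrite /q1 /q2 /=; congr (_ *: (F _ - _)).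
  by rewrite [s *: 1]mulr1 scalerDl addrCA.
split=> -[]; rewrite /derivable /derive -/q1 -/q2 => c1 c2;
  by split; rewrite /derivable /derive -/q1 -/q2 -?e ?e // -?e.
Qed.

Lemma delta_norm (i : 'I_n) : `|delta_mx 0 i : 'rV[R]_n| <= 1.
Proof.
rewrite [leLHS]/Num.norm/= mx_normrE; apply: bigmax_le => // -[a b] _ /=.
by rewrite mxE normr_nat; case: (_ && _); rewrite /= ?lexx ?ler01.
Qed.

(** Parametrising the segment by s in [0, 1] covers steps w of either sign, and w = 0. *)
Lemma coord_mean_value F x (i : 'I_n) (w : R) :
  (forall s : R, 0 <= s <= 1 -> derivable F (x + (s * w) *: delta_mx 0 i) (delta_mx 0 i)) ->
  exists2 s : R, 0 <= s <= 1 &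
    F (x + w *: delta_mx 0 i) - F x = w * partial i F (x + (s * w) *: delta_mx 0 i).
Proof.
move=> dF; pose e : 'rV[R]_n := delta_mx 0 i.
pose g (s : R) := F (x + (s * w) *: e).
pose dg (s : R) := w * partial i F (x + (s * w) *: e).
have Dg (s : R) : 0 <= s <= 1 -> is_derive s (1 : R) g (dg s).
  move=> s01; have /derivableP/is_derive_lineP h := dF _ s01.
  have -> : g = (fun y : R => F (x + y *: e)) \o (fun s : R => s * w) by [].
  have hs : is_derive s (1 : R) (fun s : R => s * w) w.
    have -> : (fun s : R => s * w) = w *: (id : R -> R).
      by apply/funext => y; rewrite mulrC.
    by apply: is_derive_eq; rewrite [LHS]mulr1.
  by have := @is_derive1_comp _ _ (fun s : R => s * w) s _ _ h hs; rewrite mulrC.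
have [|||s s01 es] := @MVT_segment R g dg 0 1.
- exact: ler01.
- by move=> s; rewrite in_itv/= => /andP[s0 s1]; apply: Dg; rewrite !ltW.
- apply: derivable_within_continuous => s; rewrite in_itv/= => s01.
  by have [] := Dg _ s01.
exists s; first by move: s01; rewrite in_itv.
by move: es; rewrite /g /dg mul1r mul0r scale0r addr0 subr0 mulr1.
Qed.

(* Telescoping along the coordinate path from [x] to [x + h v]. *)
Lemma C1_directional F x v :
  (\forall y \near x, C1_at F y) -> is_derive x v F (\sum_i v 0 i * partial i F x).
Proof.
move=> C1F; pose d := \sum_i v 0 i * partial i F x.
suff h : (fun h : R => h^-1 *: ((F \o shift x) (h *: v) - F x)) @ 0^' --> d.
  by split; [apply/cvg_ex; exists d|exact/cvg_lim].
apply/cvgrPdist_le => eps eps0.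
(* [K] bounds every coordinate of the path divided by h; the summand 1 keeps it positive when v =
   0. *)
pose K := \sum_i `|v 0 i| + 1.
have K1 : 0 < K by rewrite /K ltr_pwDr// sumr_ge0.
have : \forall y \near x, C1_at F y /\ forall i, `|partial i F x - partial i F y| <= eps / K.
  have cont i : \forall y \near x, `|partial i F x - partial i F y| <= eps / K.
    have [_ c] := nbhs_singleton C1F i.
    by move/cvgrPdist_le : c; apply; rewrite divr_gt0.
  by apply: filterS2 C1F (filter_forall _ cont) => y; split.
move=> /nbhs_ballP[r /= r0 hr].
near=> h.
have h0 : h != 0 by near: h; exact: nbhs_dnbhs_neq.
have hrK : `|h| * K < r.
  by rewrite -ltr_pdivlMr//; near: h; apply: dnbhs0_lt; rewrite divr_gt0.
(* The vertices of the path: v with all coordinates from index k on set to 0. *)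
pose T k : 'rV[R]_n := \row_i (if (i < k)%N then v 0 i else 0).
have T0 : T 0%N = 0 by apply/rowP => i; rewrite !mxE.
have Tn : T n = v by apply/rowP => i; rewrite !mxE ltn_ord.
have TS (k : 'I_n) : T k.+1 = T k + v 0 k *: delta_mx 0 k.
  apply/rowP => i; rewrite !mxE eqxx/= ltnS leq_eqVlt (inj_eq val_inj).
  by have [->|_] := eqVneq i k; rewrite ?ltnn ?mulr1 ?add0r// mulr0 addr0.
have TB (k : 'I_n) (s : R) : 0 <= s <= 1 ->
    ball x r (x + h *: T k + (s * (h * v 0 k)) *: delta_mx 0 k).
  move=> /andP[s0 s1]; rewrite mx_norm_ball /ball_/= opprD addrA opprD addrA subrr sub0r -opprD normrN.
  apply: le_lt_trans hrK.
  have -> : h *: T k + (s * (h * v 0 k)) *: delta_mx 0 k =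
      h *: (T k + (s * v 0 k) *: delta_mx 0 k).
    by rewrite scalerDr scalerA mulrCA.
  rewrite normrZ; apply: ler_wpM2l => //.
  rewrite [leLHS]/Num.norm/= mx_normrE; apply: bigmax_le => [|[a i] _] /=; first exact: ltW.
  apply: le_trans (_ : `|v 0 i| <= _).
    rewrite !mxE (ord1 a) eqxx/=; have [->|ik] := eqVneq i k.
      by rewrite ltnn add0r mulr1 normrM ger0_norm// ler_piMl.
    by rewrite mulr0 addr0; case: ifP => // _; rewrite normr0.
  by rewrite /K (bigD1 i)//= -addrA lerDl addr_ge0// sumr_ge0.
have step (k : 'I_n) : `|v 0 k * partial k F x -
    h^-1 * (F (x + h *: T k.+1) - F (x + h *: T k))| <= `|v 0 k| * (eps / K).
  have [s s01|s s01] := @coord_mean_value F (x + h *: T k) k (h * v 0 k).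
    by have [+ _] := hr _ (TB k s s01); move=> /(_ k)[].
  rewrite -addrA -scalerA -scalerDr -TS => ->.
  have [_ /(_ k)] := hr _ (TB k s s01).
  set D := partial k F x; set D' := partial k F _ => DD.
  have -> : v 0 k * D - h^-1 * (h * v 0 k * D') = v 0 k * (D - D') by field.
  by rewrite normrM; apply: ler_wpM2l.
have -> : h^-1 *: ((F \o shift x) (h *: v) - F x) =
    \sum_(k < n) h^-1 * (F (x + h *: T k.+1) - F (x + h *: T k)).
  rewrite -mulr_sumr -(big_mkord xpredT (fun k => F (x + h *: T k.+1) - F (x + h *: T k))).
  by rewrite telescope_sumr// Tn T0 scaler0 addr0 /= [h *: v + x]addrC.
rewrite /d -sumrB; apply: le_trans (ler_norm_sum _ _ _) _.
apply: le_trans (ler_sum _ (fun k _ => step k)) _.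
rewrite -mulr_suml mulrA ler_pdivrMr// mulrC; apply: ler_wpM2l; first exact: ltW.
by rewrite /K lerDl.
Unshelve. all: by end_near. Qed.

End Line.

(** If d were positive, D would be positive on some interval to the right of 0, and by the mean
    value theorem psi would exceed psi 0 there. *)
Lemma local_max_second_order (R : realType) (psi D : R -> R) (d : R) :
  (\forall h \near (0 : R), is_derive h (1 : R) psi (D h)) -> is_derive (0 : R) (1 : R) D d ->
  (\forall h \near (0 : R), psi h <= psi 0) -> D 0 = 0 /\ d <= 0.
Proof.
move=> Dpsi DD max0.
have : \forall h \near (0 : R), is_derive h (1 : R) psi (D h) /\ psi h <= psi 0.
  exact: filterI Dpsi max0.
move=> /nbhs_ballP[e /= e0 he].
have ballE (h : R) : ball (0 : R) e h <-> `|h| < e.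
  by rewrite /ball/= sub0r normrN.
have D0 : D 0 = 0.
  have h0 : is_derive (0 : R) (1 : R) psi 0.
    apply: (@derive1_at_max _ psi (- e) e) => [|t||t]; rewrite ?in_itv/=.
    - by lra.
    - by rewrite -ltr_norml => /ballE/he[[]].
    - by apply/andP; split; lra.
    - by rewrite -ltr_norml => /ballE/he[].
  have [_ <-] := nbhs_singleton Dpsi.
  by have [] := h0.
split=> //; rewrite leNgt; apply/negP => d0.
have [/cvg_ex[l cl] dl] := DD.
have l_d : l = d by rewrite -dl; apply/esym/cvg_lim.
rewrite l_d in cl.
have /nbhs_ballP[r /= r0 hr] : \forall h \near (0 : R), h != 0 -> 0 < h^-1 *: ((D \o shift 0) (h *: (1 : R)) - D 0).
  exact: cvgr_gt cl _ d0.
have Dpos (h : R) : 0 < h -> h < r -> 0 < D h.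
  move=> h0 hr0; have := hr h; rewrite /ball/= sub0r normrN gtr0_norm// => /(_ hr0).
  rewrite gt_eqF// => /(_ isT).
  rewrite D0 subr0 addr0 [h *: 1]mulr1.
  by rewrite /GRing.scale/= pmulr_rgt0// invr_gt0.
pose h := Num.min e r / 2.
have m0 : 0 < Num.min e r by rewrite lt_min e0.
have h0 : 0 < h by rewrite /h divr_gt0.
have hm : h < Num.min e r by rewrite /h; lra.
have [he' hr'] : h < e /\ h < r by move: hm; rewrite lt_min => /andP[].
have Dh (s : R) : 0 <= s <= h -> is_derive s (1 : R) psi (D s).
  by move=> /andP[s0 sh]; have /ballE/he[] : `|s| < e by rewrite ger0_norm//; lra.
have [|s||c cin ec] := @MVT _ psi D 0 h.
- exact: h0.
- by rewrite in_itv/= => /andP[s0 sh]; apply: Dh; rewrite !ltW.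
- by apply: derivable_within_continuous => s; rewrite in_itv/= => sh; have [] := Dh _ sh.
move: cin ec; rewrite in_itv/= subr0 => /andP[c0 ch] ec.
have : 0 < D c * h by rewrite mulr_gt0// Dpos//; lra.
have [_] : is_derive h (1 : R) psi (D h) /\ psi h <= psi 0 by apply: he; apply/ballE; rewrite gtr0_norm.
lra.
Qed.

Section Hessian.
Context {R : realType} {n : nat}.
Implicit Types (F G : 'rV[R]_n -> R) (x v : 'rV[R]_n).

Lemma line_cvg x v : x + h *: v @[h --> (0 : R)] --> x.
Proof.
have c : (fun h : R => h *: v) h @[h --> (0 : R)] --> 0 *: v by exact: scalel_continuous.
have := cvgD (cvg_cst x) c; rewrite scale0r addr0.
exact.
Qed.

Lemma C2_line F x v : C2_near F x ->
  (\forall h \near (0 : R), is_derive h (1 : R) (fun s : R => F (x + s *: v))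
     (\sum_i v 0 i * partial i F (x + h *: v))) /\
  is_derive (0 : R) (1 : R) (fun h : R => \sum_i v 0 i * partial i F (x + h *: v))
     (\sum_i v 0 i * \sum_j v 0 j * partial j (partial i F) x).
Proof.
move=> C2F; split.
  (* [C1_directional] asks for [C1_at] on a neighbourhood of each point of the line. *)
  have : \forall y \near x, \forall z \near y, C1_at F z.
    by move/nbhs_interior : C2F; apply: filterS => y; apply: filterS => z [].
  move=> /(line_cvg v) nF; near=> h; apply/is_derive_lineP.
  by apply: C1_directional; near: h; exact: nF.
have -> : (fun h : R => \sum_i v 0 i * partial i F (x + h *: v)) =
    \sum_i (v 0 i *: (fun h : R => partial i F (x + h *: v))).
  by apply/funext => h; rewrite fct_sumE.
apply: is_derive_sum => i.
suff : is_derive (0 : R) (1 : R) (fun h : R => partial i F (x + h *: v))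
   (\sum_j v 0 j * partial j (partial i F) x) by move=> ?; exact: is_deriveZ.
apply/is_derive_lineP; rewrite scale0r addr0; apply: C1_directional.
by apply: filterS C2F => y [].
Unshelve. all: by end_near. Qed.

End Hessian.

Lemma eq_leR (R : realType) (a b : R) : a = b -> a <= b.
Proof. by move=> ->. Qed.

Lemma dist_le_halves (R : realType) (a b c c' eps : R) :
  `|a - c| <= eps / 2 -> `|b - c'| <= eps / 2 -> c' = c -> `|a - b| <= eps.
Proof.
move=> ha hb e; rewrite e in hb; have -> : a - b = (a - c) - (b - c) by ring.
by apply: le_trans (ler_normB _ _) _; rewrite [leRHS]splitr; exact: lerD.
Qed.

Lemma second_difference_unique (R : realType) (w p q a a' b c d : R) : 0 < w ->
  a - b - (c - d) = w * (w * p) -> a' - c - (b - d) = w * (w * q) -> a = a' -> p = q.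
Proof.
move=> w0 ep eq aa; have w00 : w != 0 by rewrite gt_eqF.
by apply: (mulfI w00); apply: (mulfI w00); rewrite -ep -eq aa; ring.
Qed.

Section Compare.
Context {R : realType} {n : nat}.
Implicit Types (F G : 'rV[R]_n -> R) (x v : 'rV[R]_n).

Lemma hessian_formE F x v : (v *m hessian F x *m v^T) 0 0 =
  \sum_i v 0 i * \sum_j v 0 j * partial j (partial i F) x.
Proof.
rewrite mxE; apply: eq_bigr => j _; rewrite !mxE mulrC; congr (_ * _).
by apply: eq_bigr => i _; rewrite !mxE.
Qed.

Lemma local_max_line F G x v : C2_near F x -> C2_near G x ->
  (\forall y \near x, F y - G y <= F x - G x) ->
  \sum_i v 0 i * partial i F x = \sum_i v 0 i * partial i G x /\
  \sum_i v 0 i * (\sum_j v 0 j * partial j (partial i F) x) <=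
  \sum_i v 0 i * (\sum_j v 0 j * partial j (partial i G) x).
Proof.
move=> C2F C2G FG.
have [F1 F2] := C2_line v C2F; have [G1 G2] := C2_line v C2G.
pose psi s := F (x + s *: v) - G (x + s *: v).
pose D h := \sum_i v 0 i * partial i F (x + h *: v) - \sum_i v 0 i * partial i G (x + h *: v).
have psi1 : \forall h \near (0 : R), is_derive h (1 : R) psi (D h).
  by near=> h; apply: is_deriveB; near: h.
have psi2 := is_deriveB F2 G2.
have psi3 : \forall h \near (0 : R), psi h <= psi 0.
  rewrite /psi scale0r addr0; near=> h; near: h; exact: (line_cvg v FG).
have [D0 d0] := local_max_second_order psi1 psi2 psi3.
split; first by move: D0; rewrite /D scale0r addr0 => /subr0_eq.
by move: d0; rewrite subr_le0.
Unshelve. all: by end_near. Qed.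

Lemma local_max_compare F G x : C2_near F x -> C2_near G x ->
  (\forall y \near x, F y - G y <= F x - G x) ->
  gradient F x = gradient G x /\
  forall v, (v *m hessian F x *m v^T) 0 0 <= (v *m hessian G x *m v^T) 0 0.
Proof.
move=> C2F C2G FG; have H v := local_max_line v C2F C2G FG.
split=> [|v]; last first.
  have [_ d0] := H v; have eF := hessian_formE F x v; have eG := hessian_formE G x v.
  exact: le_trans (le_trans (eq_leR eF) d0) (eq_leR (esym eG)).
apply/rowP => i; rewrite !mxE; have [+ _] := H (delta_mx 0 i).
have E (a : 'I_n -> R) : \sum_j (delta_mx 0 i : 'rV[R]_n) 0 j * a j = a i.
  rewrite (bigD1 i)//= mxE !eqxx mul1r big1 ?addr0// => j ji.
  by rewrite mxE eqxx (negbTE ji) mul0r.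
by rewrite !E.
Qed.

Lemma is_derive_translate F y a v (d : R) :
  is_derive (y + a) v F d -> is_derive y v (fun z => F (z + a)) d.
Proof.
have e : (fun h : R => h^-1 *: (((fun z => F (z + a)) \o shift y) (h *: v) - F (y + a))) =
         (fun h : R => h^-1 *: ((F \o shift (y + a)) (h *: v) - F (y + a))).
  by apply/funext => h /=; rewrite addrA.
by case=> h1 h2; split; rewrite /derivable /derive e.
Qed.

(** The mean value theorem along e_i for the increment [A] in direction e_j, then along e_j for the
    partial derivative. *)
Lemma cross_difference F x (i j : 'I_n) (r w : R) : 0 < w -> w + w < r ->
  (forall y, ball x r y -> C1_at F y /\ C1_at (partial i F) y) ->
  exists2 y, ball x r y &
    F (x + w *: delta_mx 0 i + w *: delta_mx 0 j) - F (x + w *: delta_mx 0 i)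
    - (F (x + w *: delta_mx 0 j) - F x) = w * (w * partial j (partial i F) y).
Proof.
move=> w0 wr hF; pose e k : 'rV[R]_n := delta_mx 0 k.
have B (s s' : R) : 0 <= s <= 1 -> 0 <= s' <= 1 -> ball x r (x + (s * w) *: e i + (s' * w) *: e j).
  move=> /andP[s0 s1] /andP[s'0 s'1].
  rewrite mx_norm_ball /ball_/= -addrA opprD addrA subrr sub0r normrN.
  apply: le_lt_trans (ler_normD _ _) _; rewrite !normrZ.
  have P (t : R) k : 0 <= t -> t <= 1 -> `|t * w| * `|e k| <= w.
    move=> t0 t1; have w0' := ltW w0; have tw0 : 0 <= t * w by exact: mulr_ge0.
    rewrite (ger0_norm tw0); apply: le_trans (ler_piMr tw0 (delta_norm k)) _.
    exact: ler_piMl.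
  by apply: le_lt_trans wr; apply: lerD; rewrite -normrM; exact: P.
pose A (y : 'rV[R]_n) := F (y + w *: e j) - F y.
have z01 : 0 <= (0 : R) <= 1 by rewrite lexx ler01.
have o01 : 0 <= (1 : R) <= 1 by rewrite lexx ler01.
have DA (s : R) : 0 <= s <= 1 -> is_derive (x + (s * w) *: e i) (e i) A
    (partial i F (x + (s * w) *: e i + w *: e j) - partial i F (x + (s * w) *: e i)).
  move=> s01; apply: is_deriveB; last first.
    have := B _ _ s01 z01; rewrite mul0r scale0r addr0 => /hF[+ _] => /(_ i)[+ _].
    by move=> /derivableP.
  have := B _ _ s01 o01; rewrite mul1r => /hF[+ _] => /(_ i)[+ _] => /derivableP D1.
  exact: is_derive_translate.
have [s s01|s s01 e1] := @coord_mean_value _ _ A x i w; first by have [] := DA s s01.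
have [s' s'01|s' s'01 e2] := @coord_mean_value _ _ (partial i F) (x + (s * w) *: e i) j w.
  by have [_ +] := hF _ (B _ _ s01 s'01) => /(_ j)[].
exists (x + (s * w) *: e i + (s' * w) *: e j); first exact: B.
by rewrite -e2 -[RHS]/(w * _) -(@derive_val _ _ _ _ _ _ _ (DA s s01)) -/(partial i A _) -e1.
Qed.

(** The second difference is symmetric in i and j, so the two mixed derivatives agree at points
    arbitrarily close to x, and continuity concludes. The eigenvalue lemmas need this for the test
    functions. *)
Lemma hessian_sym F x : C2_near F x -> Defs.symmetric (hessian F x).
Proof.
move=> C2F; apply/matrixP => i j; rewrite !mxE.
apply/eqP; rewrite -subr_eq0 -normr_le0; apply/ler_addgt0Pl => eps eps0; rewrite addr0.
have e20 : 0 < eps / 2 by rewrite divr_gt0.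
have C2x := nbhs_singleton C2F.
have near2 k l : \forall y \near x, `|partial k (partial l F) x - partial k (partial l F) y| <= eps / 2.
  have [_ /(_ l)/(_ k)[_ c]] := C2x.
  by move/cvgrPdist_le : c; apply.
have : \forall y \near x, [/\ C1_at F y, C1_at (partial i F) y, C1_at (partial j F) y,
    `|partial i (partial j F) x - partial i (partial j F) y| <= eps / 2 &
    `|partial j (partial i F) x - partial j (partial i F) y| <= eps / 2].
  apply: filterS (filterI C2F (filterI (near2 i j) (near2 j i))) => y [[h1 h2] [h3 h4]].
  by split; [exact: h1|exact: (h2 i)|exact: (h2 j)|exact: h3|exact: h4].
move=> /nbhs_ballP[r /= r0 hr].
pose w := r / 3; have w0 : 0 < w by rewrite /w divr_gt0.
have wr : w + w < r by rewrite /w; lra.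
have [y yr ey] := @cross_difference F x i j r w w0 wr (fun y yr => let: And5 a b _ _ _ := hr y yr in conj a b).
have [z zr ez] := @cross_difference F x j i r w w0 wr (fun y yr => let: And5 a _ b _ _ := hr y yr in conj a b).
have yz : partial j (partial i F) y = partial i (partial j F) z.
  refine (second_difference_unique w0 ey ez _).
  congr F; exact: addrAC.
have [_ _ _ _ hy] := hr y yr; have [_ _ _ hz _] := hr z zr.
exact: (dist_le_halves hy hz (esym yz)).
Qed.

End Compare.

(** * The Hessian of the Cartan cubic and of u *)

Section DeriveTools.
Context {R : realType} {n : nat}.
Implicit Types (F : 'rV[R]_n -> R) (x v : 'rV[R]_n).

(** The function is a polynomial along the line, and the derivative is its linear coefficient; this
    serves the cubic, its gradient, the coordinates and the squared norm. *)
Lemma is_derive_taylor3 F x v (d b c : R) :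
  (forall h : R, F (x + h *: v) = F x + h * d + h ^+ 2 * b + h ^+ 3 * c) ->
  is_derive x v F d.
Proof.
move=> FE; rewrite -[x]addr0 -[X in _ + X](scale0r v); apply/is_derive_lineP.
pose p : {poly R} := (F x)%:P + d *: 'X + b *: 'X^2 + c *: 'X^3.
have -> : (fun s : R => F (x + s *: v)) = horner p.
  by apply/funext => h; rewrite FE /p !(hornerD, hornerC, hornerZ, hornerX, hornerXn) [d * h]mulrC; ring.
apply: is_derive_eq; rewrite /p !(derivD, derivC, derivZ, derivX, derivXn) !(hornerD, hornerC, hornerZ, hornerX, hornerXn, hornerMn) expr0n/=; ring.
Qed.

Lemma is_derive_powR F x v (a d : R) : 0 < F x -> is_derive x v F d ->
  is_derive x v (fun y => F y `^ a) (a * F x `^ (a - 1) * d).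
Proof.
have xE : x = x + (0 : R) *: v by rewrite scale0r addr0.
rewrite {1 2 3}xE => F0 /is_derive_lineP dF; apply/is_derive_lineP.
have := @is_derive1_comp R (fun y : R => y `^ a) (fun s : R => F (x + s *: v)) 0 _ _ (is_derive1_powR _ F0) dF.
by rewrite -xE.
Qed.

End DeriveTools.

Section Ord5.
Lemma ord5P (P : 'I_5 -> Prop) : P 0 -> P 1 -> P 2 -> P 3 -> P 4 -> forall i, P i.
Proof.
move=> P0 P1 P2 P3 P4 [[|[|[|[|[|//]]]]] lt].
- by rewrite (_ : Ordinal lt = 0) //; apply: val_inj.
- by rewrite (_ : Ordinal lt = 1) //; apply: val_inj.
- by rewrite (_ : Ordinal lt = 2) //; apply: val_inj.
- by rewrite (_ : Ordinal lt = 3) //; apply: val_inj.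
- by rewrite (_ : Ordinal lt = 4) //; apply: val_inj.
Qed.

Lemma sum_ord5 (V : nmodType) (F : 'I_5 -> V) :
  \sum_i F i = F 0 + F 1 + F 2 + F 3 + F 4.
Proof.
rewrite !big_ord_recr big_ord0 /= add0r.
by congr (_ + _ + _ + _ + _); congr F; apply: val_inj.
Qed.
End Ord5.

(** * Algebraic identities of the Cartan cubic *)

Section Cubic.
Context {R : realType}.
Implicit Types (x y v : 'rV[R]_5).

Definition cubic_grad x : 'rV[R]_5 :=
  let x1 := x 0 0 in let x2 := x 0 1 in
  let z1 := x 0 2 in let z2 := x 0 3 in let z3 := x 0 4 in
  \row_j nth 0 [::
    3 * x1 ^+ 2 + 3 / 2 * (z1 ^+ 2 + z2 ^+ 2 - 2 * z3 ^+ 2 - 2 * x2 ^+ 2);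
    - 6 * x1 * x2 + 3 * Num.sqrt 3 / 2 * (z1 ^+ 2 - z2 ^+ 2);
    3 * x1 * z1 + 3 * Num.sqrt 3 * (x2 * z1 + z2 * z3);
    3 * x1 * z2 + 3 * Num.sqrt 3 * (z1 * z3 - x2 * z2);
    - 6 * x1 * z3 + 3 * Num.sqrt 3 * (z1 * z2)] j.

Definition cubic_hess x : 'M[R]_5 :=
  let x1 := x 0 0 in let x2 := x 0 1 in
  let z1 := x 0 2 in let z2 := x 0 3 in let z3 := x 0 4 in
  let s := Num.sqrt 3 in
  \matrix_(i, j) nth 0 (nth [::] [::
    [:: 6 * x1; - 6 * x2; 3 * z1; 3 * z2; - 6 * z3];
    [:: - 6 * x2; - 6 * x1; 3 * s * z1; - 3 * s * z2; 0];
    [:: 3 * z1; 3 * s * z1; 3 * x1 + 3 * s * x2; 3 * s * z3; 3 * s * z2];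
    [:: 3 * z2; - 3 * s * z2; 3 * s * z3; 3 * x1 - 3 * s * x2; 3 * s * z1];
    [:: - 6 * z3; 0; 3 * s * z2; 3 * s * z1; - 6 * x1]] i) j.

Definition sqnorm x : R := \sum_i x 0 i ^+ 2.

Lemma cubic_taylor x v (h : R) : cartan_cubic (x + h *: v) = cartan_cubic x +
  h * (\sum_i cubic_grad x 0 i * v 0 i) + h ^+ 2 * (\sum_i cubic_grad v 0 i * x 0 i) +
  h ^+ 3 * cartan_cubic v.
Proof.
rewrite !sum_ord5 /cartan_cubic /cubic_grad !mxE /=.
set s := Num.sqrt 3.
by field.
Qed.

Lemma cubic_grad_taylor x v (h : R) j : cubic_grad (x + h *: v) 0 j = cubic_grad x 0 j +
  h * (\sum_i cubic_hess x i j * v 0 i) + h ^+ 2 * cubic_grad v 0 j.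
Proof.
by elim/ord5P: j; rewrite !sum_ord5 /cubic_grad /cubic_hess !mxE /=; field.
Qed.

Lemma sqnorm_taylor x v (h : R) : sqnorm (x + h *: v) = sqnorm x +
  h * (\sum_i 2 * x 0 i * v 0 i) + h ^+ 2 * sqnorm v.
Proof. by rewrite /sqnorm !sum_ord5 !mxE; ring. Qed.

Lemma cubic_euler x : \sum_i cubic_grad x 0 i * x 0 i = 3 * cartan_cubic x.
Proof. by rewrite sum_ord5 /cartan_cubic /cubic_grad !mxE/=; field. Qed.

Lemma cubic_hess_x x : x *m cubic_hess x = 2 *: cubic_grad x.
Proof.
by apply/rowP; elim/ord5P; rewrite !mxE sum_ord5 /cubic_hess !mxE /=; field.
Qed.

(** The first Cartan-Muenzner equation, which expresses that P is isoparametric. *)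
Lemma cubic_eikonal x : sqnorm (cubic_grad x) = 9 * sqnorm x ^+ 2.
Proof.
rewrite /sqnorm !sum_ord5 /cubic_grad !mxE /=.
have s3 : Num.sqrt 3 ^+ 2 = 3 :> R by rewrite sqr_sqrtr.
move: s3; set s := Num.sqrt 3 => s3.
move: (x 0 0) (x 0 1) (x 0 2) (x 0 3) (x 0 4) => x1 x2 z1 z2 z3.
by field: s3.
Qed.
End Cubic.

Section ListDet.
Context {R : comNzRingType}.

Definition del_nth (j : nat) (r : seq R) := take j r ++ drop j.+1 r.

Lemma nth_del_nth j r k : nth 0 (del_nth j r) k = nth 0 r (bump j k).
Proof.
rewrite nth_cat size_take /bump; have [jr|rj] := ltnP j (size r).
  have [kj|jk] := ltnP k j; first by rewrite nth_take.
  by rewrite nth_drop addSn subnKC.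
rewrite drop_oversize ?(leqW rj)// take_oversize//.
have [kr|rk] := ltnP k (size r).
  by rewrite leqNgt (leq_trans kr rj).
by rewrite nth_nil nth_default// (leq_trans rk)// leq_addl.
Qed.

(** Laplace expansion along the first row, on lists, so that simplification turns an explicit
    determinant into a polynomial expression. *)
Fixpoint list_det n (L : seq (seq R)) : R :=
  if n is n'.+1 then
    foldr (fun j s => nth 0 (nth [::] L 0) j * ((-1) ^+ j * list_det n' (map (del_nth j) (behead L))) + s)
      0 (iota 0 n)
  else 1.

Lemma list_detE n L :
  \det (\matrix_(i < n, j < n) nth 0 (nth [::] L i) j) = list_det n L.
Proof.
have foldrE (f : nat -> R) r : foldr (fun j s => f j + s) 0 r = \sum_(j <- r) f j.
  by elim: r => [|j r /= ->]; rewrite ?big_nil ?big_cons.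
elim: n L => [|n IH] L; first by rewrite det_mx00.
rewrite (expand_det_row _ ord0) [list_det _ _]/= -/(iota 0 n.+1).
have := foldrE (fun j => nth 0 (nth [::] L 0) j *
  ((-1) ^+ j * list_det n [seq del_nth j i | i <- behead L])) (iota 0 n.+1).
rewrite [LHS]/= => ->.
rewrite -[iota 0 n.+1]/(index_iota 0 n.+1) big_mkord; apply: eq_bigr => j _.
rewrite mxE /cofactor add0n -IH; congr (_ * (_ * \det _)).
apply/matrixP => i k; rewrite !mxE /=.
have delE l : nth [::] [seq del_nth j r | r <- l] i = del_nth j (nth [::] l i).
  have [il|li] := ltnP i (size l); first by rewrite (nth_map [::]).
  by rewrite !nth_default ?size_map// .
by rewrite delE nth_del_nth nth_behead.
Qed.
End ListDet.

(** Sylvester's identity: one block matrix is factored in two ways. *)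
Lemma det_addmul (R : comNzRingType) m n (A : 'M[R]_(m, n)) (B : 'M[R]_(n, m)) :
  \det (1%:M + A *m B) = \det (1%:M + B *m A).
Proof.
have e1 : block_mx 1%:M A (- B) 1%:M = block_mx 1%:M 0 (- B) 1%:M *m block_mx 1%:M A 0 (1%:M + B *m A).
  by rewrite mulmx_block !(mul1mx, mulmx1, mul0mx, mulmx0, addr0) mulNmx addrCA addNr addr0.
have e2 : block_mx 1%:M A (- B) 1%:M = block_mx (1%:M + A *m B) A 0 1%:M *m block_mx 1%:M 0 (- B) 1%:M.
  by rewrite mulmx_block !(mul1mx, mulmx1, mul0mx, mulmx0, add0r) mulmxN addrK.
have := congr1 determinant e1; rewrite [in LHS]e2 !det_mulmx !det_ublock !det_lblock !det1 !mul1r !mulr1.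
by [].
Qed.

Section CharPoly.
Context {R : realType}.
Implicit Types (x : 'rV[R]_5) (X m : R).

(** The quadratic factor belongs to the plane of x and DP(x), where D^2 P has the eigenvalues 6 |x|
    and -6 |x|; the cubic one is the characteristic equation of [by1], [by2], [by3] up to
    scaling. *)
Lemma det_cubic_hess x X : \det (X%:M - cubic_hess x) =
  (X ^+ 2 - 36 * sqnorm x) * (X ^+ 3 - 27 * sqnorm x * X + 54 * cartan_cubic x).
Proof.
rewrite /cubic_hess /cartan_cubic /sqnorm sum_ord5.
have s3 : Num.sqrt 3 ^+ 2 = 3 :> R by rewrite sqr_sqrtr.
move: s3; set s := Num.sqrt 3.
move: (x 0 0) (x 0 1) (x 0 2) (x 0 3) (x 0 4) => x1 x2 z1 z2 z3 s3.
set A := _ - _.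
have -> : A = \matrix_(i < 5, j < 5) nth 0 (nth [::] [::
    [:: X - 6 * x1; 6 * x2; - (3 * z1); - (3 * z2); 6 * z3];
    [:: 6 * x2; X + 6 * x1; - (3 * s * z1); 3 * s * z2; 0];
    [:: - (3 * z1); - (3 * s * z1); X - (3 * x1 + 3 * s * x2); - (3 * s * z3); - (3 * s * z2)];
    [:: - (3 * z2); 3 * s * z2; - (3 * s * z3); X - (3 * x1 - 3 * s * x2); - (3 * s * z1)];
    [:: 6 * z3; 0; - (3 * s * z2); - (3 * s * z1); X + 6 * x1]] i) j.
  by apply/matrixP; elim/ord5P; elim/ord5P; rewrite /A !mxE /=; ring.
rewrite list_detE /=.
by field: s3.
Qed.

Lemma cubic_grad_hess x : cubic_grad x *m cubic_hess x = (18 * sqnorm x) *: x.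
Proof.
have s3 : Num.sqrt 3 ^+ 2 = 3 :> R by rewrite sqr_sqrtr.
apply/rowP; elim/ord5P; rewrite !mxE sum_ord5 /sqnorm sum_ord5 /cubic_hess /cubic_grad !mxE /=;
  move: s3; set s := Num.sqrt 3;
  move: (x 0 0) (x 0 1) (x 0 2) (x 0 3) (x 0 4) => x1 x2 z1 z2 z3 s3; by field: s3.
Qed.

Lemma cubic_hess_sym x : (cubic_hess x)^T = cubic_hess x.
Proof. by apply/matrixP; elim/ord5P; elim/ord5P; rewrite !mxE. Qed.

End CharPoly.

Section RankTwo.
Context {F : fieldType}.

(** Size 1 + 1 lets these matrices act on [col_mx x g] by block multiplication. *)
Definition mx2 (a b c d : F) : 'M[F]_(1 + 1) := block_mx a%:M b%:M c%:M d%:M.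

Lemma det_mx2 a b c d : \det (mx2 a b c d) = a * d - b * c.
Proof.
have -> : mx2 a b c d = \matrix_(i < 2, j < 2) nth 0 (nth [::] [:: [:: a; b]; [:: c; d]] i) j.
  apply/matrixP => -[[|[|//]] ?] [[|[|//]] ?]; rewrite /mx2 !mxE;
  by case: splitP => -[[|//] ?] //= _; rewrite !mxE; case: splitP => -[[|//] ?] //= _; rewrite !mxE.
by rewrite list_detE /=; ring.
Qed.

Lemma mx2M a b c d a' b' c' d' : mx2 a b c d *m mx2 a' b' c' d' =
  mx2 (a * a' + b * c') (a * b' + b * d') (c * a' + d * c') (c * b' + d * d').
Proof.
rewrite /mx2 mulmx_block; congr block_mx; rewrite -!scalar_mxM -raddfD//.
Qed.

Lemma mx2D a b c d a' b' c' d' : mx2 a b c d + mx2 a' b' c' d' =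
  mx2 (a + a') (b + b') (c + c') (d + d').
Proof. by rewrite /mx2 add_block_mx -!raddfD. Qed.

(* [x] and [g] span an invariant plane of [M], on which [M] acts by the matrix [S]; the
   perturbation only involves that plane, so the determinant changes by the factor of the plane. *)
Lemma det_invariant_plane n (M : 'M[F]_n) (x g : 'rV[F]_n) (S C G : 'M[F]_(1 + 1)) :
  col_mx x g *m M = S *m col_mx x g -> col_mx x g *m (col_mx x g)^T = G -> S \in unitmx ->
  \det (M + (col_mx x g)^T *m C *m col_mx x g) * \det S = \det M * \det (S + G *m C).
Proof.
set W := col_mx x g => WM WG uS.
have -> : M + W^T *m C *m W = (1%:M + (W^T *m C *m invmx S) *m W) *m M.
  by rewrite mulmxDl mul1mx -!mulmxA WM [invmx S *m _]mulmxA mulVmx// mul1mx.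
rewrite det_mulmx det_addmul mulrAC -[in LHS]det_mulmx mulmxDl mul1mx.
by rewrite !mulmxA WG mulmxKV// mulrC.
Qed.
End RankTwo.

Section CharPoly.
Context {R : realType}.
Implicit Types (x : 'rV[R]_5) (X m : R).

(** For m = 1 + delta this is |x|^m D^2 u(x), free of real powers. *)
Definition hess_core m x : 'M[R]_5 :=
  let n := sqnorm x in let p := cartan_cubic x / n in let g := cubic_grad x in
  cubic_hess x - (m / n) *: (x^T *m g + g^T *m x) - (m * p)%:M
  + (m * (m + 2) * p / n) *: (x^T *m x).

Lemma sqnormE x : x *m x^T = (sqnorm x)%:M.
Proof.
rewrite [LHS]mx11_scalar mxE; congr (_%:M); apply: eq_bigr => i _.
by rewrite mxE expr2.
Qed.

(** [det_invariant_plane] with M = Y - D^2 P: the factor Y^2 - 36 |x|^2 is the determinant of [S]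
    and cancels. It must be nonzero for [S] to be invertible. *)
Lemma det_hess_core m x X : let n := sqnorm x in let p := cartan_cubic x / n in
  let Y := X + m * p in n != 0 -> Y ^+ 2 != 36 * n ->
  \det (X%:M - hess_core m x) = (Y ^+ 3 - 27 * n * Y + 54 * cartan_cubic x) *
    (Y ^+ 2 + m * (4 - m) * p * (Y - 3 * p) - 9 * (2 - m) ^+ 2 * n).
Proof.
move=> n p Y n0 Y0; set g := cubic_grad x.
have K0 : Y ^+ 2 - 36 * n != 0 by rewrite subr_eq0.
pose S := mx2 Y (- 2) (- (18 * n)) Y.
pose C := mx2 (- (m * (m + 2) * p / n)) (m / n) (m / n) 0.
pose G := mx2 n (3 * cartan_cubic x) (3 * cartan_cubic x) (9 * n ^+ 2).
have dS : \det S = Y ^+ 2 - 36 * n by rewrite det_mx2; ring.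
have uS : S \in unitmx by rewrite unitmxE dS unitfE.
have xg : x *m g^T = (3 * cartan_cubic x)%:M.
  rewrite [LHS]mx11_scalar mxE -cubic_euler; congr (_%:M); apply: eq_bigr => i _.
  by rewrite mxE mulrC.
have WG : col_mx x g *m (col_mx x g)^T = G.
  rewrite tr_col_mx mul_col_row sqnormE xg; congr block_mx.
    by rewrite -[LHS]trmxK trmx_mul trmxK xg tr_scalar_mx.
  by rewrite sqnormE cubic_eikonal.
have WM : col_mx x g *m (Y%:M - cubic_hess x) = S *m col_mx x g.
  rewrite mul_col_mx /S /mx2 mul_block_col !mul_scalar_mx !mulmxBr !mul_mx_scalar.
  by rewrite cubic_hess_x cubic_grad_hess !scaleNr; congr col_mx; rewrite addrC.
have E : X%:M - hess_core m x = (Y%:M - cubic_hess x) + (col_mx x g)^T *m C *m col_mx x g.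
  rewrite -mulmxA /C /mx2 mul_block_col !mul_scalar_mx tr_col_mx mul_row_col.
  rewrite scale0r addr0 mulmxDr -!scalemxAr /hess_core -/n -/p -/g /Y raddfD/=.
  apply/matrixP => i j; rewrite !mxE; ring.
have := det_invariant_plane C WM WG uS; rewrite -E dS det_cubic_hess.
rewrite /S /G /C mx2M mx2D det_mx2 => h; apply: (mulIf K0); rewrite h.
have pE : cartan_cubic x = p * n by rewrite /p; field.
rewrite -/n pE; field.
exact: n0.
Qed.

End CharPoly.

Lemma horner_char_poly (R : comNzRingType) n (A : 'M[R]_n) X :
  (char_poly A).[X] = \det (X%:M - A).
Proof.
rewrite /char_poly -horner_evalE -det_map_mx; congr (\det _).
apply/matrixP => i j; rewrite /char_poly_mx !mxE.
by rewrite [LHS]/= /horner_eval !(hornerD, hornerN, hornerC, hornerMn, hornerX).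
Qed.

Lemma poly_eq_outside (R : numDomainType) (p q d : {poly R}) : d != 0 ->
  (forall X, d.[X] != 0 -> p.[X] = q.[X]) -> p = q.
Proof.
move=> d0 pq; apply/eqP; rewrite -subr_eq0; have [//|pq0] := eqVneq (p - q) 0.
have r0 : (p - q) * d != 0 by rewrite mulf_neq0.
pose rs : seq R := [seq i%:R | i <- iota 0 (size ((p - q) * d))].
have : (size rs < size ((p - q) * d)%R)%N.
  apply: max_poly_roots => //.
    apply/allP => X _; rewrite /root hornerM mulf_eq0.
    have [d0X|/pq e] := eqVneq d.[X] 0; first by rewrite orbT.
    by rewrite hornerD hornerN e subrr eqxx.
  by rewrite map_inj_uniq ?iota_uniq//; exact: mulrIn (oner_neq0 R).
by rewrite size_map size_iota ltnn.
Qed.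

Section Branch.
Context {R : realType}.
Implicit Types (eps t : R).

Lemma branch_exists eps t : 0 < eps < 1 -> -1 <= t <= 1 ->
  exists B : branch eps, bt B = t.
Proof.
move=> /andP[e0 e1] /andP[t0 t1].
pose p : {poly R} := 27 *: 'X - 'X^3 - (54 * t)%:P.
have pE y : p.[y] = 27 * y - y ^+ 3 - 54 * t.
  by rewrite /p !(hornerD, hornerN, hornerZ, hornerX, hornerXn, hornerC).
have [||y /andP[ya yb] /rootP] := @poly_ivt R p (-3) 3; first lra.
  by rewrite !pE; apply/andP; split; lra.
rewrite pE => yt.
(* 108 - 3 y^2 is the discriminant of Y^2 + y Y + y^2 - 27, the cofactor of Y - y in the cubic. *)
pose q := Num.sqrt (108 - 3 * y ^+ 2).
have y9 : y ^+ 2 <= 9 by nra.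
have q2 : q ^+ 2 = 108 - 3 * y ^+ 2 by rewrite sqr_sqrtr//; lra.
have q0 : 0 <= q by exact: sqrtr_ge0.
have qa : 6 + y <= q by nra.
have qa' : 6 - y <= q by nra.
have qb : q <= 12 + y by nra.
have qb' : q <= 12 - y by nra.
pose E := 8 - 2 * eps - eps ^+ 2.
pose c := eps * (9 * eps + E * t ^+ 2).
have E0 : 0 < E by rewrite /E; nra.
have c0 : 0 < c.
  apply: mulr_gt0 => //; have : 0 <= E * t ^+ 2 by apply: mulr_ge0; [lra|exact: sqr_ge0].
  lra.
pose w := Num.sqrt ((E * t) ^+ 2 + 4 * c).
have w2 : w ^+ 2 = (E * t) ^+ 2 + 4 * c.
  by rewrite sqr_sqrtr// addr_ge0 ?sqr_ge0//; lra.
have w0 : 0 <= w by exact: sqrtr_ge0.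
have wE : `|E * t| < w.
  by rewrite -ltr_sqr ?nnegrE// real_normK ?num_real// w2; lra.
move: wE; rewrite ltr_norml => /andP[wE1 wE2].
have y1c : ((- y + q) / 2) ^+ 3 = 27 * ((- y + q) / 2) - 54 * t.
  have -> : ((- y + q) / 2) ^+ 3 = (- y ^+ 3 + 3 * y ^+ 2 * q - 3 * y * q ^+ 2 + q * q ^+ 2) / 8 by field.
  rewrite q2; lra.
have y3c : ((- y - q) / 2) ^+ 3 = 27 * ((- y - q) / 2) - 54 * t.
  have -> : ((- y - q) / 2) ^+ 3 = (- y ^+ 3 - 3 * y ^+ 2 * q - 3 * y * q ^+ 2 - q * q ^+ 2) / 8 by field.
  rewrite q2; lra.
have bq : ((- (E * t) + w) / 2) ^+ 2 + E * t * ((- (E * t) + w) / 2) = c.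
  have -> : ((- (E * t) + w) / 2) ^+ 2 + E * t * ((- (E * t) + w) / 2) = (w ^+ 2 - (E * t) ^+ 2) / 4 by field.
  rewrite w2; lra.
unshelve eexists (@Branch R eps t ((- y + q) / 2) y ((- y - q) / 2)
  ((- (E * t) + w) / 2) ((- (E * t) - w) / 2) _ _ _ _ _ _ _ _ _ _ _ _); last by [].
all: rewrite -/E -/c.
- by rewrite t0.
- by rewrite y1c; ring.
- by clear -yt; lra.
- by rewrite y3c; ring.
- by apply/andP; clear -qa qb; split; lra.
- by rewrite ya.
- by apply/andP; clear -qa' qb'; split; lra.
- by field.
- by clear -wE2; lra.
- by clear -wE1; lra.
- exact: bq.
- by field.
Qed.

Lemma branch_e2 eps (B : branch eps) : by1 B * by2 B + by1 B * by3 B + by2 B * by3 B = -27.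
Proof.
case: B => t y1 y2 y3 b bm _ c1 c2 c3 /andP[a1 a2] /andP[a3 a4] /andP[a5 a6] ys _ _ _ _ /=.
have y3E : y3 = - y1 - y2 by lra.
(* A double root must be 3, since y2 <= 3 <= y1; otherwise the difference of two cubic equations is
   divided by y1 - y2. *)
have [y12|y12] := eqVneq y1 y2; first by rewrite y3E; nra.
have : (y1 - y2) * (y1 ^+ 2 + y1 * y2 + y2 ^+ 2 - 27) = 0 by lra.
move/eqP; rewrite mulf_eq0 subr_eq0 (negbTE y12) /= => /eqP e.
rewrite y3E; lra.
Qed.

Lemma branch_e3 eps (B : branch eps) : by1 B * by2 B * by3 B = - (54 * bt B).
Proof.
have := branch_e2 B; have := br_c1 B; have := br_sum B.
move: (by1 B) (by2 B) (by3 B) => y1 y2 y3 s c e2.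
have y3E : y3 = - y1 - y2 by lra.
have : y1 * (y1 * y2 + y1 * y3 + y2 * y3) = y1 * (-27) by rewrite e2.
rewrite y3E; lra.
Qed.

Lemma char_poly_hess_core eps (B : branch eps) (x : 'rV[R]_5) r : 0 < r ->
  sqnorm x = r ^+ 2 -> cartan_cubic x = r ^+ 3 * bt B ->
  char_poly (hess_core (2 - eps) x) = \prod_i ('X - (r * branch_eig B i)%:P).
Proof.
move=> r0 nr Pt.
have n0 : sqnorm x != 0 by rewrite nr expf_neq0// gt_eqF.
pose m := 2 - eps; pose p := r * bt B.
have pE : cartan_cubic x / sqnorm x = p by rewrite nr Pt /p; field; rewrite gt_eqF.
(* Both sides are polynomials in X, so the values excluded in [det_hess_core] do no harm. At X = 1 +
   36 |x|^2 - m p the excluding polynomial is positive. *)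
apply: (@poly_eq_outside _ _ _ (('X + (m * p)%:P) ^+ 2 - (36 * sqnorm x)%:P)).
  apply/eqP => /(congr1 (fun q : {poly R} => q.[1 + 36 * sqnorm x - m * p])).
  rewrite !hornerE /=; have : 0 <= sqnorm x by rewrite nr sqr_ge0.
  by move: (sqnorm x) => N N0 /eqP; rewrite gt_eqF//; nra.
move=> X; rewrite !hornerE /= -mulrA -/p => X0.
rewrite horner_char_poly det_hess_core ?pE//; last by rewrite -subr_eq0.
rewrite horner_prod !big_ord_recr big_ord0 /= mul1r !hornerE.
rewrite /branch_eig /= -/m nr Pt /p.
have f1 (Y : R) : (Y - r * by1 B) * (Y - r * by2 B) * (Y - r * by3 B) =
    Y ^+ 3 - 27 * r ^+ 2 * Y + 54 * (r ^+ 3 * bt B).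
  transitivity (Y ^+ 3 - r * (by1 B + by2 B + by3 B) * Y ^+ 2 +
    r ^+ 2 * (by1 B * by2 B + by1 B * by3 B + by2 B * by3 B) * Y - r ^+ 3 * (by1 B * by2 B * by3 B)).
    by ring.
  by rewrite br_sum branch_e2 branch_e3; ring.
have f2 : (X - r * bb B) * (X - r * bbm B) =
    (X + m * (r * bt B)) ^+ 2 + m * (4 - m) * (r * bt B) * (X + m * (r * bt B) - 3 * (r * bt B)) -
    9 * (2 - m) ^+ 2 * r ^+ 2.
  have bE : bbm B = - ((8 - 2 * eps - eps ^+ 2) * bt B) - bb B by have := br_qsum B; lra.
  transitivity (X ^+ 2 - r * (bb B + bbm B) * X -
    r ^+ 2 * (bb B ^+ 2 + (8 - 2 * eps - eps ^+ 2) * bt B * bb B)).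
    by rewrite bE; ring.
  by rewrite br_qsum br_qb /m; ring.
have shift y : X - r * (y - m * bt B) = X + m * (r * bt B) - r * y by ring.
by rewrite !shift -[RHS]mulrA f1 f2 /m; ring.
Qed.
End Branch.

Section ContinuityTools.
Context {R : realType} {n : nat}.
Implicit Types (f g : 'rV[R]_n -> R) (y : 'rV[R]_n).

Lemma cont_ext f g y : (forall z, f z = g z) -> {for y, continuous g} ->
  {for y, continuous f}.
Proof. by move=> /funext ->. Qed.

Lemma contD f g y : {for y, continuous f} -> {for y, continuous g} ->
  {for y, continuous (fun z => f z + g z)}.
Proof. exact: continuousD. Qed.

Lemma contN f y : {for y, continuous f} -> {for y, continuous (fun z => - f z)}.
Proof. exact: continuousN. Qed.

Lemma contM f g y : {for y, continuous f} -> {for y, continuous g} ->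
  {for y, continuous (fun z => f z * g z)}.
Proof. exact: continuousM. Qed.

Lemma cont_near_eq f g y : {near y, f =1 g} -> {for y, continuous f} ->
  {for y, continuous g}.
Proof.
move=> fg cf; rewrite /prop_for /continuous_at -(nbhs_singleton fg).
exact: cvg_trans (near_eq_cvg fg) cf.
Qed.

Lemma contC (c : R) y : {for y, continuous (fun=> c)}.
Proof. exact: cst_continuous. Qed.

Lemma contX f k y : {for y, continuous f} -> {for y, continuous (fun z => f z ^+ k)}.
Proof.
move=> cf; elim: k => [|k IH]; first exact: contC.
have -> : (fun z => f z ^+ k.+1) = (fun z => f z * f z ^+ k) by apply/funext => z; rewrite exprS.
exact: contM.
Qed.

Lemma cont_sum (I : finType) (F : I -> 'rV[R]_n -> R) y :
  (forall i, {for y, continuous (F i)}) -> {for y, continuous (fun z => \sum_i F i z)}.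
Proof.
move=> cF; rewrite (_ : (fun z => _) = (fun z => \sum_(i <- index_enum I) F i z)) //.
elim: (index_enum I) => [|i r IH].
  rewrite (_ : (fun z => _) = (fun=> 0)); first exact: contC.
  by apply/funext => z; rewrite big_nil.
rewrite (_ : (fun z => _) = (fun z => F i z + \sum_(i <- r) F i z)); first exact: contD.
by apply/funext => z; rewrite big_cons.
Qed.

Lemma cont_coord i y : {for y, continuous (fun z : 'rV[R]_n => z 0 i)}.
Proof. exact: coord_continuous. Qed.

Lemma cont_shift f (e : 'rV[R]_n) y : (forall x : 'rV[R]_n, {for x, continuous f}) ->
  {for y, continuous (fun z : 'rV[R]_n => f (z + e))}.
Proof.
move=> cf; have ce : {for y, continuous (fun z : 'rV[R]_n => z + e)}.
  by apply: continuousD; [exact: cvg_id|exact: cst_continuous].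
exact: (continuous_comp ce (cf _)).
Qed.

Lemma cont_powR f (a : R) y : 0 < f y -> {for y, continuous f} ->
  {for y, continuous (fun z => f z `^ a)}.
Proof.
move=> f0 cf; apply: (@continuous_comp _ _ _ f (fun t : R => t `^ a)) => //.
apply/differentiable_continuous/derivable1_diffP.
by have [] := is_derive1_powR a f0.
Qed.

End ContinuityTools.

(** * Derivatives of u away from the origin *)

Section CartanFunction.
Context {R : realType}.
Implicit Types (x y v : 'rV[R]_5) (m c : R).

Lemma sqnorm_gt0 x : x != 0 -> 0 < sqnorm x.
Proof.
move=> x0; rewrite lt_neqAle sumr_ge0 ?andbT; last by move=> i _; exact: sqr_ge0.
apply: contraNneq x0 => /esym/eqP; rewrite psumr_eq0; last by move=> i _; exact: sqr_ge0.
move=> /allP h; apply/eqP/rowP => i; rewrite mxE.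
by have := h i (mem_index_enum i); rewrite /= sqrf_eq0 => /eqP.
Qed.

Lemma cont_sqnorm y : {for y, continuous (@sqnorm R)}.
Proof. by apply: cont_sum => i; apply: contX; exact: cont_coord. Qed.

Lemma sum_delta (a : 'I_5 -> R) i : \sum_k a k * (delta_mx 0 i : 'rV[R]_5) 0 k = a i.
Proof.
rewrite (bigD1 i)//= mxE !eqxx mulr1 big1 ?addr0// => k ki.
by rewrite mxE eqxx (negbTE ki) mulr0.
Qed.

Lemma cont_cubic y : {for y, continuous (@cartan_cubic R)}.
Proof.
pose c i := @cont_coord R 5 i y; pose sq i := @contX R 5 _ 2 y (c i); pose k a := @contC R 5 a y.
exact: (contD (contD (@contX R 5 _ 3 y (c 0)) (contM (contM (contM (k 3) (c 0)) (k 2^-1))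
    (contD (contD (contD (sq 2) (sq 3)) (contN (contM (k 2) (sq 4)))) (contN (contM (k 2) (sq 1))))))
  (contM (contM (contM (k 3) (k (Num.sqrt 3))) (k 2^-1))
    (contD (contD (contM (c 1) (sq 2)) (contN (contM (c 1) (sq 3))))
      (contM (contM (contM (k 2) (c 2)) (c 3)) (c 4))))).
Qed.

(** The exact Taylor formula with h = 1 along e_j writes this entry through values of the cubic and
    a linear function. The Hessian entries are treated in the same way. *)
Lemma cont_grad y j : {for y, continuous (fun z => cubic_grad z 0 j)}.
Proof.
pose e : 'rV[R]_5 := delta_mx 0 j.
have E z : cubic_grad z 0 j = cartan_cubic (z + e) +
    (- cartan_cubic z + (- (\sum_i cubic_grad e 0 i * z 0 i) + - cartan_cubic e)).
  by have := cubic_taylor z e 1; rewrite sum_delta scale1r => ->; ring.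
have c1 := @cont_shift R 5 _ e y (fun y => @cont_cubic y).
have c2 := @contN R 5 _ y (@cont_cubic y).
have c3 : {for y, continuous (fun z : 'rV[R]_5 => \sum_i (cubic_grad e : 'rV[R]_5) 0 i * z 0 i)}.
  by apply: cont_sum => i; exact: contM (@contC R 5 _ y) (@cont_coord R 5 i y).
have c4 := contD c1 (contD c2 (contD (@contN R 5 _ y c3) (@contC R 5 (- cartan_cubic e) y))).
exact: (@cont_ext R 5 _ _ y E c4).
Qed.

Lemma cont_hess y i j : {for y, continuous (fun z => cubic_hess z i j)}.
Proof.
pose e : 'rV[R]_5 := delta_mx 0 i.
have E z : cubic_hess z i j = cubic_grad (z + e) 0 j + (- cubic_grad z 0 j + - cubic_grad e 0 j).
  by have := cubic_grad_taylor z e 1 j; rewrite sum_delta scale1r => ->; ring.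
have c1 := @cont_shift R 5 _ e y (fun y => @cont_grad y j).
have c4 := contD c1 (contD (@contN R 5 _ y (@cont_grad y j)) (@contC R 5 (- cubic_grad e 0 j) y)).
exact: (@cont_ext R 5 _ _ y E c4).
Qed.

Lemma cont_sqnorm_powR y (a : R) : y != 0 -> {for y, continuous (fun z => sqnorm z `^ a)}.
Proof. by move=> y0; apply: cont_powR (@cont_sqnorm y); exact: sqnorm_gt0. Qed.

Definition cartan_w m x : R := cartan_cubic x * sqnorm x `^ (- (m / 2)).

Definition cartan_dw m (i : 'I_5) x : R :=
  cubic_grad x 0 i * sqnorm x `^ (- (m / 2)) -
  m * (cartan_cubic x * x 0 i * sqnorm x `^ (- (m / 2) - 1)).

Definition cartan_ddw m (i j : 'I_5) x : R :=
  cubic_hess x i j * sqnorm x `^ (- (m / 2)) -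
  m * ((cubic_grad x 0 j * x 0 i + cubic_grad x 0 i * x 0 j + cartan_cubic x * (i == j)%:R) *
    sqnorm x `^ (- (m / 2) - 1)) +
  m * (m + 2) * (cartan_cubic x * (x 0 i * x 0 j) * sqnorm x `^ (- (m / 2) - 1 - 1)).

Lemma is_derive_cubic x i : is_derive x (delta_mx 0 i) (@cartan_cubic R) (cubic_grad x 0 i).
Proof.
apply: is_derive_taylor3 => h; rewrite cubic_taylor sum_delta; by [].
Qed.

Lemma is_derive_grad x i j :
  is_derive x (delta_mx 0 i) (fun z => cubic_grad z 0 j) (cubic_hess x i j).
Proof.
apply: (@is_derive_taylor3 _ _ _ _ _ _ (cubic_grad (delta_mx 0 i : 'rV[R]_5) 0 j) 0) => h.
by rewrite cubic_grad_taylor sum_delta mulr0 addr0.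
Qed.

Lemma is_derive_coord x i j :
  is_derive x (delta_mx 0 i) (fun z : 'rV[R]_5 => z 0 j) (i == j)%:R.
Proof.
apply: (@is_derive_taylor3 _ _ _ _ _ _ 0 0) => h.
by rewrite !mxE eqxx/= eq_sym !mulr0 !addr0.
Qed.

Lemma is_derive_sqnorm x i : is_derive x (delta_mx 0 i) (@sqnorm R) (2 * x 0 i).
Proof.
apply: (@is_derive_taylor3 _ _ _ _ _ _ (sqnorm (delta_mx 0 i : 'rV[R]_5)) 0) => h.
by rewrite sqnorm_taylor sum_delta mulr0 addr0.
Qed.

Lemma is_derive_sqnorm_powR x i (a : R) : x != 0 ->
  is_derive x (delta_mx 0 i) (fun z => sqnorm z `^ a) (2 * a * x 0 i * sqnorm x `^ (a - 1)).
Proof.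
move=> x0; have := is_derive_powR a (sqnorm_gt0 x0) (is_derive_sqnorm x i).
by rewrite (_ : a * _ * _ = 2 * a * x 0 i * sqnorm x `^ (a - 1)); last ring.
Qed.

Lemma is_deriveM_fun (f g : 'rV[R]_5 -> R) x v (df dg : R) :
  is_derive x v f df -> is_derive x v g dg ->
  is_derive x v (fun z => f z * g z) (f x * dg + g x * df).
Proof. exact: is_deriveM. Qed.

Lemma is_deriveB_fun (f g : 'rV[R]_5 -> R) x v (df dg : R) :
  is_derive x v f df -> is_derive x v g dg ->
  is_derive x v (fun z => f z - g z) (df - dg).
Proof. exact: is_deriveB. Qed.

Lemma is_derive_w m i x : x != 0 -> is_derive x (delta_mx 0 i) (cartan_w m) (cartan_dw m i x).
Proof.
move=> x0; rewrite /cartan_w.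
apply: is_derive_eq (is_deriveM_fun (is_derive_cubic x i) (is_derive_sqnorm_powR i (- (m / 2)) x0)) _.
by rewrite /cartan_dw; field.
Qed.

Lemma is_derive_dw m i j x : x != 0 ->
  is_derive x (delta_mx 0 i) (cartan_dw m j) (cartan_ddw m i j x).
Proof.
move=> x0; rewrite /cartan_dw.
have d1 := is_deriveM_fun (is_derive_grad x i j) (is_derive_sqnorm_powR i (- (m / 2)) x0).
have d2 := is_deriveM_fun (is_deriveM_fun (is_derive_cubic x i) (is_derive_coord x i j))
  (is_derive_sqnorm_powR i (- (m / 2) - 1) x0).
have d3 : is_derive x (delta_mx 0 i : 'rV[R]_5) (fun=> m) 0 by exact: is_derive_cst.
apply: is_derive_eq (is_deriveB_fun d1 (is_deriveM_fun d3 d2)) _.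
by rewrite /cartan_ddw; field.
Qed.

Lemma cont_dw m i x : x != 0 -> {for x, continuous (cartan_dw m i)}.
Proof.
move=> x0; have cp a := @cont_sqnorm_powR x a x0.
exact: (contD (contM (@cont_grad x i) (cp _)) (contN (contM (@contC R 5 m x)
  (contM (contM (@cont_cubic x) (@cont_coord R 5 i x)) (cp _))))).
Qed.

Lemma cont_ddw m i j x : x != 0 -> {for x, continuous (cartan_ddw m i j)}.
Proof.
move=> x0; have cp a := @cont_sqnorm_powR x a x0.
have c1 := contM (@cont_hess x i j) (cp (- (m / 2))).
have c2 := contM (contD (contD (contM (@cont_grad x j) (@cont_coord R 5 i x))
  (contM (@cont_grad x i) (@cont_coord R 5 j x))) (contM (@cont_cubic x) (@contC R 5 (i == j)%:R x)))
  (cp (- (m / 2) - 1)).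
have c3 := contM (contM (@cont_cubic x) (contM (@cont_coord R 5 i x) (@cont_coord R 5 j x)))
  (cp (- (m / 2) - 1 - 1)).
exact: (contD (contD c1 (contN (contM (@contC R 5 m x) c2))) (contM (@contC R 5 (m * (m + 2)) x) c3)).
Qed.

Lemma cartan_uE delta c x : x != 0 -> cartan_u delta c x = c + cartan_w (1 + delta) x.
Proof.
move=> x0; rewrite /cartan_u (negbTE x0) /cartan_w; congr (_ + _ * _).
rewrite -powRN /enorm -powR12_sqrt; last by apply: sumr_ge0 => i _; exact: sqr_ge0.
rewrite -[X in X `^ _ `^ _]/(sqnorm x) -powRrM; congr (_ `^ _); by field.
Qed.

Lemma near_neq0 x : x != 0 -> \forall y \near x, y != 0.
Proof.
move=> x0; have : \forall y \near x, 0 < sqnorm y.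
  by apply: (cvgr_gt _ (@cont_sqnorm x)); exact: sqnorm_gt0.
apply: filterS => y; apply: contraTneq => ->.
by rewrite /sqnorm big1 ?ltxx// => i _; rewrite mxE expr0n.
Qed.

Lemma is_derive_u delta c i x : x != 0 ->
  is_derive x (delta_mx 0 i) (cartan_u delta c) (cartan_dw (1 + delta) i x).
Proof.
move=> x0; apply: (@near_eq_is_derive _ _ _ (fun z => c + cartan_w (1 + delta) z)).
  by near=> y; rewrite cartan_uE//; near: y; exact: near_neq0.
have d3 : is_derive x (delta_mx 0 i : 'rV[R]_5) (fun=> c) 0 by exact: is_derive_cst.
apply: is_derive_eq (is_deriveD d3 (is_derive_w (1 + delta) i x0)) _.
by rewrite add0r.
Unshelve. all: by end_near. Qed.

Lemma partial_u delta c i x : x != 0 ->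
  partial i (cartan_u delta c) x = cartan_dw (1 + delta) i x.
Proof. by move=> x0; have [] := is_derive_u delta c i x0. Qed.

Lemma near_partial_u delta c i x : x != 0 ->
  \forall y \near x, cartan_dw (1 + delta) i y = partial i (cartan_u delta c) y.
Proof.
move=> x0; near=> y; rewrite partial_u//; near: y; exact: near_neq0.
Unshelve. all: by end_near. Qed.

Lemma is_derive_partial_u delta c i j x : x != 0 ->
  is_derive x (delta_mx 0 i) (partial j (cartan_u delta c)) (cartan_ddw (1 + delta) i j x).
Proof.
move=> x0; apply: near_eq_is_derive (near_partial_u delta c j x0) _.
exact: is_derive_dw.
Qed.

Lemma partial_partial_u delta c i j x : x != 0 ->
  partial i (partial j (cartan_u delta c)) x = cartan_ddw (1 + delta) i j x.
Proof. by move=> x0; have [] := is_derive_partial_u delta c i j x0. Qed.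

Lemma C2_near_u delta c x : x != 0 -> C2_near (cartan_u delta c) x.
Proof.
move=> x0; near=> y.
have y0 : y != 0 by near: y; exact: near_neq0.
split=> [i|j i]; split.
- by have [] := is_derive_u delta c i y0.
- exact: (@cont_near_eq R 5 (cartan_dw (1 + delta) i) (partial i (cartan_u delta c)) y
    (near_partial_u delta c i y0) (@cont_dw (1 + delta) i y y0)).
- by have [] := is_derive_partial_u delta c i j y0.
- apply: (cont_near_eq _ (@cont_ddw (1 + delta) i j y y0)).
  by near=> z; rewrite partial_partial_u//; near: z; exact: near_neq0.
Unshelve. all: by end_near. Qed.

End CartanFunction.

(** * The spectrum of the conformal Hessian of u *)

Section CartanEigenvalues.
Context {R : realType}.
Implicit Types (x : 'rV[R]_5) (m delta c : R).

Lemma enorm_sqr x : enorm x ^+ 2 = sqnorm x.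
Proof. by rewrite sqr_sqrtr//; apply: sumr_ge0 => i _; exact: sqr_ge0. Qed.

Lemma enorm_gt0 x : x != 0 -> 0 < enorm x.
Proof. by move=> x0; rewrite sqrtr_gt0; exact: sqnorm_gt0. Qed.

Lemma powR_sub1 (z a : R) : 0 < z -> z `^ (a - 1) = z `^ a / z.
Proof.
move=> z0; rewrite powRD; first by rewrite powRN powRr1// ltW.
by apply/implyP => _; rewrite gt_eqF.
Qed.

Lemma sqnorm_powR x m : x != 0 -> sqnorm x `^ (- (m / 2)) = enorm x `^ (- m).
Proof.
move=> x0; rewrite -enorm_sqr -powR_mulrn ?ltW ?enorm_gt0// -powRrM.
by congr (_ `^ _); field.
Qed.

Lemma hessian_cartan_u delta c x : x != 0 ->
  hessian (cartan_u delta c) x = enorm x `^ (- (1 + delta)) *: hess_core (1 + delta) x.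
Proof.
move=> x0; have N0 := sqnorm_gt0 x0; have Nn0 : sqnorm x != 0 by rewrite gt_eqF.
apply/matrixP => i j; rewrite mxE partial_partial_u// /cartan_ddw !powR_sub1// sqnorm_powR//.
rewrite /hess_core !mxE !big_ord1 !mxE.
move: (cubic_grad x 0 i) (cubic_grad x 0 j) (cubic_hess x i j) (x 0 i) (x 0 j) (cartan_cubic x).
move: Nn0 (enorm x `^ _); move: (sqnorm x) => N N0' q gi gj h xi xj p.
by rewrite mulr_natr; case: (i == j); rewrite ?mulr1n ?mulr0n; field.
Qed.

Lemma gradient_cartan_u delta c x : x != 0 ->
  enorm (gradient (cartan_u delta c) x) ^+ 2 = (enorm x `^ (- (1 + delta))) ^+ 2 *
   (9 * sqnorm x ^+ 2 - (6 * (1 + delta) - (1 + delta) ^+ 2) * cartan_cubic x ^+ 2 / sqnorm x).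
Proof.
move=> x0; have N0 := sqnorm_gt0 x0; have Nn0 : sqnorm x != 0 by rewrite gt_eqF.
rewrite enorm_sqr {1}/sqnorm.
set m := 1 + delta; set q := enorm x `^ _; set P := cartan_cubic x.
have dE i : gradient (cartan_u delta c) x 0 i =
    q * (cubic_grad x 0 i - m * P / sqnorm x * x 0 i).
  rewrite mxE partial_u// /cartan_dw powR_sub1// sqnorm_powR// -/m -/q -/P.
  by move: Nn0; move: (sqnorm x) (cubic_grad x 0 i) (x 0 i) => N g y N0'; field.
rewrite (eq_bigr _ (fun i _ => congr1 (fun z => z ^+ 2) (dE i))).
set b := m * P / sqnorm x.
have -> : \sum_i (q * (cubic_grad x 0 i - b * x 0 i)) ^+ 2 =
    q ^+ 2 * (sqnorm (cubic_grad x) - 2 * b * (\sum_i cubic_grad x 0 i * x 0 i) +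
       b ^+ 2 * sqnorm x).
  rewrite /sqnorm !mulr_sumr -sumrB -big_split/= mulr_sumr; apply: eq_bigr => i _.
  by ring.
by rewrite cubic_euler cubic_eikonal -/P /b; field.
Qed.

(** Cauchy-Schwarz for 3 P(x) = DP(x) . x with |DP| = 3 |x|^2, written as a sum of squares. *)
Lemma cubic_le x : `|cartan_cubic x| <= enorm x ^+ 3.
Proof.
have [->|x0] := eqVneq x 0.
  by rewrite /cartan_cubic !mxE !(mulr0, mul0r, expr0n, addr0, subr0, add0r)/= normr0 exprn_ge0// sqrtr_ge0.
have r0 := enorm_gt0 x0; have N0 := sqnorm_gt0 x0.
suff : cartan_cubic x ^+ 2 <= (enorm x ^+ 3) ^+ 2.
  by rewrite -real_normK ?num_real// ler_sqr// ?nnegrE ?exprn_ge0// ltW.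
rewrite exprAC enorm_sqr.
have h : 0 <= \sum_i (sqnorm x * cubic_grad x 0 i - 3 * cartan_cubic x * x 0 i) ^+ 2.
  by apply: sumr_ge0 => i _; exact: sqr_ge0.
have e (N P : R) : \sum_i (N * cubic_grad x 0 i - 3 * P * x 0 i) ^+ 2 =
    N ^+ 2 * sqnorm (cubic_grad x) - 6 * N * P * (\sum_i cubic_grad x 0 i * x 0 i)
    + 9 * P ^+ 2 * sqnorm x.
  by rewrite /sqnorm !mulr_sumr -sumrB -big_split/=; apply: eq_bigr => i _; ring.
move: h; rewrite e cubic_euler cubic_eikonal => h.
have : 0 <= 9 * sqnorm x * (sqnorm x ^+ 3 - cartan_cubic x ^+ 2).
  by apply: le_trans h _; rewrite le_eqVlt; apply/orP; left; apply/eqP; ring.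
by rewrite pmulr_rge0 ?subr_ge0// mulr_gt0.
Qed.

Lemma spectral_form_affine n (A : 'M[R]_n) l (k s : R) : spectral_form A l ->
  spectral_form (k *: A - s%:M) (\row_i (k * l 0 i - s)).
Proof.
move=> [U uU AE]; exists U; first exact: uU.
rewrite map_mxB map_mxZ map_scalar_mx/= AE.
have -> : diag_mx (map_mx (real_complex R) (\row_i (k * l 0 i - s))) =
    real_complex R k *: diag_mx (map_mx (real_complex R) l) - (real_complex R s)%:M.
  apply/matrixP => i j; rewrite !mxE; case: (i == j); rewrite ?mulr0n ?mulr1n ?mulr0 ?subr0//.
  by rewrite rmorphB rmorphM.
rewrite mulmxBr mulmxBl -!scalemxAr -!scalemxAl; congr (_ - _).
by rewrite mul_mx_scalar -scalemxAl -invmx_unitary// mulVmx ?unitarymx_unit// scalemx1.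
Qed.

Lemma hess_core_sym m x : Defs.symmetric (hess_core m x).
Proof.
have hs i j : cubic_hess x j i = cubic_hess x i j.
  by rewrite -[in LHS](cubic_hess_sym x) mxE.
rewrite /Defs.symmetric /hess_core; move: (cubic_hess x) (cubic_grad x) hs => Q g hs.
apply/matrixP => i j; rewrite !mxE !big_ord1 !mxE hs [j == i]eq_sym.
ring.
Qed.

Lemma eigenvalues_conformal delta c x : 0 < delta < 1 -> 0 < enorm x <= 1 ->
  eigenvalue_set delta c (eigenvalues (conformal_hessian (cartan_u delta c) x)).
Proof.
move=> d01 /andP[r0 r1]; set r := enorm x in r0 r1 *.
have x0 : x != 0.
  apply: contraTneq r0 => xE; rewrite /r xE /enorm big1 ?sqrtr0 ?ltxx// => i _.
  by rewrite mxE expr0n.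
have e01 : 0 < 1 - delta < 1 by move: d01 => /andP[? ?]; apply/andP; split; lra.
have rn0 : r != 0 by rewrite gt_eqF.
have [|B BE] := @branch_exists R (1 - delta) (cartan_cubic x / r ^+ 3) e01.
  have r3 : 0 < r ^+ 3 by rewrite exprn_gt0.
  have := cubic_le x; rewrite -/r ler_norml => /andP[P1 P2].
  by rewrite ler_pdivrMr// ler_pdivlMr// mulN1r mul1r P1.
have PE : cartan_cubic x = r ^+ 3 * bt B by rewrite BE; field.
have NE : sqnorm x = r ^+ 2 by rewrite -enorm_sqr.
pose k := cartan_u delta c x * r `^ (- (1 + delta)).
pose s := shift_term delta r (bt B).
have sE : 2^-1 * enorm (gradient (cartan_u delta c) x) ^+ 2 = s.
  rewrite gradient_cartan_u// -/r NE PE /s /shift_term.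
  have -> : r `^ (2 * (1 - delta)) = (r `^ (- (1 + delta))) ^+ 2 * r ^+ 4.
    rewrite -!powR_mulrn ?powR_ge0 ?ltW// -powRrM -powRD; last by apply/implyP.
    by congr (_ `^ _); ring.
  by move: (r `^ _) => q; field.
have HE : conformal_hessian (cartan_u delta c) x = k *: hess_core (2 - (1 - delta)) x - s%:M.
  have mE : 2 - (1 - delta) = 1 + delta by ring.
  by rewrite /conformal_hessian sE (hessian_cartan_u delta c x0) scalerA mE.
have [l lE] := spectral_form_exists (hess_core_sym (2 - (1 - delta)) x).
have [p pE] := prod_XsubC_inj (l' := \row_i (r * branch_eig B i))
  (etrans (esym (spectral_form_char_poly lE)) (etrans (char_poly_hess_core r0 NE PE)
   (eq_bigr _ (fun i _ => congr1 (fun z => 'X - z%:P) (esym (mxE _ _ _ _)))))).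
have sH : Defs.symmetric (conformal_hessian (cartan_u delta c) x).
  by rewrite HE /Defs.symmetric linearB linearZ/= (hess_core_sym _ x) tr_scalar_mx.
have f1 := spectral_form_eigenvalues sH.
have f2 := spectral_form_affine k s lE; rewrite -HE in f2.
have [p' ->] := prod_XsubC_inj (etrans (esym (spectral_form_char_poly f1)) (spectral_form_char_poly f2)).
exists r, B, (p' * p)%g; split; first by rewrite r0.
apply/rowP => i; rewrite !mxE pE !mxE permM /conformal_eig -/s; congr (_ - _).
rewrite mulrA; congr (_ * _); rewrite /k /scale_factor /cartan_u (negbTE x0) -/r PE.
have e1 : r `^ (- (1 + delta)) * r = r `^ (- delta).
  rewrite -[X in _ * X]powRr1 ?ltW// -powRD; last by apply/implyP.
  by congr (_ `^ _); ring.
have e2 : r `^ (2 * (1 - delta)) = r ^+ 3 / r `^ (1 + delta) * r `^ (- delta).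
  rewrite -powRN -powR_mulrn ?ltW// -!powRD; try exact/implyP.
  by congr (_ `^ _); ring.
rewrite -mulrA e1 e2; ring.
Qed.

End CartanEigenvalues.

(** * The viscosity property *)

Lemma powR_add (R : realType) (x r s : R) : 0 < x -> x `^ (r + s) = x `^ r * x `^ s.
Proof. by move=> x0; rewrite powRD// (gt_eqF x0) implybT. Qed.

Section Touching.
Context {R : realType}.

Lemma derive_linear_bound (D : R -> R) (d : R) : is_derive (0 : R) (1 : R) D d ->
  exists2 rho : R, 0 < rho & forall h : R, 0 <= h < rho -> `|D h - D 0| <= (`|d| + 1) * h.
Proof.
case=> dD <-.
have /cvgrPdist_le/(_ 1 ltr01)/nbhs_ballP[rho /= rho0 hr] := dD.
exists rho => // h /andP[]; rewrite le_eqVlt => /predU1P[<- _|h0 hrho].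
  by rewrite subrr normr0 mulr0.
have /hr : ball (0 : R) rho h by rewrite /ball/= sub0r normrN gtr0_norm.
rewrite gt_eqF// => /(_ isT) /=; rewrite [h *: 1]mulr1 addr0.
rewrite -[X in `|X - _|]/('D_1 D 0); set d0 := 'D_1 D 0 => hd.
have -> : D h - D 0 = h * (h^-1 * (D h - D 0)) by rewrite mulVKf ?gt_eqF.
rewrite normrM (gtr0_norm h0) mulrC; apply: ler_wpM2r; first exact: ltW.
have -> : h^-1 * (D h - D 0) = d0 - (d0 - h^-1 *: (D h - D 0)) by rewrite subKr.
by apply: le_trans (ler_normB _ _) _; rewrite lerD2l.
Qed.

Lemma C2_taylor_bound n (F : 'rV[R]_n -> R) (x v : 'rV[R]_n) : C2_near F x ->
  exists M rho : R, 0 < rho /\ forall h : R, 0 < h < rho ->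
    `|F (x + h *: v) - F x - h * (\sum_i v 0 i * partial i F x)| <= M * h ^+ 2.
Proof.
move=> C2F; have [F1 F2] := C2_line v C2F.
set D := fun h : R => \sum_i v 0 i * partial i F (x + h *: v) in F1 F2.
have D0 : \sum_i v 0 i * partial i F x = D 0 by rewrite /D scale0r addr0.
have [rho1 rho10 hD] := derive_linear_bound F2.
have /nbhs_ballP[rho2 /= rho20 hF] := F1.
set M := `|_| + 1 in hD; exists M, (Num.min rho1 rho2); split; first by rewrite lt_min rho10.
move=> h /andP[h0]; rewrite lt_min => /andP[h1 h2]; rewrite D0.
have Fd (s : R) : 0 <= s <= h -> is_derive s (1 : R) (fun s : R => F (x + s *: v)) (D s).
  move=> /andP[s0 sh]; apply: hF; rewrite /ball/= sub0r normrN ger0_norm//.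
  exact: le_lt_trans h2.
have [|s||s] := @MVT_segment R (fun s : R => F (x + s *: v)) D 0 h.
- exact: ltW.
- by rewrite in_itv/= => /andP[s0 sh]; apply: Fd; rewrite !ltW.
- by apply: derivable_within_continuous => s; rewrite in_itv/= => sh; have [] := Fd _ sh.
rewrite in_itv/= => /andP[s0 sh]; rewrite scale0r addr0 subr0 => ->.
have s1 : 0 <= s < rho1 by rewrite s0 (le_lt_trans sh).
have -> : D s * h - h * D 0 = h * (D s - D 0) by ring.
rewrite normrM (gtr0_norm h0) expr2 mulrCA ler_pM2l//; apply: le_trans (hD s s1) _.
by apply: ler_wpM2l => //; rewrite addr_ge0.
Qed.

(* Since [h ^ (2 - delta)] dominates [h ^ 2], comparing the scales [h] and [theta h] with
   [theta ^ (1 - delta) = 1/2] contradicts both bounds on the slope [a]. *)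
Lemma no_linear_approximation (delta a M rho : R) : 0 < delta < 1 -> 0 < rho ->
  (forall h : R, 0 < h < rho -> h `^ (2 - delta) <= a * h + M * h ^+ 2 /\
     a * h <= h `^ (2 - delta) + M * h ^+ 2) -> False.
Proof.
move=> /andP[d0 d1] rho0 H; have e0 : 0 < 1 - delta by lra.
have powE (h : R) : 0 < h -> h `^ (2 - delta) = h * h `^ (1 - delta).
  move=> h0; rewrite -[X in X * _]powRr1 ?ltW// -powR_add//.
  by congr (_ `^ _); ring.
have H' (h : R) : 0 < h < rho -> h `^ (1 - delta) <= a + M * h /\
    a <= h `^ (1 - delta) + M * h.
  move=> hh; have /andP[h0 _] := hh; have [h1 h2] := H h hh; rewrite powE// in h1 h2.
  by split; rewrite -(ler_pM2l h0); lra.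
pose M1 := `|M| + 1; have M10 : 0 < M1 by rewrite /M1 ltr_pwDr.
have MM : M <= M1 by rewrite /M1; have := ler_norm M; lra.
pose theta : R := 2^-1 `^ (1 - delta)^-1.
have th0 : 0 < theta by rewrite powR_gt0.
have th1 : theta <= 1 by apply: powR_le1; [lra|rewrite invr_ge0 ltW].
have thE : theta `^ (1 - delta) = 2^-1 by rewrite -powRrM mulVf ?powRr1// gt_eqF.
(* Chosen so that h <= k implies 8 M1 h <= h^(1 - delta). *)
pose k := (8 * M1)^-1 `^ delta^-1.
have k0 : 0 < k by rewrite powR_gt0// invr_gt0 mulr_gt0.
pose h := Num.min k (rho / 2).
have h0 : 0 < h by rewrite lt_min k0 divr_gt0.
have hrho : h < rho by rewrite gt_min; apply/orP; right; lra.
have thh : 0 < theta * h by rewrite mulr_gt0.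
have thh1 : theta * h <= h by rewrite ler_piMl// ltW.
have hd : 8 * M1 * h `^ delta <= 1.
  rewrite -ler_pdivlMl ?mulr_gt0// mulr1.
  have -> : (8 * M1)^-1 = k `^ delta by rewrite -powRrM mulVf ?powRr1 ?gt_eqF// invr_ge0 mulr_ge0// ltW.
  by apply: ge0_ler_powR; rewrite ?nnegrE; [exact: ltW|exact: ltW|exact: ltW|rewrite ge_min lexx].
have [h1 _] := H' h (introT andP (conj h0 hrho)).
have [_ h2] := H' (theta * h) (introT andP (conj thh (le_lt_trans thh1 hrho))).
rewrite (powRM _ (ltW th0) (ltW h0)) thE in h2.
have hh : h = h `^ (1 - delta) * h `^ delta.
  by rewrite -powR_add// subrK powRr1// ltW.
have p0 : 0 < h `^ (1 - delta) by rewrite powR_gt0.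
have b1 : M * h <= M1 * h by rewrite ler_pM2r.
have b2 : M * (theta * h) <= M1 * h.
  apply: le_trans (_ : M1 * (theta * h) <= _); first by rewrite ler_pM2r.
  by rewrite ler_pM2l.
have b3 : 8 * (M1 * h) <= h `^ (1 - delta).
  rewrite [in leLHS]hh; apply: le_trans (_ : h `^ (1 - delta) * (8 * M1 * h `^ delta) <= _).
    by rewrite le_eqVlt; apply/orP; left; apply/eqP; ring.
  by rewrite -[leRHS]mulr1 ler_pM2l.
(* With p = h^(1 - delta): p <= a + p / 8 and a <= p / 2 + p / 8, which contradicts p > 0. *)
by lra.
Qed.

End Touching.

Section Main.
Context {R : realType}.
Implicit Types (x : 'rV[R]_5) (delta c : R) (phi : 'rV[R]_5 -> R).

Lemma cartan_u_axis delta c (h sg : R) : 0 < h -> sg ^+ 2 = 1 ->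
  cartan_u delta c (h *: (sg *: delta_mx 0 0)) = c + sg * h `^ (2 - delta).
Proof.
move=> h0 sg2; have sg0 : sg != 0.
  by apply: contra_eq_neq sg2 => ->; rewrite expr0n/= eq_sym oner_eq0.
have x0 : h *: (sg *: delta_mx 0 0) != 0 :> 'rV[R]_5.
  apply/eqP => /rowP/(_ 0); rewrite !mxE !eqxx mulr1 => /eqP.
  by rewrite mulf_eq0 (negbTE sg0) gt_eqF.
rewrite /cartan_u (negbTE x0); congr (_ + _).
have -> : enorm (h *: (sg *: delta_mx 0 0) : 'rV[R]_5) = h.
  rewrite /enorm sum_ord5 !mxE/= !(mulr0, mulr1, expr0n, addr0)/= exprMn sg2 mulr1.
  by rewrite sqrtr_sqr gtr0_norm.
have -> : cartan_cubic (h *: (sg *: delta_mx 0 0) : 'rV[R]_5) = sg * h ^+ 3.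
  rewrite /cartan_cubic !mxE/= !(mulr0, mulr1, expr0n, addr0, subr0)/=.
  by rewrite exprMn (exprS sg) sg2 !(mulr0, mulr1, mul0r, addr0) mulrC.
rewrite -mulrA; congr (_ * _).
rewrite -powRN -powR_mulrn ?ltW// -powR_add//; congr (_ `^ _); ring.
Qed.

(** The sign [sg0] is 1 when phi lies above u and -1 when it lies below. Evaluating at the two
    opposite points of the x1-axis, where u - c is h^(2 - delta) and its negative, gives the two
    bounds on the slope of phi. *)
Lemma no_touching delta c phi (sg0 : R) : 0 < delta < 1 -> sg0 ^+ 2 = 1 -> C2_near phi 0 ->
  (\forall x \near (0 : 'rV[R]_5), 0 <= sg0 * (phi x - phi 0 - (cartan_u delta c x - c))) -> False.
Proof.
move=> d01 sg2 C2phi /nbhs_ballP[r1 /= r10 hr].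
pose e : 'rV[R]_5 := delta_mx 0 0.
pose a := \sum_i (sg0 *: e) 0 i * partial i phi 0.
have [M1 [r2 [r20 h2]]] := C2_taylor_bound (sg0 *: e) C2phi.
have [M2 [r3 [r30 h3]]] := C2_taylor_bound (- sg0 *: e) C2phi.
pose rho := Num.min r1 (Num.min r2 r3).
have aN : \sum_i (- sg0 *: e) 0 i * partial i phi 0 = - a.
  by rewrite /a -sumrN; apply: eq_bigr => i _; rewrite scaleNr mxE mulNr.
apply: (@no_linear_approximation _ delta (sg0 * a) (Num.max M1 M2) rho d01).
  by rewrite !lt_min r10 r20.
move=> h /andP[h0]; rewrite !lt_min => /and3P[k1 k2 k3].
have hpos := sqr_ge0 h.
have m1 : M1 * h ^+ 2 <= Num.max M1 M2 * h ^+ 2 by apply: ler_wpM2r => //; rewrite le_max lexx.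
have m2 : M2 * h ^+ 2 <= Num.max M1 M2 * h ^+ 2 by apply: ler_wpM2r => //; rewrite le_max lexx orbT.
have nN : (- sg0) ^+ 2 = 1 by rewrite sqrrN.
have B (s : R) : s ^+ 2 = 1 -> 0 <= sg0 * (phi (0 + h *: (s *: e)) - phi 0 - s * h `^ (2 - delta)).
  move=> s2; have := hr (h *: (s *: e)); rewrite cartan_u_axis// [c + _]addrC addrK add0r; apply.
  rewrite mx_norm_ball /ball_/= sub0r normrN !normrZ.
  have -> : `|s| = 1 by apply/eqP; rewrite -sqrp_eq1// real_normK ?num_real// s2.
  rewrite mul1r (gtr0_norm h0); apply: le_lt_trans k1.
  by rewrite -[leRHS]mulr1 ler_pM2l// delta_norm.
have := h3 h (introT andP (conj h0 k3)); have := h2 h (introT andP (conj h0 k2)).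
have := B _ sg2; have := B _ nN; rewrite aN -/a.
set p := h `^ _; set f1 := phi (0 + h *: (sg0 *: e)); set f2 := phi (0 + h *: (- sg0 *: e)).
rewrite !ler_norml => b2 b1 /andP[c1 c2] /andP[c3 c4].
have [E|E] : sg0 = 1 \/ sg0 = -1.
  by move/eqP: sg2; rewrite sqrf_eq1 => /orP[/eqP|/eqP]; [left|right].
- by rewrite E in b1 b2 *; clear -b1 b2 c1 c2 c3 c4 m1 m2; split; lra.
- by rewrite E in b1 b2 *; clear -b1 b2 c1 c2 c3 c4 m1 m2; split; lra.
Qed.

Lemma cartan_u_bound delta c x : 0 < delta < 1 -> enorm x <= 1 ->
  `|cartan_u delta c x - c| <= enorm x.
Proof.
move=> /andP[d0 d1] x1; rewrite /cartan_u; have [->|x0] := eqVneq x 0.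
  by rewrite subrr normr0 sqrtr_ge0.
have r0 := enorm_gt0 x0.
rewrite [c + _]addrC addrK normrM normfV (ger0_norm (powR_ge0 _ _)) ler_pdivrMr ?powR_gt0//.
apply: le_trans (cubic_le x) _.
have -> : enorm x ^+ 3 = enorm x * enorm x `^ (1 + delta) * enorm x `^ (1 - delta).
  rewrite -[X in X * _ * _]powRr1 ?ltW// -!powR_add// -powR_mulrn ?ltW//; congr (_ `^ _); ring.
rewrite -[leRHS]mulr1; apply: ler_wpM2l; first by rewrite mulr_ge0// ?powR_ge0 ?ltW.
by apply: powR_le1; rewrite ?r0//; lra.
Qed.

Lemma coord_le_norm n (y : 'rV[R]_n) i : `|y 0 i| <= `|y|.
Proof.
rewrite [leRHS]/Num.norm/= mx_normrE.
exact: (le_bigmax _ (fun ij : 'I_1 * 'I_n => `|y ij.1 ij.2|) (0, i)).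
Qed.

Lemma cartan_u_continuous delta c x : 0 < delta < 1 -> {for x, continuous (cartan_u delta c)}.
Proof.
move=> d01; have [xE|x0] := eqVneq x 0; last first.
  apply: (@cont_near_eq R 5 (fun z => c + cartan_w (1 + delta) z)).
    by near=> z; rewrite cartan_uE//; near: z; exact: near_neq0.
  exact: (contD (@contC R 5 c x) (contM (@cont_cubic R x) (@cont_sqnorm_powR R x _ x0))).
have u0 : cartan_u delta c x = c by rewrite /cartan_u xE eqxx.
suff : forall eps : R, 0 < eps ->
    \forall y \near x, `|cartan_u delta c x - cartan_u delta c y| <= eps.
  by move=> h; exact/(@cvgrPdist_le _ _ _ (nbhs x)).
move=> eps eps0.
(* The balls are those of the sup norm, and the Euclidean norm is at most 5 times it; the minimum
   with 1 keeps y where [cartan_u_bound] applies. *)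
have e5 : 0 < Num.min 1 eps / 5 by rewrite divr_gt0// lt_min ltr01.
have e5E : 5 * (Num.min 1 eps / 5) = Num.min 1 eps by field.
apply/nbhs_ballP; exists (Num.min 1 eps / 5) => //= y yB; rewrite u0 distrC.
have : enorm y <= Num.min 1 eps.
  rewrite -e5E; apply: le_trans (enorm_le_sum y) _.
  have yB' : `|y| < Num.min 1 eps / 5.
    by move: yB; rewrite mx_norm_ball /ball_/= xE sub0r normrN.
  have yi (i : 'I_5) : true -> `|y 0 i| <= Num.min 1 eps / 5.
    by move=> _; exact: le_trans (coord_le_norm y i) (ltW yB').
  apply: le_trans (ler_sum _ yi) _.
  by rewrite sumr_const card_ord -[leLHS]mulr_natl.
rewrite le_min => /andP[y1 y2].
exact: le_trans (cartan_u_bound c d01 y1) y2.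
Unshelve. all: by end_near. Qed.

Lemma conformal_hessian_same_jet n (F G : 'rV[R]_n -> R) (x : 'rV[R]_n) :
  gradient F x = gradient G x -> F x = G x ->
  conformal_hessian G x = conformal_hessian F x + F x *: (hessian G x - hessian F x).
Proof.
have addE (a : R) (H H' S : 'M[R]_n) : a *: H' - S = a *: H - S + a *: (H' - H).
  by rewrite scalerBr addrAC [a *: H + _]addrC subrK.
by rewrite /conformal_hessian => -> ->; exact: addE.
Qed.

Lemma symmetric_scaled_difference n (a : R) (A B : 'M[R]_n) :
  Defs.symmetric A -> Defs.symmetric B -> Defs.symmetric (a *: (A - B)).
Proof. by rewrite /Defs.symmetric => sA sB; rewrite linearZ/= linearB/= sA sB. Qed.

Lemma nonneg_definite_scaled_difference n (a : R) (A B : 'M[R]_n) : 0 <= a ->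
  (forall v : 'rV[R]_n, (v *m A *m v^T) 0 0 <= (v *m B *m v^T) 0 0) ->
  nonneg_definite (a *: (B - A)).
Proof.
move=> a0 AB v; rewrite -scalemxAr -scalemxAl mxE mulr_ge0//.
have -> : (v *m (B - A) *m v^T) 0 0 = (v *m B *m v^T) 0 0 - (v *m A *m v^T) 0 0.
  by rewrite mulmxBr mulmxBl mxE [X in _ + X]mxE.
by rewrite subr_ge0.
Qed.

Lemma solves_of_large delta c : 0 < delta < 1 -> 9 <= c ->
  2 * (1 - delta) / delta + 2 * (9 / 2 * (2 * (1 - delta) / delta) * (285 / (1 - delta) ^+ 5) +
    9 * (200 / (1 - delta) ^+ 4)) <= c ->
  solves_elliptic_conformal_hessian unit_ball (@cartan_u R delta c).
Proof.
move=> d01 c9 cl.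
have above (v p : R) : v - p <= c - c -> 0 <= 1 * (p - c - (v - c)) by move=> ?; lra.
have below (v p : R) : c - c <= v - p -> 0 <= -1 * (p - c - (v - c)) by move=> ?; lra.
pose L := eigenvalue_set delta c; pose K := trace_const delta.
have K0 : 0 <= K by exact: trace_const_ge0.
have Lin x : x != 0 -> enorm x <= 1 -> L (eigenvalues (conformal_hessian (cartan_u delta c) x)).
  by move=> x0 x1; apply: eigenvalues_conformal => //; rewrite enorm_gt0.
have L0 : L !=set0.
  have e0 : (delta_mx 0 0 : 'rV[R]_5) != 0.
    by apply/eqP => /rowP/(_ 0); rewrite !mxE !eqxx => /eqP; rewrite oner_eq0.
  exists (eigenvalues (conformal_hessian (cartan_u delta c) (delta_mx 0 0))); apply: Lin => //.
  by rewrite /enorm sum_ord5 !mxE/= !(expr0n, addr0, expr1n)/= sqrtr1.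
have Lg p q : L p -> L q -> 0 <= gauge K (p - q) by exact: eigenvalue_set_gauge.
pose f := lower_envelope K L.
have fperm : permutation_invariant f by apply: lower_envelope_perm => // s p; exact: eigenvalue_set_perm.
have fmono := lower_envelope_mono K0 L0 Lg.
have fle (A N : 'M[R]_5) : Defs.symmetric A -> Defs.symmetric N -> nonneg_definite N ->
    f (eigenvalues A) <= f (eigenvalues (A + N)).
  move=> sA sN N0; have [s hs] := eigenvalues_mono sA sN N0.
  have d0 i : 0 <= (eigenvalues (A + N) - col_perm s (eigenvalues A)) 0 i.
    by rewrite !mxE subr_ge0.
  have /andP[+ _] := fmono (col_perm s (eigenvalues A)) _ d0.
  rewrite -/f [X in f X - _](_ : _ = eigenvalues (A + N)); last by rewrite addrC subrK.
  rewrite fperm => h; rewrite -subr_ge0; apply: le_trans h; exact: sumr_ge0.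
exists f; split => //.
- exact: lower_envelope_lipschitz.
- exact: uniformly_elliptic_of_mono K0 fperm fmono.
have upos x : enorm x < 1 -> 0 < cartan_u delta c x.
  move=> x1; have := cartan_u_bound c d01 (ltW x1); rewrite ler_norml => /andP[+ _].
  by lra.
split=> [x _|x|x0 phi].
- exact: cartan_u_continuous.
- exact: upos.
move=> x01 C2phi phix0; have u0 := upos _ x01.
have [xE|xn0] := eqVneq x0 0.
  move: C2phi phix0; rewrite xE => C2phi.
  rewrite [cartan_u _ _ 0]/cartan_u eqxx => phi0; split=> H; exfalso.
    apply: (@no_touching delta c phi 1 d01) => //; first by rewrite expr1n.
    by apply: filterS H => y; rewrite phi0; exact: above.
  apply: (@no_touching delta c phi (-1) d01) => //; first by rewrite sqrrN expr1n.
  by apply: filterS H => y; rewrite phi0; exact: below.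
have C2u := C2_near_u delta c xn0.
have fu0 : f (eigenvalues (conformal_hessian (cartan_u delta c) x0)) = 0.
  by apply: lower_envelope_eq0 => //; apply: Lin => //; exact: ltW.
(* Both touching conditions are instances, with u and phi in either order: equal values and
   gradients leave a nonnegative multiple of the difference of Hessians. *)
have comp F G : C2_near F x0 -> C2_near G x0 -> F x0 = G x0 -> 0 < F x0 ->
    (\forall y \near x0, F y - G y <= F x0 - G x0) ->
    f (eigenvalues (conformal_hessian F x0)) <= f (eigenvalues (conformal_hessian G x0)).
  move=> C2F C2G FG F0 loc; have [gE hle] := local_max_compare C2F C2G loc.
  rewrite (conformal_hessian_same_jet gE FG).
  have sF := hessian_sym C2F; have sG := hessian_sym C2G.
  apply: fle.
  - by rewrite /Defs.symmetric linearB/= linearZ/= sF tr_scalar_mx.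
  - exact: symmetric_scaled_difference.
  - exact: nonneg_definite_scaled_difference (ltW F0) hle.
split=> H.
  by rewrite -fu0; apply: comp => //.
rewrite -fu0; apply: comp => //; first by rewrite phix0.
by apply: filterS H => y; rewrite -lerN2 !opprB.
Qed.

End Main.

Theorem theorem1p2 (R : realType) :
  (forall delta : R, 0 < delta < 1 ->
     exists2 c0 : R, 0 < c0 & forall c : R, c0 <= c ->
       solves_elliptic_conformal_hessian unit_ball (cartan_u delta c)) /\
  (forall c : R, 24 * 10 ^+ 4 <= c ->
     solves_elliptic_conformal_hessian unit_ball (cartan_u (2^-1) c)).
Proof.
split=> [delta d01|c c0].
  exists (9 + `|2 * (1 - delta) / delta + 2 * (9 / 2 * (2 * (1 - delta) / delta) *
     (285 / (1 - delta) ^+ 5) + 9 * (200 / (1 - delta) ^+ 4))|).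
    by rewrite ltr_wpDr.
  move=> c; set X := (X in `|X|) => hc; have := ler_norm X; have := normr_ge0 X.
  by move=> X0 X1; apply: solves_of_large => //; rewrite -?/X; lra.
apply: solves_of_large; first by apply/andP; split; lra.
  by lra.
(* The condition becomes 2 + 2 * (9 * 285 * 32 + 9 * 200 * 16) = 221762 <= c. *)
rewrite (_ : 1 - 2^-1 = 2^-1); last by field.
rewrite (_ : 2 * 2^-1 / 2^-1 = 2); last by field.
rewrite !exprVn !invrK.
lra.
Qed.
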